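(* Let $\mathcal{C}$ be an asymptotic class relative to $\chi:\mathcal{C}\to\mathbb{N}$, and let $\mathbf{\Gamma}$ be a definable bipartite graph of finite relative dimension over a definable set $\mathbf{S}$ on $\mathcal{C}$. Then the set of accumulation points of the family of finite graphs $$\{\mathbf{\Gamma}_s(F): F\in\mathcal{C},\ s\in\mathbf{S}(F)\}$$ in the space $\tilde{\mathscr{W}}_0$ of graphons has a set of representatives which is a finite set of stepfunctions.
   Context: **Definable sets.** $\mathcal{C}$ is a class of structures for a fixed first-order language $\mathcal{L}$ (a category with substructure embeddings as morphisms). A definable set $\mathbf{X}$ (without parameters) is an assignment $F\mapsto\mathbf{X}(F)=\varphi(F)=\{a\in F^n: F\models\varphi(a)\}$, $F\in\mathcal{C}$, for some $\mathcal{L}$-formula $\varphi$ in $n\ge 0$ variables (for $n=0$, $\varphi$ is a sentence and the assignment gives its truth value in $F$). A definable function $\pi:\mathbf{X}\to\mathbf{Y}$ of definable sets is given by a definable subset of $\mathbf{X}\times\mathbf{Y}$ which for every $F\in\mathcal{C}$ is the graph of a function $\pi_F:\mathbf{X}(F)\to\mathbf{Y}(F)$. A definable function from a definable set $\mathbf{S}$ to an arbitrary set $E$ is given by finitely many values $e_1,\dots,e_n\in E$ and finitely many definable subsets $\mathbf{S}_i\subseteq\mathbf{S}$ such that for each $F\in\mathcal{C}$, $\mathbf{S}(F)=\coprod_i\mathbf{S}_i(F)$ and the function takes the value $e_i$ on $\mathbf{S}_i(F)$. A definable set $\mathbf{X}$ over $\mathbf{S}$ is a definable function $\pi:\mathbf{X}\to\mathbf{S}$;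 for $s\in\mathbf{S}(F)$, its fibre is $\mathbf{X}_s(F)=\pi_F^{-1}(s)$. Products of definable sets over $\mathbf{S}$ are fibre products over $\mathbf{S}$. **Relative asymptotic class.** $\mathcal{C}$ is an asymptotic class relative to $\chi:\mathcal{C}\to\mathbb{N}$ if for every definable set $\mathbf{X}$ over a definable set $\mathbf{S}$ there are definable functions $\mu_{\mathbf{X}}:\mathbf{S}\to\mathbb{Q}\cup\{\infty\}$ and $d_{\mathbf{X}}:\mathbf{S}\to\mathbb{N}\cup\{\infty\}$, with $\mu_{\mathbf{X}}(s)<\infty$ if and only if $d_{\mathbf{X}}(s)<\infty$, such that for every $\epsilon>0$ there is $N>0$ such that for every $F\in\mathcal{C}$ with $\chi(F)>N$ and every $s\in\mathbf{S}(F)$, $$\left||\mathbf{X}_s(F)|-\mu_{\mathbf{X}}(s)\chi(F)^{d_{\mathbf{X}}(s)}\right|\leq\epsilon\,\chi(F)^{d_{\mathbf{X}}(s)}$$ (a condition with content when $d_{\mathbf{X}}(s)$ is finite). $\mathbf{X}\to\mathbf{S}$ is of finite relative dimension if $d_{\mathbf{X}}$ takes values in $\mathbb{N}$. **Definable graphs.** A definable bipartite graph over $\mathbf{S}$ is a triple $\mathbf{\Gamma}=(\mathbf{U},\mathbf{V},\mathbf{E})$ with $\mathbf{U}$, $\mathbf{V}$ and $\mathbf{E}\subseteq\mathbf{U}\times\mathbf{V}$ definable sets over $\mathbf{S}$; $\mathbf{\Gamma}_s(F)=(\mathbf{U}_s(F),\mathbf{V}_s(F),\mathbf{E}_s(F))$.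 It is of finite relative dimension if its constituent definable sets over $\mathbf{S}$ are. **Graphons.** A kernel is an essentially bounded measurable function $[0,1]^2\to\mathbb{R}$ (not assumed symmetric), up to null sets; a graphon is a kernel $W$ with $0\le W\le1$; $\mathscr{W}_0$ is the set of graphons. A stepfunction is a kernel $W$ such that there are finite partitions $[0,1]=\coprod_{i=1}^n U_i=\coprod_{j=1}^m V_j$ into measurable sets with $W$ constant on each $U_i\times V_j$. A finite bipartite graph $(U,V,E)$ is identified with the graphon obtained by partitioning $[0,1]$ into intervals $U_i$ ($i\in U$) of length $1/|U|$ and into intervals $V_j$ ($j\in V$) of length $1/|V|$, with value $1$ on $U_i\times V_j$ if $(i,j)\in E$ and $0$ otherwise. The cut norm is $\|W\|_\square=\sup_{A,B\subseteq[0,1]}\left|\int_{A\times B}W\,dx\,dy\right|$ ($A,B$ measurable), and the cut distance is $\delta_\square(U,W)=\inf_{\varphi,\psi}\|U-W^{\varphi,\psi}\|_\square$, where $\varphi,\psi$ range over invertible measure-preserving maps $[0,1]\to[0,1]$ and $W^{\varphi,\psi}(x,y)=W(\varphi(x),\psi(y))$. $\tilde{\mathscr{W}}_0$ is the metric space obtained from $(\mathscr{W}_0,\delta_\square)$ by identifying graphons at distance $0$.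
   Formalization: In an asymptotic class μ=0 is allowed only with d=0, and d=∞ only for fibres that are infinite or outgrow every power of χ; accumulation points are taken along χ(F)→∞. Literally the claim fails, e.g. for all finite digraphs with χ=0 or χ=2^|F|. *)

(* Defs.v *)
From mathcomp Require Import all_boot all_order all_algebra.
From mathcomp Require Import all_classical all_reals all_analysis.
Set Implicit Arguments.
Unset Strict Implicit.
Unset Printing Implicit Defensive.
Import Order.TTheory GRing.Theory Num.Theory.
Local Open Scope classical_set_scope.
Local Open Scope card_scope.
Local Open Scope ring_scope.

(** * First-order logic *)

Record language := Language {
  fsym : Type; farity : fsym -> nat;
  rsym : Type; rarity : rsym -> nat }.

Record structure (L : language) := Structure {
  carrier :> Type;
  finterp : forall f : fsym L, ('I_(farity f) -> carrier) -> carrier;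
  rinterp : forall r : rsym L, ('I_(rarity r) -> carrier) -> Prop }.

Inductive term (L : language) (n : nat) : Type :=
| Var of 'I_n
| App (f : fsym L) of ('I_(farity f) -> term L n).

(* Formulas whose free variables are among the n variables indexed by 'I_n.
   The quantifier binds the last variable; the connectives listed form a
   complete set for the classical semantics [sat]. *)
Inductive formula (L : language) (n : nat) : Type :=
| FFalse
| FEq of term L n & term L n
| FRel (r : rsym L) of ('I_(rarity r) -> term L n)
| FImp of formula L n & formula L n
| FAll of formula L n.+1.
Arguments FFalse {L n}.

Section semantics.
Variables (L : language) (F : structure L).

Fixpoint eval n (a : 'I_n -> F) (t : term L n) : F :=
  match t with
  | Var i => a i
  | App f ts => finterp (fun i => eval a (ts i))
  end.

Definition extend n (a : 'I_n -> F) (x : F) : 'I_n.+1 -> F :=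
  fun i => if unlift ord_max i is Some j then a j else x.

Fixpoint sat n (p : formula L n) : ('I_n -> F) -> Prop :=
  match p with
  | FFalse => fun=> False
  | FEq t u => fun a => eval a t = eval a u
  | FRel r ts => fun a => rinterp (fun i => eval a (ts i))
  | FImp p q => fun a => sat p a -> sat q a
  | FAll p => fun a => forall x, sat p (extend a x)
  end.

Definition cat_val n m (a : 'I_n -> F) (b : 'I_m -> F) : 'I_(n + m) -> F :=
  fun i => match fintype.split i with inl j => a j | inr k => b k end.

(* The set X(F) for the definable set X given by the formula p. *)
Definition points n (p : formula L n) : set ('I_n -> F) := [set a | sat p a].

End semantics.
Arguments points {L} F {n} p.

(** * Definable sets and functions on a class C of structures *)

Section definable.
Variables (L : language) (C : set (structure L)).

Definition definable_function n m
    (X : formula L n) (Y : formula L m) (g : formula L (n + m)) : Prop :=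
  forall F, C F ->
    (forall (a : 'I_n -> F) (b : 'I_m -> F),
       points F g (cat_val a b) -> points F X a /\ points F Y b) /\
    (forall a, points F X a -> exists! b, points F g (cat_val a b)).

(* Definable functions from a definable set S to a set T.  The values of f
   outside S(F), or at F not in C, are irrelevant. *)
Definition definable_valued m (S : formula L m) (T : Type)
    (f : forall F : structure L, ('I_m -> F) -> T) : Prop :=
  exists (k : nat) (e : 'I_k -> T) (P : 'I_k -> formula L m),
  forall F, C F ->
    [/\ forall i, points F (P i) `<=` points F S,
        forall s, points F S s -> exists! i, points F (P i) s
      & forall i s, points F (P i) s -> f F s = e i].

Record defset_over m (S : formula L m) (n : nat) := DefsetOver {
  do_set : formula L n;
  do_map : formula L (n + m);
  do_mapP : definable_function do_set S do_map }.

Definition fibre m (S : formula L m) n (X : defset_over S n)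
    (F : structure L) (s : 'I_m -> F) : set ('I_n -> F) :=
  [set a | points F (do_map X) (cat_val a s)].

(** * Relative asymptotic classes *)

(* mu and d are a measure and a dimension for X over S, with None standing for
   infinity.  As usual for asymptotic classes, (d, mu) = (0, 0) is the only
   value allowed with mu = 0.  The last clause gives the meaning of infinite
   dimension: the fibre is infinite or outgrows every power of chi.  Without
   these two conventions every class of finite structures would be
   asymptotic, with mu = d = oo, or with mu = 0 and d = 1 for a fast growing
   chi. *)
Definition has_asymptotics (chi : structure L -> nat) m (S : formula L m) n
    (X : defset_over S n)
    (mu : forall F : structure L, ('I_m -> F) -> option rat)
    (d : forall F : structure L, ('I_m -> F) -> option nat) : Prop :=
  [/\ definable_valued S mu /\ definable_valued S d,
      forall F, C F -> forall s, points F S s ->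
        mu F s <> None <-> d F s <> None,
      forall F, C F -> forall s, points F S s ->
        mu F s = Some 0 -> d F s = Some 0%N,
      forall eps : rat, 0 < eps -> exists2 N : nat, (0 < N)%N &
        forall F, C F -> (N < chi F)%N -> forall s, points F S s ->
        forall q k, mu F s = Some q -> d F s = Some k ->
        exists2 c : nat, fibre X s #= `I_c &
          `|c%:R - q * (chi F)%:R ^+ k| <= eps * (chi F)%:R ^+ k
    & forall k : nat, exists N : nat,
        forall F, C F -> (N < chi F)%N -> forall s, points F S s ->
        d F s = None ->
        forall c : nat, fibre X s #= `I_c -> (chi F ^ k < c)%N].

Definition asymptotic_class (chi : structure L -> nat) : Prop :=
  forall m (S : formula L m) n (X : defset_over S n),
  exists mu d, has_asymptotics chi X mu d.

Definition finite_relative_dimension (chi : structure L -> nat)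
    m (S : formula L m) n (X : defset_over S n) : Prop :=
  exists mu d, has_asymptotics chi X mu d /\
    forall F, C F -> forall s, points F S s -> d F s <> None.

(** * Definable bipartite graphs *)

(* E is a definable set over S contained in the fibre product of U and V
   over S. *)
Record defgraph_over m (S : formula L m) := DefgraphOver {
  dg_nU : nat; dg_nV : nat;
  dg_U : defset_over S dg_nU;
  dg_V : defset_over S dg_nV;
  dg_E : defset_over S (dg_nU + dg_nV);
  dg_sub : forall F, C F -> forall s, points F S s -> forall u v,
    fibre dg_E s (cat_val u v) -> fibre dg_U s u /\ fibre dg_V s v }.

Definition graph_finite_relative_dimension (chi : structure L -> nat)
    m (S : formula L m) (G : defgraph_over S) : Prop :=
  [/\ finite_relative_dimension chi (dg_U G),
      finite_relative_dimension chi (dg_V G)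
    & finite_relative_dimension chi (dg_E G)].

End definable.

(** * Graphons *)

Definition unit_itv (R : realType) : set R := `[0, 1].

Section graphons.
Variable R : realType.
Implicit Types W : R * R -> R.

Local Notation I01 := (@unit_itv R).
Local Notation leb := (@lebesgue_measure R).

(* Kernels are represented by functions on R * R of which only the restriction
   to [0, 1]^2 matters; changing them on null sets does not affect the cut
   distance. *)
Definition is_graphon W : Prop :=
  measurable_fun (I01 `*` I01) W /\
  forall z, (I01 `*` I01) z -> 0 <= W z <= 1.

Definition finite_partition n (A : 'I_n -> set R) : Prop :=
  [/\ forall i, measurable (A i), trivIset setT A & \bigcup_i A i = I01].

Definition is_stepfunction W : Prop :=
  exists (n m : nat) (A : 'I_n -> set R) (B : 'I_m -> set R),
    [/\ finite_partition A, finite_partition B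
      & forall i j, exists c : R, forall z, (A i `*` B j) z -> W z = c].

Definition cut_norm W : \bar R :=
  ereal_sup [set `| \int[(leb \x leb)%E]_(z in A `*` B) (W z)%:E |%E
    | A in [set A | measurable A /\ A `<=` I01]
    & B in [set B | measurable B /\ B `<=` I01]].

Definition invertible_measure_preserving (f : R -> R) : Prop :=
  [/\ set_bij I01 I01 f, measurable_fun I01 f,
      forall A, measurable A -> A `<=` I01 -> measurable (f @` A)
    & forall A, measurable A -> A `<=` I01 -> leb (I01 `&` f @^-1` A) = leb A].

Definition cut_distance W1 W2 : \bar R :=
  ereal_inf [set cut_norm (fun z => W1 z - W2 (f z.1, g z.2))
    | f in invertible_measure_preserving & g in invertible_measure_preserving].

(* The point of the space of graphons represented by W. *)
Definition graphon_class W : set (R * R -> R) :=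
  [set W' | is_graphon W' /\ cut_distance W W' = 0%E].

(* The index of the interval containing x in the partition of [0, 1] into
   n.+1 intervals of equal length. *)
Definition interval_index n (x : R) : 'I_n.+1 :=
  inord (minn n (Num.truncn (n.+1%:R * x))).

(* W is the graphon attached to the finite bipartite graph (U, V, E), for some
   ordering of the vertices.  The construction requires U and V to be
   nonempty. *)
Definition is_graph_graphon (TU TV : Type) (U : set TU) (V : set TV)
    (E : TU -> TV -> Prop) W : Prop :=
  exists (n m : nat) (u : 'I_n.+1 -> TU) (v : 'I_m.+1 -> TV),
    [/\ set_bij setT U u, set_bij setT V v
      & forall z, W z =
          (`[< E (u (interval_index n z.1)) (v (interval_index m z.2)) >])%:R].

Section accumulation.
Variables (L : language) (C : set (structure L)) (chi : structure L -> nat).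
Variables (m : nat) (S : formula L m) (G : defgraph_over C S).

(* Accumulation is taken along chi(F) -> oo, since being an asymptotic class
   says nothing about the structures with bounded chi. *)
Definition is_cluster_graphon W : Prop :=
  forall (eps : R) (N : nat), 0 < eps ->
  exists F, [/\ C F, (N < chi F)%N &
    exists2 s, points F S s &
    exists2 W', is_graph_graphon (fibre (dg_U G) s) (fibre (dg_V G) s)
                  (fun u v => fibre (dg_E G) s (cat_val u v)) W'
              & (cut_distance W' W < eps%:E)%E].

Definition accumulation_points : set (set (R * R -> R)) :=
  [set graphon_class W | W in [set W | is_graphon W /\ is_cluster_graphon W]].

End accumulation.
End graphons.

(* Main.v *)
(* Write f_v for the indicator function of the neighbourhood of a vertex v of V,
   a function on U. The codegrees <f_v, f_w> are sizes of definable sets, so,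
   relative to |U|, they take finitely many asymptotic values. Call v and v'
   equivalent if the asymptotic values of the codegrees of (v, w) and (v', w)
   agree for all w in V outside a set of relative measure 0; this is a definable
   relation, again by the asymptotics. The operator g |-> (w |-> <g, f_w>) has
   Hilbert-Schmidt norm at most 1, hence maps bounded sets to uniformly totally
   bounded ones; since inequivalent vertices have images of f_v at distance
   bounded below, the number of classes is bounded. Codegrees being nearly
   constant on classes, a Gram matrix computation shows that the graph is close
   in cut norm to its average over the classes of V. Doing the same for U and
   averaging in both variables gives a step function with boundedly many steps,
   whose relative step sizes and densities are ratios of sizes of definable sets
   and thus have finitely many asymptotic values. So, as chi(F) tends to
   infinity, the graphs approach a finite set of step functions, and every
   accumulation point is at distance 0 from one of these. *)
Require Import Defs.
From mathcomp Require Import all_boot all_order all_fingroup all_algebra.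
From mathcomp Require Import all_classical all_reals all_analysis.
From mathcomp Require Import measurable_realfun.
From mathcomp Require Import ring lra zify.
Set Implicit Arguments.
Unset Strict Implicit.
Unset Printing Implicit Defensive.
Import Order.TTheory GRing.Theory Num.Theory.
Import numFieldNormedType.Exports.
Local Open Scope classical_set_scope.
Local Open Scope card_scope.
Local Open Scope ring_scope.

(** * Definable predicates *)

(** The hypothesis speaks of definable families only, for large [chi] and up to an error. A newly
    formed family might have infinite dimension; this is excluded by bounding it by a count already
    known to be of polynomial size, which [tame] records. Having nearly equal codegrees is neither
    transitive nor definable, but the finitely many asymptotic values are separated by a gap that
    does not depend on the structure; comparing them is definable and, once the errors are small
    against the gap, gives an equivalence relation. The bound on the number of classes must be
    uniform as well. Compactness is therefore made quantitative by sampling: k^2 vertices, with k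
    depending on the gaps only, control the mean square distance of any two codegree vectors, and
    the asymptotic codegrees with the sample form a signature that determines the class. Labels of
    classes are chosen separately in each structure, with no definability claimed. Sizes and
    densities are therefore treated as definable functions of vertices lying in the classes, and the
    finite list of step functions consists of all assignments of asymptotic values to labels. *)

Definition lsub (T : Type) n m (a : 'I_(n + m) -> T) : 'I_n -> T :=
  fun i => a (lshift m i).
Definition rsub (T : Type) n m (a : 'I_(n + m) -> T) : 'I_m -> T :=
  fun i => a (rshift n i).

Section renaming.
Variables (L : language) (F : structure L).

Lemma lsub_cat n m (a : 'I_n -> F) (b : 'I_m -> F) : lsub (cat_val a b) = a.
Proof.
apply/funext => i; rewrite /lsub /cat_val.
by have -> : lshift m i = unsplit (inl i) by []; rewrite unsplitK.
Qed.

Lemma rsub_cat n m (a : 'I_n -> F) (b : 'I_m -> F) : rsub (cat_val a b) = b.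
Proof.
apply/funext => i; rewrite /rsub /cat_val.
by have -> : rshift n i = unsplit (inr i) by []; rewrite unsplitK.
Qed.

Lemma cat_sub n m (a : 'I_(n + m) -> F) : cat_val (lsub a) (rsub a) = a.
Proof.
by apply/funext => i; rewrite /cat_val /lsub /rsub -{2}(splitK i); case: splitP.
Qed.

Definition ren_up n m (f : 'I_n -> 'I_m) : 'I_n.+1 -> 'I_m.+1 :=
  fun i => if unlift ord_max i is Some j then lift ord_max (f j) else ord_max.

Fixpoint ren_term n m (f : 'I_n -> 'I_m) (t : term L n) : term L m :=
  match t with
  | Var i => @Var L m (f i)
  | App g ts => App (fun i => ren_term f (ts i))
  end.

Fixpoint ren n m (f : 'I_n -> 'I_m) (p : formula L n) : formula L m :=
  match p with
  | FFalse => FFalse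
  | FEq t u => FEq (ren_term f t) (ren_term f u)
  | FRel r ts => FRel (fun i => ren_term f (ts i))
  | FImp p q => FImp (ren f p) (ren f q)
  | FAll p => FAll (ren (ren_up f) p)
  end.

Lemma eval_ren n m (f : 'I_n -> 'I_m) (t : term L n) (a : 'I_m -> F) :
  Defs.eval a (ren_term f t) = Defs.eval (fun i => a (f i)) t.
Proof. by elim: t => //= g ts IH; congr (finterp _); apply/funext => i. Qed.

Lemma sat_ren n m (f : 'I_n -> 'I_m) (p : formula L n) (a : 'I_m -> F) :
  sat (ren f p) a <-> sat p (fun i => a (f i)).
Proof.
elim: p m f a => {n} [n|n t u|n r ts|n p IHp q IHq|n p IH] m f a //=.
- by rewrite !eval_ren.
- suff -> : (fun i => Defs.eval a (ren_term f (ts i))) =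
            (fun i => Defs.eval (fun i => a (f i)) (ts i)) by [].
  by apply/funext => i; exact: eval_ren.
- by split=> H /IHp /H /IHq.
- have E x : (fun i => extend a x (ren_up f i)) = extend (fun i => a (f i)) x.
    apply/funext => i; rewrite /extend /ren_up.
    by case: (unlift ord_max i) => [j|]; rewrite ?liftK ?unlift_none.
  by split=> H x; [have /IH := H x; rewrite E|apply/IH; rewrite E].
Qed.

End renaming.

Section definable_predicates.
Variables (L : language) (C : set (structure L)).

Definition predicate k := forall F : structure L, ('I_k -> F) -> Prop.

(** Stated for predicates up to agreement on the structures of [C], so that closure lemmas replace
    the writing of explicit formulas. *)
Definition definable k (P : predicate k) : Prop :=
  exists p : formula L k, forall F, C F -> forall a, sat p a <-> P F a.

Lemma definable_ext k (P Q : predicate k) :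
  (forall F, C F -> forall a, P F a <-> Q F a) -> definable P -> definable Q.
Proof.
by move=> PQ [p hp]; exists p => F CF a; rewrite (hp F CF) (PQ F CF).
Qed.

Lemma definable_points k (p : formula L k) : definable (fun F => points F p).
Proof. by exists p. Qed.

Lemma definable_false k : definable (fun F (a : 'I_k -> F) => False).
Proof. by exists FFalse. Qed.

Lemma definable_imp k (P Q : predicate k) :
  definable P -> definable Q -> definable (fun F a => P F a -> Q F a).
Proof.
by move=> [p hp] [q hq]; exists (FImp p q) => F CF a /=; rewrite hp // hq.
Qed.

Lemma definable_not k (P : predicate k) :
  definable P -> definable (fun F a => ~ P F a).
Proof. by move=> hP; apply: definable_imp hP (definable_false k). Qed.

Lemma definable_and k (P Q : predicate k) :
  definable P -> definable Q -> definable (fun F a => P F a /\ Q F a).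
Proof.
move=> hP hQ.
apply: definable_ext (definable_not (definable_imp hP (definable_not hQ))).
move=> F _ a; split=> [nPQ|[p q] /(_ p)//].
by split; apply: contrapT => n; apply: nPQ.
Qed.

Lemma definable_or k (P Q : predicate k) :
  definable P -> definable Q -> definable (fun F a => P F a \/ Q F a).
Proof.
move=> hP hQ; apply: definable_ext (definable_imp (definable_not hP) hQ).
move=> F _ a; split=> [nPQ|[//|//]].
by have [p|/nPQ q] := pselect (P F a); [left|right].
Qed.

Lemma definable_exists_in k (V : eqType) (s : seq V) (P : V -> predicate k) :
  (forall v, definable (P v)) ->
  definable (fun F a => exists2 v, v \in s & P v F a).
Proof.
move=> hP; elim: s => [|v s IH].
  by apply: definable_ext (definable_false k) => F _ a; split=> // -[].
apply: definable_ext (definable_or (hP v) IH) => F _ a; split.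
  case=> [Pv|[w ws Pw]]; first by exists v; rewrite ?mem_head.
  by exists w => //; rewrite inE ws orbT.
by case=> w; rewrite inE => /orP[/eqP->|ws] Pw; [left|right; exists w].
Qed.

Lemma definable_forall_ord k l (P : 'I_l -> predicate k) :
  (forall i, definable (P i)) -> definable (fun F a => forall i, P i F a).
Proof.
move=> hP; have := definable_not (definable_exists_in (enum 'I_l)
  (fun i => definable_not (hP i))).
apply: definable_ext => F _ a; split=> [nP i|H [i _]]; last exact.
by apply: contrapT => nPi; apply: nP; exists i; rewrite ?mem_enum.
Qed.

Lemma definable_eq k (i j : 'I_k) :
  definable (fun F (a : 'I_k -> F) => a i = a j).
Proof. by exists (FEq (@Var L k i) (@Var L k j)). Qed.

Lemma definable_ren k l (f : 'I_k -> 'I_l) (P : predicate k) :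
  definable P -> definable (fun F a => P F (fun i => a (f i))).
Proof.
by move=> [p hp]; exists (ren f p) => F CF a; rewrite sat_ren hp.
Qed.

Definition predicate2 k l :=
  forall F : structure L, ('I_k -> F) -> ('I_l -> F) -> Prop.
Definition predicate3 k l m :=
  forall F : structure L, ('I_k -> F) -> ('I_l -> F) -> ('I_m -> F) -> Prop.

Definition definable2 k l (P : predicate2 k l) : Prop :=
  definable (fun F (a : 'I_(k + l) -> F) => P F (lsub a) (rsub a)).
Definition definable3 k l m (P : predicate3 k l m) : Prop :=
  definable (fun F (a : 'I_(k + l + m) -> F) =>
    P F (lsub (lsub a)) (rsub (lsub a)) (rsub a)).

(** As a substitution of variables, this places two blocks independently inside a longer tuple. *)
Definition copair (T : Type) n m (f : 'I_n -> T) (g : 'I_m -> T)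
    (i : 'I_(n + m)) : T :=
  match fintype.split i with inl j => f j | inr k => g k end.

Lemma copair_lshift (T : Type) n m (f : 'I_n -> T) (g : 'I_m -> T) i :
  copair f g (lshift m i) = f i.
Proof. by rewrite /copair (_ : lshift m i = unsplit (inl i)) // unsplitK. Qed.

Lemma copair_rshift (T : Type) n m (f : 'I_n -> T) (g : 'I_m -> T) i :
  copair f g (rshift n i) = g i.
Proof. by rewrite /copair (_ : rshift n i = unsplit (inr i)) // unsplitK. Qed.

(** Every reordering, repetition or weakening of variable blocks is an instance: the index maps say
    at which coordinates of the ambient tuple each block is read. *)
Lemma definable_ren2 k l n (P : predicate2 k l) (f : 'I_k -> 'I_n)
    (g : 'I_l -> 'I_n) : definable2 P ->
  definable (fun F a => P F (fun i => a (f i)) (fun i => a (g i))).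
Proof.
move=> /(definable_ren (copair f g)); apply: definable_ext => F _ a.
rewrite /lsub /rsub.
under eq_fun do rewrite copair_lshift.
by under [X in P F _ X]eq_fun do rewrite copair_rshift.
Qed.

Lemma definable_ren3 k l m n (P : predicate3 k l m) (f : 'I_k -> 'I_n)
    (g : 'I_l -> 'I_n) (h : 'I_m -> 'I_n) : definable3 P ->
  definable (fun F a =>
    P F (fun i => a (f i)) (fun i => a (g i)) (fun i => a (h i))).
Proof.
move=> /(definable_ren (copair (copair f g) h)); apply: definable_ext => F _ a.
rewrite /lsub /rsub.
under eq_fun do rewrite !copair_lshift.
under [X in P F _ X _]eq_fun do rewrite copair_lshift copair_rshift.
by under [X in P F _ _ X]eq_fun do rewrite copair_rshift.
Qed.

(** * Finitely valued definable functions and tame counting functions *)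

Definition valuation k (V : Type) := forall F : structure L, ('I_k -> F) -> V.

Definition finitely_valued k (T : predicate k) (V : eqType)
    (f : valuation k V) : Prop :=
  (exists s : seq V, forall F, C F -> forall a, T F a -> f F a \in s) /\
  forall v, definable (fun F a => T F a /\ f F a = v).

(** Only finitely many values occur on [T], so the predicate is a finite disjunction of level
    sets. *)
Lemma definable_level k (T : predicate k) (V : eqType) (f : valuation k V)
    (Q : V -> Prop) :
  finitely_valued T f -> definable (fun F a => T F a /\ Q (f F a)).
Proof.
move=> [[s hs] hf].
apply: definable_ext (definable_exists_in [seq v <- s | `[< Q v >]] hf).
move=> F CF a; split=> [[v]|[Ta Qf]].
  by rewrite mem_filter => /andP[/asboolP Qv _] [Ta ->].
exists (f F a) => //; rewrite mem_filter (hs F CF) // andbT.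
exact/asboolP.
Qed.

Lemma finitely_valued_comp k (T : predicate k) (V W : eqType) (h : V -> W)
    (f : valuation k V) : finitely_valued T f ->
  finitely_valued T (fun F a => h (f F a)).
Proof.
move=> hf; split=> [|w]; last exact: definable_level (fun v => h v = w) hf.
by have [[s hs] _] := hf; exists (map h s) => F CF a Ta; rewrite map_f ?hs.
Qed.

Lemma finitely_valued_pair k (T : predicate k) (V W : eqType)
    (f : valuation k V) (g : valuation k W) : finitely_valued T f ->
  finitely_valued T g -> finitely_valued T (fun F a => (f F a, g F a)).
Proof.
move=> [[s hs] hf] [[t ht] hg]; split=> [|[v w]].
  exists [seq (x, y) | x <- s, y <- t] => F CF a Ta.
  by apply/allpairsP; exists (f F a, g F a); rewrite hs ?ht.
apply: definable_ext (definable_and (hf v) (hg w)) => F _ a.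
by split=> [[[Ta ->] [_ ->]]//|[Ta [-> ->]]].
Qed.

Lemma finitely_valued_ren k l (T : predicate k) (T' : predicate l)
    (h : 'I_k -> 'I_l) (V : eqType) (f : valuation k V) :
  definable T' ->
  (forall F, C F -> forall a, T' F a -> T F (fun i => a (h i))) ->
  finitely_valued T f -> finitely_valued T' (fun F a => f F (fun i => a (h i))).
Proof.
move=> dT' TT' [[s hs] hf]; split.
  by exists s => F CF a T'a; apply: hs => //; exact: TT'.
move=> v; apply: definable_ext (definable_and dT' (definable_ren h (hf v))).
move=> F CF a; split=> [[? [_ ?]]//|[T'a fv]]; split=> //; split=> //.
exact: TT'.
Qed.

Lemma definable_valued_finite k (p : formula L k) (V : eqType)
    (f : valuation k V) :
  definable_valued C p f -> finitely_valued (fun F => points F p) f.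
Proof.
move=> [n [e [P hP]]]; split.
  exists (codom e) => F CF a pa; have [_ /(_ _ pa)[i [Pi _]] fP] := hP F CF.
  by rewrite (fP i) ?codom_f.
move=> v.
(* Distinct pieces may carry the same value, so a level set is a union of pieces. *)
have := definable_exists_in [seq i <- enum 'I_n | e i == v]
  (fun i => definable_points (P i)).
apply: definable_ext => F CF a; have [sP uP fP] := hP F CF; split.
  case=> i; rewrite mem_filter => /andP[/eqP <- _] Pa.
  by split; [exact: (sP i)|exact: fP].
case=> pa fv; have [i [Pi _]] := uP a pa; exists i => //.
by rewrite mem_filter mem_enum -(fP i _ Pi) fv eqxx.
Qed.

End definable_predicates.

(* Infinite sets have ncard 0. *)
(** * Asymptotics of definable families *)

Definition ncard (T : Type) (A : set T) : nat := xget 0%N [set n | A #= `I_n].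

Lemma ncardE (T : Type) (A : set T) n : A #= `I_n -> ncard A = n.
Proof.
move=> An; apply: xget_unique => //= l Al; apply/esym/card_eq_II.
by rewrite card_eq_sym in An; exact: card_eq_trans An Al.
Qed.

Lemma ncard_finite (T : Type) (A : set T) : finite_set A -> A #= `I_(ncard A).
Proof. by move/finite_setP => ex; exact: (xgetPex 0%N ex). Qed.

Lemma ncard_bij (T U : Type) (A : set T) (B : set U) (f : T -> U) :
  set_bij A B f -> ncard A = ncard B.
Proof.
move=> fb; congr xget; rewrite predeqE => n /=.
have AB : A #= B by exact: pcard_eq (bij_of_set_bijection fb).
split=> [|Bn]; last exact: card_eq_trans AB Bn.
by rewrite card_eq_sym in AB; exact: card_eq_trans AB.
Qed.

Section tame.
Variables (L : language) (C : set (structure L)) (chi : structure L -> nat).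
Variable R : realType.
Local Notation definable := (definable C).
Local Notation definable2 := (definable2 C).
Local Notation finitely_valued := (finitely_valued C).

Definition for_large k (T P : predicate L k) : Prop :=
  exists N : nat, forall F, C F -> (N < chi F)%N -> forall a, T F a -> P F a.

Lemma for_large_mono k (T P Q : predicate L k) :
  (forall F, C F -> (0 < chi F)%N -> forall a, T F a -> P F a -> Q F a) ->
  for_large T P -> for_large T Q.
Proof.
move=> PQ [N hN]; exists N => F CF NF a Ta.
apply: PQ => //; last exact: hN.
exact: leq_ltn_trans NF.
Qed.

Lemma for_large_and k (T P Q : predicate L k) :
  for_large T P -> for_large T Q -> for_large T (fun F a => P F a /\ Q F a).
Proof.
move=> [N hN] [M hM]; exists (maxn N M) => F CF; rewrite gtn_max => /andP[NF MF].
by move=> a Ta; split; [exact: hN|exact: hM].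
Qed.

(** The threshold may depend on the value of [f], since the maximum over finitely many values serves
    for all. Error margins can thus be chosen in terms of the measures and dimensions at hand. *)
Lemma for_large_levels k (T P : predicate L k) (V : eqType)
    (f : valuation L k V) :
  finitely_valued T f ->
  (forall v, for_large T (fun F a => f F a = v -> P F a)) -> for_large T P.
Proof.
move=> [[s hs] _] hP.
suff : for_large T (fun F a => forall v, v \in s -> f F a = v -> P F a).
  by apply: for_large_mono => F CF _ a Ta /(_ (f F a)); apply=> //; exact: hs.
elim: s {hs} => [|v s IH]; first by exists 0%N.
apply: for_large_mono (for_large_and (hP v) IH) => F CF _ a Ta [h1 h2] w.
by rewrite inE => /orP[/eqP->|]; [exact: h1|exact: h2].
Qed.

Lemma for_large_chi k (T : predicate L k) (M : R) :
  for_large T (fun F a => M <= (chi F)%:R).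
Proof.
exists (Num.truncn M) => F _ MF _ _; apply: ltW.
have [M0|M0] := leP 0 M; last exact: lt_le_trans M0 (ler0n _ _).
by rewrite (lt_le_trans (truncnS_gt M)) // ler_nat.
Qed.

(** No set is mentioned, so that products of counts are covered too. The last clause makes division
    possible: a vanishing measure would otherwise say nothing about the relative size of a nonempty
    set. *)
Definition tame k (T : predicate L k) (x : valuation L k nat) : Prop :=
  exists (mu : valuation L k R) (d : valuation L k nat),
  [/\ finitely_valued T mu, finitely_valued T d,
      forall eps : R, 0 < eps -> for_large T (fun F a =>
        `|(x F a)%:R - mu F a * (chi F)%:R ^+ d F a| <= eps * (chi F)%:R ^+ d F a)
    & for_large T (fun F a => (0 < x F a)%N -> 0 < mu F a)].

Lemma tame_ren k l (T : predicate L k) (T' : predicate L l) (h : 'I_k -> 'I_l)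
    (x : valuation L k nat) :
  definable T' ->
  (forall F, C F -> forall a, T' F a -> T F (fun i => a (h i))) ->
  tame T x -> tame T' (fun F a => x F (fun i => a (h i))).
Proof.
move=> dT' TT' [mu [d [fmu fd xe xp]]].
exists (fun F a => mu F (fun i => a (h i))), (fun F a => d F (fun i => a (h i))).
have pull (P : predicate L k) :
    for_large T P -> for_large T' (fun F a => P F (fun i => a (h i))).
  by move=> [N hN]; exists N => F CF NF a T'a; apply: hN => //; exact: TT'.
split; [exact: finitely_valued_ren fmu|exact: finitely_valued_ren fd| |].
- by move=> eps e0; exact: pull (xe eps e0).
- exact: pull xp.
Qed.

Lemma tame_mul k (T : predicate L k) (x y : valuation L k nat) :
  tame T x -> tame T y -> tame T (fun F a => x F a * y F a)%N.
Proof.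
move=> [mu [d [fmu fd xe xp]]] [nu [e [fnu fe ye yp]]].
exists (fun F a => mu F a * nu F a), (fun F a => d F a + e F a)%N.
split.
- exact: (finitely_valued_comp (fun p => p.1 * p.2)
    (finitely_valued_pair fmu fnu)).
- exact: (finitely_valued_comp (fun p => p.1 + p.2)%N
    (finitely_valued_pair fd fe)).
- move=> eps e0.
  apply: (for_large_levels (finitely_valued_pair fmu fnu)) => -[m n].
  pose D := `|m| + `|n| + 1.
  have D0 : 0 < D by rewrite /D ltr_wpDl ?addr_ge0.
  (* With both relative errors at most [dl], the product is off by at most [dl * (dl + |m| + |n|)],
     and [dl <= 1] bounds this by [dl * (2 * D)]. *)
  pose dl := Num.min 1 (eps / (2 * D)).
  have dl0 : 0 < dl by rewrite lt_min ltr01 divr_gt0 ?mulr_gt0.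
  have dl1 : dl <= 1 by rewrite ge_min lexx.
  have dle : dl * (2 * D) <= eps.
    by rewrite -ler_pdivlMr ?mulr_gt0 // ge_min lexx orbT.
  apply: for_large_mono (for_large_and (xe dl dl0) (ye dl dl0)).
  move=> F CF chi0 a Ta [hx hy] [em en]; rewrite em in hx *; rewrite en in hy *.
  rewrite natrM exprD.
  set X := (x F a)%:R in hx *; set Y := (y F a)%:R in hy *.
  set c := _ ^+ _ in hx *; set c' := _ ^+ _ in hy *.
  have c0 : 0 <= c by rewrite exprn_ge0.
  have c'0 : 0 <= c' by rewrite exprn_ge0.
  have -> : X * Y - m * n * (c * c') =
    (X - m * c) * (Y - n * c') + m * c * (Y - n * c') + n * c' * (X - m * c).
    by ring.
  have h1 : `|(X - m * c) * (Y - n * c')| <= dl * c * (dl * c').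
    by rewrite normrM ler_pM.
  have h2 : `|m * c * (Y - n * c')| <= `|m| * c * (dl * c').
    by rewrite normrM normrM (ger0_norm c0) ler_wpM2l // mulr_ge0.
  have h3 : `|n * c' * (X - m * c)| <= `|n| * c' * (dl * c).
    by rewrite normrM normrM (ger0_norm c'0) ler_wpM2l // mulr_ge0.
  apply: le_trans (ler_normD _ _) _; apply: le_trans (lerD (ler_normD _ _) h3) _.
  apply: le_trans (lerD (lerD h1 h2) (lexx _)) _.
  have -> : dl * c * (dl * c') + `|m| * c * (dl * c') + `|n| * c' * (dl * c) =
            dl * (dl + `|m| + `|n|) * (c * c') by ring.
  apply: ler_wpM2r; first exact: mulr_ge0.
  apply: le_trans dle; rewrite ler_pM2l // /D.
  have := normr_ge0 m; have := normr_ge0 n; lra.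
- apply: for_large_mono (for_large_and xp yp) => F _ _ a _ [hx hy].
  by rewrite muln_gt0 => /andP[x0 y0]; rewrite mulr_gt0 ?hx ?hy.
Qed.

(** Compare the exponents. Equal ones give the quotient of the measures; a smaller one for [x] gives
    0; a larger one contradicts [x <= y] for large [chi] unless [x] vanishes, so that 0 is correct
    again. *)
Lemma tame_ratio k (T : predicate L k) (x y : valuation L k nat) :
  tame T x -> tame T y -> for_large T (fun F a => (x F a <= y F a)%N) ->
  exists2 r : valuation L k R, finitely_valued T r &
    forall eps : R, 0 < eps -> for_large T (fun F a => (0 < y F a)%N ->
      `|(x F a)%:R / (y F a)%:R - r F a| <= eps).
Proof.
move=> [mu [d [fmu fd xe xp]]] [nu [e [fnu fe ye yp]]] xy.
pose rho (p : (R * R) * (nat * nat)) : R :=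
  if p.2.1 == p.2.2 then p.1.1 / p.1.2 else 0.
have fv := finitely_valued_pair (finitely_valued_pair fmu fnu)
  (finitely_valued_pair fd fe).
exists (fun F a => rho ((mu F a, nu F a), (d F a, e F a))).
  exact: finitely_valued_comp fv.
move=> eps e0; apply: (for_large_levels fv) => -[[m n] [i j]].
(* A nonpositive measure makes [y] vanish for large [chi], and the claim is void. *)
have [n0|n0] := leP n 0.
  apply: for_large_mono yp => F _ _ a _ hy [_ en _ _] /hy.
  by rewrite en ltNge n0.
have n20 : 0 < n / 2 by rewrite divr_gt0.
pose D := `|m| + n + 1.
have D0 : 0 < D by rewrite /D addr_gt0 ?ltr_wpDl.
(* The bound [n / 2] keeps [y] at least half its asymptotic size; the last term then absorbs the
   error [dl * (n + |m|)] divided by [n ^ 2 / 2]. *)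
pose dl := Num.min 1 (Num.min (n / 2) (eps * (n ^+ 2) / (2 * D))).
have dl0 : 0 < dl.
  by rewrite !lt_min ltr01 n20 divr_gt0 ?mulr_gt0 ?exprn_gt0.
have dl1 : dl <= 1 by rewrite ge_min lexx.
have dln : dl <= n / 2 by rewrite !ge_min lexx !orbT.
have dle : dl * (2 * D) <= eps * n ^+ 2.
  by rewrite -ler_pdivlMr ?mulr_gt0 // !ge_min lexx !orbT.
have big := for_large_chi T (Num.max (2 * (`|m| + 1) / (n * eps))
  (4 * (n + 1) / m + 1)).
have base := for_large_and (for_large_and (xe dl dl0) (ye dl dl0))
  (for_large_and xp (for_large_and xy big)).
have [ij|ji|ij] := ltngtP i j; last 1 first.
- apply: for_large_mono base => F _ chi0 a _ [[hx hy] [_ [_ _]]] [em en ed ee] y0.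
  rewrite em ed in hx; rewrite en ee -ij in hy; rewrite /rho /= em en ed ee ij eqxx.
  set X := (x F a)%:R in hx *; set Y := (y F a)%:R in hy *.
  set c := _ ^+ i in hx hy.
  have c0 : 0 < c by rewrite exprn_gt0 ?ltr0n.
  have Y0 : 0 < Y by rewrite ltr0n.
  have Yc : n / 2 * c <= Y.
    move: hy; rewrite ler_norml => /andP[hy _].
    have := ler_wpM2r (ltW c0) dln; lra.
  have -> : X / Y - m / n = (n * (X - m * c) - m * (Y - n * c)) / (Y * n).
    by field; rewrite !gt_eqF.
  rewrite normrM normfV [`|Y * n|]gtr0_norm ?mulr_gt0 // ler_pdivrMr ?mulr_gt0 //.
  apply: le_trans (ler_normB _ _) _; rewrite !normrM (gtr0_norm n0).
  have h1 := ler_wpM2l (ltW n0) hx; have h2 := ler_wpM2l (normr_ge0 m) hy.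
  apply: le_trans (lerD h1 h2) _.
  have h3 : eps * n * (n / 2 * c) <= eps * (Y * n).
    by rewrite [Y * n]mulrC [leRHS]mulrA ler_wpM2l // mulr_ge0 ?ltW.
  apply: le_trans h3.
  have h4 := ler_wpM2r (ltW c0) dle.
  have : dl * (n + `|m|) * c <= dl * D * c.
    by rewrite (ler_wpM2r (ltW c0)) // (ler_wpM2l (ltW dl0)) // /D; lra.
  by move: h4; rewrite expr2; lra.
- apply: for_large_mono base => F _ chi0 a _ [[hx hy] [_ [_ hb]]] [em en ed ee] y0.
  rewrite em ed in hx; rewrite en ee in hy; rewrite /rho /= ed ee (ltn_eqF ij) subr0.
  rewrite ger0_norm ?divr_ge0 //.
  set X := (x F a)%:R in hx *; set Y := (y F a)%:R in hy *.
  set c := _ ^+ i in hx; set c' := _ ^+ j in hy.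
  have c0 : 0 < c by rewrite exprn_gt0 ?ltr0n.
  have c'0 : 0 < c' by rewrite exprn_gt0 ?ltr0n.
  have Y0 : 0 < Y by rewrite ltr0n.
  have chi1 : 1 <= (chi F)%:R :> R by rewrite ler1n.
  have cc' : (chi F)%:R * c <= c' by rewrite -exprS ler_weXn2l.
  have Yc : n / 2 * c' <= Y.
    move: hy; rewrite ler_norml => /andP[hy _].
    have := ler_wpM2r (ltW c'0) dln; lra.
  have Xc : X <= (`|m| + 1) * c.
    move: hx; rewrite ler_norml => /andP[_ hx].
    have := ler_wpM2r (ltW c0) dl1; have := ler_wpM2r (ltW c0) (ler_norm m).
    lra.
  rewrite ler_pdivrMr //; apply: le_trans Xc _.
  move: hb; rewrite ge_max => /andP[hb _].
  have hb' : 2 * (`|m| + 1) <= (chi F)%:R * (n * eps).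
    by rewrite -ler_pdivrMr ?mulr_gt0.
  have h1 := ler_wpM2r (ltW c0) hb'.
  have h2 : eps * (n / 2 * c') <= eps * Y by rewrite ler_wpM2l // ltW.
  have h3 : (n * eps / 2) * ((chi F)%:R * c) <= (n * eps / 2) * c'.
    by rewrite ler_wpM2l // divr_ge0 // mulr_ge0 ?ltW.
  lra.
- have [m0|m0] := ltP 0 m; last first.
    apply: for_large_mono base => F _ _ a _ [_ [hx _]] [em _ ed ee] y0.
    have /eqP -> : x F a == 0%N.
      by rewrite -leqn0 leqNgt; apply/negP => /hx; rewrite em ltNge m0.
    by rewrite /rho /= ed ee (gtn_eqF ji) mul0r subrr normr0 ltW.
  pose dm := Num.min 1 (m / 2).
  have dm0 : 0 < dm by rewrite lt_min ltr01 divr_gt0.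
  have := for_large_and (xe dm dm0) base.
  apply: for_large_mono.
  move=> F _ chi0 a _ [hx [[_ hy] [_ [hxy hb]]]] [em en ed ee] y0; exfalso.
  move: hxy; apply/negP; rewrite -ltnNge -(ltr_nat R).
  rewrite em ed in hx; rewrite en ee in hy.
  set X := (x F a)%:R in hx *; set Y := (y F a)%:R in hy *.
  set c := _ ^+ i in hx; set c' := _ ^+ j in hy.
  have c0 : 0 < c by rewrite exprn_gt0 ?ltr0n.
  have c'0 : 0 < c' by rewrite exprn_gt0 ?ltr0n.
  have chi1 : 1 <= (chi F)%:R :> R by rewrite ler1n.
  have cc' : (chi F)%:R * c' <= c by rewrite -exprS ler_weXn2l.
  have Xc : m / 2 * c <= X.
    move: hx; rewrite ler_norml => /andP[hx _].
    have dmm : dm <= m / 2 by rewrite ge_min lexx orbT.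
    have := ler_wpM2r (ltW c0) dmm; lra.
  have Yc : Y <= (n + 1) * c'.
    move: hy; rewrite ler_norml => /andP[_ hy].
    have := ler_wpM2r (ltW c'0) dl1; lra.
  apply: le_lt_trans Yc _; apply: lt_le_trans Xc.
  move: hb; rewrite ge_max => /andP[_ hb].
  have hb' : 4 * (n + 1) + m <= (chi F)%:R * m.
    have := ler_wpM2r (ltW m0) hb; rewrite mulrDl mul1r mulfVK ?gt_eqF //.
  have h1 := ler_wpM2r (ltW c'0) hb'.
  have h2 := ler_wpM2l (ltW m0) cc'.
  have h3 : 0 < m * c' by rewrite mulr_gt0.
  have h4 : 0 < (n + 1) * c' by rewrite mulr_gt0 ?addr_gt0.
  lra.
Qed.

End tame.

Section asymptotics.
Variables (L : language) (C : set (structure L)) (chi : structure L -> nat).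
Variable R : realType.
Local Notation definable := (definable C).
Local Notation definable2 := (definable2 C).
Local Notation finitely_valued := (finitely_valued C).
Local Notation for_large := (for_large C chi).
Local Notation tame := (tame C chi R).

Lemma tame_eq k (T : predicate L k) (x y : valuation L k nat) :
  for_large T (fun F a => x F a = y F a) -> tame T x -> tame T y.
Proof.
move=> xy [mu [d [fmu fd xe xp]]]; exists mu, d; split=> //.
- move=> eps e0.
  by apply: for_large_mono (for_large_and xy (xe eps e0)) => F _ _ a _ [<-].
- by apply: for_large_mono (for_large_and xy xp) => F _ _ a _ [<-].
Qed.

(** Finite dimension is asked for large [chi] only, which is all that can be shown for a family
    bounded by another count. *)
Lemma has_asymptotics_tame k (S : formula L k) n (X : defset_over C S n) mu d :
  has_asymptotics chi X mu d ->
  for_large (fun F => points F S) (fun F s => d F s <> None) ->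
  tame (fun F => points F S) (fun F s => ncard (fibre X s)) /\
  for_large (fun F => points F S) (fun F s => finite_set (fibre X s)).
Proof.
move=> [[/definable_valued_finite fmu /definable_valued_finite fd] mud mu0 Xe _].
move=> d_fin.
have appr (eps : rat) : 0 < eps -> for_large (fun F => points F S) (fun F s =>
    exists q j, [/\ mu F s = Some q, d F s = Some j, fibre X s #= `I_(ncard (fibre X s))
      & `|(ncard (fibre X s))%:R - q * (chi F)%:R ^+ j| <= eps * (chi F)%:R ^+ j]).
  move=> /Xe[N N0 hN].
  have large : for_large (fun F => points F S) (fun F s => forall q j,
      mu F s = Some q -> d F s = Some j -> exists2 c : nat, fibre X s #= `I_c &
        `|c%:R - q * (chi F)%:R ^+ j| <= eps * (chi F)%:R ^+ j).
    by exists N => F CF NF s Ss; exact: hN.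
  apply: for_large_mono (for_large_and d_fin large) => F CF _ s Ss [].
  have := mud F CF s Ss.
  case: (d F s) => [j|]; case: (mu F s) => [q|] // [h1 h2] _; last by case: h2.
  move=> /(_ q j erefl erefl)[c Xc hc]; exists q, j.
  by rewrite (ncardE Xc).
split; last first.
  apply: for_large_mono (appr 1 ltr01) => F _ _ s _ [q [j [_ _ Xc _]]].
  by apply/finite_setP; eexists; exact: Xc.
exists (fun F s => ratr (odflt 0 (mu F s))), (fun F s => odflt 0%N (d F s)).
split.
- exact: (finitely_valued_comp (fun q => ratr (odflt 0 q)) fmu).
- exact: (finitely_valued_comp (odflt 0%N) fd).
- move=> eps e0; have [q] := rat_in_itvoo e0.
  rewrite in_itv /= => /andP[q0 qe].
  have {}q0 : 0 < q by rewrite -(ltr_rat R) rmorph0.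
  apply: for_large_mono (appr q q0) => F CF _ s Ss [r [j [-> -> _ /=]]].
  rewrite -(ler_rat R) ratr_norm rmorphB !rmorphM !rmorphXn /= !ratr_nat => h.
  by apply: le_trans h _; rewrite ler_wpM2r ?exprn_ge0 // ltW.
- apply: (for_large_levels fmu) => q.
  (* Measure 0 comes with dimension 0, so an error of 1/2 forces the integer count to be 0; an error
     of half the measure leaves no room for a negative measure. *)
  pose e : rat := if odflt 0 q == 0 then 1 / 2 else `|odflt 0 q| / 2.
  have e0 : 0 < e by rewrite /e; case: eqP => [_|/eqP q0]; rewrite divr_gt0 ?normr_gt0.
  apply: for_large_mono (appr e e0) => F CF chi0 s Ss [r [j [mr dj _]]].
  move=> h muq; move: e0 h; rewrite {}/e -{}muq mr /=.
  have c0 : 0 < (chi F)%:R ^+ j :> rat by rewrite exprn_gt0 ?ltr0n.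
  rewrite ltr0q.
  case: eqP => [r0|/eqP r0] _ h x0.
    move: h; have := mu0 F CF s Ss; rewrite mr r0 dj => /(_ erefl)[->].
    rewrite expr0 !mulr1 subr0 ger0_norm // => h.
    have : 1 <= (ncard (fibre X s))%:R :> rat by rewrite ler1n.
    lra.
  rewrite ltNge; apply/negP => r0'.
  move: h; rewrite ler_norml (ler0_norm r0') => /andP[_ h].
  have : r * (chi F)%:R ^+ j < 0 by rewrite pmulr_llt0 // lt_neqAle r0.
  have : 0 <= (ncard (fibre X s))%:R :> rat by [].
  lra.
Qed.

Hypothesis asymp : asymptotic_class C chi.

(** The family is turned into a definable set over [T], to which the hypothesis on the class
    applies. It remains to exclude infinite dimension: a finite fibre would then outgrow every power
    of [chi], whereas [y] bounds it polynomially. *)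
Lemma tame_family n k (T : predicate L k) (X : predicate2 L n k)
    (y : valuation L k nat) :
  definable T -> definable2 X -> tame T y ->
  for_large T (fun F a => finite_set [set x | X F x a] /\
                          (ncard [set x | X F x a] <= y F a)%N) ->
  tame T (fun F a => ncard [set x | X F x a]).
Proof.
move=> dT dX ty Xy; have [S hS] := dT.
have dX' : definable (fun F (a : 'I_(n + k) -> F) =>
    X F (lsub a) (rsub a) /\ T F (rsub a)).
  apply: definable_and dX _.
  exact: (definable_ren (fun i => rshift n i) dT).
have [p hp] := dX'.
(* The graph of the projection to the last k coordinates, cut down to [T] so that it lands in the
   base. *)
have dg : definable (fun F (a : 'I_(n + k + k) -> F) =>
    (X F (lsub (lsub a)) (rsub (lsub a)) /\ T F (rsub (lsub a))) /\
    forall i : 'I_k, rsub (lsub a) i = rsub a i).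
  apply: definable_and; last first.
    by apply: definable_forall_ord => i; exact: definable_eq.
  exact: (definable_ren (fun i => lshift k i) dX').
have [g hg] := dg.
have gP : definable_function C p S g.
  move=> F CF; split=> [a b|a /(hp F CF)[Xa Ta]].
    rewrite /points /= (hg F CF) lsub_cat rsub_cat => -[[Xa Ta] ab].
    have {}ab : rsub a = b by exact/funext.
    by rewrite (hp F CF) (hS F CF) -ab.
  exists (rsub a); rewrite /points /=; split=> [|b].
    by rewrite (hg F CF) lsub_cat rsub_cat.
  by rewrite (hg F CF) lsub_cat rsub_cat => -[_ /funext].
pose XX := DefsetOver gP.
have fibE F s a : C F -> fibre XX s a <->
    [/\ X F (lsub a) (rsub a), T F (rsub a) & rsub a = s].
  move=> CF; split=> [/(hg F CF)|[Xa Ta as_]].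
    by rewrite lsub_cat rsub_cat => -[[Xa Ta] /funext].
  by apply/(hg F CF); rewrite lsub_cat rsub_cat as_ -{1 2}as_.
have bij F s : C F -> T F s ->
    set_bij (fibre XX s) [set x | X F x s] (@lsub F n k).
  move=> CF Ts; split.
  - by move=> a /(fibE F s a CF)[Xa _ <-].
  - move=> a b; rewrite !inE => /(fibE F s a CF)[_ _ as_] /(fibE F s b CF)[_ _ bs].
    by move=> ab; rewrite -[a]cat_sub -[b]cat_sub as_ bs ab.
  - move=> x Xx; exists (cat_val x s); last exact: lsub_cat.
    by apply/(fibE F _ _ CF); rewrite lsub_cat rsub_cat.
have [mu [d asy]] := asymp XX.
have [/(tame_ren dT (h := fun i => i))] : tame (fun F => points F S)
    (fun F s => ncard (fibre XX s)) /\
    for_large (fun F => points F S) (fun F s => finite_set (fibre XX s)); last first.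
  move=> tX _; apply: tame_eq (tX _).
    by exists 0%N => F CF _ a Ta; exact: (ncard_bij (bij F a CF Ta)).
  by move=> F CF a Ta; apply/(hS F CF).
apply: (has_asymptotics_tame asy).
have [_ _ _ _ out] := asy.
suff [N hN] : for_large T (fun F s => d F s <> None).
  by exists N => F CF NF a Sa; apply: hN => //; apply/(hS F CF).
have [nu [e [fnu fe ye _]]] := ty.
apply: (for_large_levels (finitely_valued_pair fnu fe)) => -[m j].
(* One power above the exponent of [y]: as soon as [chi] is at least [|m| + 1], the bound
   [(|m| + 1) * chi ^ j] on [y] contradicts growth beyond [chi ^ j.+1]. *)
have [N hN] := out j.+1.
have lN : for_large T (fun F s => d F s = None ->
    forall c : nat, fibre XX s #= `I_c -> (chi F ^ j.+1 < c)%N).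
  by exists N => F CF NF s Ts; apply: hN => //; apply/(hS F CF).
have := for_large_and (for_large_and (ye 1 ltr01) Xy)
  (for_large_and lN (for_large_chi C chi T (`|m| + 1))).
apply: for_large_mono => F CF chi0 s Ts [[hy [fX Xly] [hN' hchi] [em ej] dN]].
have cX : fibre XX s #= `I_(ncard [set x | X F x s]).
  rewrite -(ncard_bij (bij F s CF Ts)); apply: ncard_finite.
  rewrite -(eq_finite_set (pcard_eq (bij_of_set_bijection (bij F s CF Ts)))) in fX.
  exact: fX.
have := leq_trans (hN' dN _ cX) Xly; apply/negP; rewrite -leqNgt -(ler_nat R).
rewrite em ej in hy; rewrite natrX exprS.
have c0 : 0 <= (chi F)%:R ^+ j :> R by rewrite exprn_ge0.
move: hy; rewrite ler_norml => /andP[_ hy].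
have := ler_wpM2r c0 hchi; have := ler_wpM2r c0 (ler_norm m).
lra.
Qed.

End asymptotics.

(** * Cut norm estimates for finite matrices *)

Section class_averages.
Variables (R : realFieldType) (B J : finType) (cl : B -> J).
Implicit Types x y : B -> R.

(** Indexed by an element rather than a label, so that the class is never empty and division by its
    size is safe. *)
Definition class_size (b : B) : nat := #|[pred c | cl c == cl b]|.

Lemma class_size_gt0 b : 0 < (class_size b)%:R :> R.
Proof. by rewrite ltr0n; apply/card_gt0P; exists b; rewrite inE. Qed.

(** The conditional expectation of [x] on the partition by labels, an orthogonal projection. *)
Definition class_avg x (b : B) : R :=
  (\sum_(c | cl c == cl b) x c) / (class_size b)%:R.

Lemma class_avg_eq x b c : cl b = cl c -> class_avg x b = class_avg x c.
Proof. by move=> e; rewrite /class_avg /class_size e. Qed.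

Lemma class_avgB x y b :
  class_avg (fun c => x c - y c) b = class_avg x b - class_avg y b.
Proof. by rewrite /class_avg sumrB mulrBl. Qed.

Lemma class_avg_cst (k : R) b : class_avg (fun=> k) b = k.
Proof.
by rewrite /class_avg sumr_const -[k *+ _]mulr_natr mulfK // gt_eqF ?class_size_gt0.
Qed.

Lemma class_avg_adjoint x y :
  \sum_b x b * class_avg y b = \sum_b class_avg x b * y b.
Proof.
have -> : \sum_b x b * class_avg y b =
    \sum_b \sum_(c | cl c == cl b) x b * y c / (class_size b)%:R.
  by apply: eq_bigr => b _; rewrite /class_avg mulrA mulr_sumr mulr_suml.
rewrite (exchange_big_dep predT) //=; apply: eq_bigr => c _.
rewrite /class_avg !mulr_suml; apply: eq_big => [b|b /eqP cb]; first exact: eq_sym.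
by rewrite /class_size cb mulrAC.
Qed.

Lemma class_avg_norm_le x (k : R) b :
  (forall c, cl c = cl b -> `|x c| <= k) -> `|class_avg x b| <= k.
Proof.
move=> xk; have s0 := class_size_gt0 b.
rewrite normrM normfV (gtr0_norm s0) ler_pdivrMr //.
apply: le_trans (ler_norm_sum _ _ _) _.
have -> : k * (class_size b)%:R = \sum_(c | cl c == cl b) k.
  by rewrite sumr_const mulr_natr.
by apply: ler_sum => c /eqP; exact: xk.
Qed.

Lemma class_avg_near x (k : R) b :
  (forall c, cl c = cl b -> `|x b - x c| <= k) -> `|x b - class_avg x b| <= k.
Proof.
move=> xk.
have -> : x b - class_avg x b = class_avg (fun c => x b - x c) b.
  by rewrite class_avgB class_avg_cst.
exact: class_avg_norm_le.
Qed.

Lemma sum_sub_class_avg x y :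
  \sum_b x b * (y b - class_avg y b) = \sum_b (x b - class_avg x b) * y b.
Proof.
under eq_bigr do rewrite mulrBr; under [RHS]eq_bigr do rewrite mulrBl.
by rewrite !sumrB class_avg_adjoint.
Qed.

End class_averages.

(** Cauchy-Schwarz, by expanding the nonnegative sum of [(N * x i - c i * S) ^ 2] and using
    [c i ^ 2 <= 1]. *)
Lemma sqr_sum_le (R : realFieldType) (I : finType) (c x : I -> R) :
  (forall i, `|c i| <= 1) -> (\sum_i c i * x i) ^+ 2 <= #|I|%:R * \sum_i x i ^+ 2.
Proof.
move=> c1; set S := \sum_i c i * x i; set N : R := #|I|%:R; set Q := \sum_i _.
have [I0|I0] := posnP #|I|.
  have E (i : I) : False by have := card0_eq I0 i; rewrite !inE.
  by rewrite /S big1 ?expr0n ?mulr_ge0 ?sumr_ge0 // => i; case: (E i).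
have N0 : 0 < N by rewrite ltr0n.
have : 0 <= \sum_i (N * x i - c i * S) ^+ 2 by rewrite sumr_ge0 // => i _; exact: sqr_ge0.
have -> : \sum_i (N * x i - c i * S) ^+ 2 =
    N ^+ 2 * Q - 2 * N * S * S + S ^+ 2 * \sum_i c i ^+ 2.
  rewrite (eq_bigr (fun i => N ^+ 2 * x i ^+ 2 - 2 * N * S * (c i * x i) +
    S ^+ 2 * c i ^+ 2)) => [|i _]; last by ring.
  by rewrite big_split sumrB /= -!mulr_sumr.
have cN : \sum_i c i ^+ 2 <= N.
  have -> : N = \sum_(i : I) 1 by rewrite sumr_const.
  by apply: ler_sum => i _; rewrite -real_normK ?num_real // expr_le1.
have h := ler_wpM2l (sqr_ge0 S) cN.
move=> h0; rewrite -(ler_pM2l N0); nra.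
Qed.

(* Greedy sampling: each new vector is chosen with a nonpositive scalar product
   with the current sum. *)
Lemma small_sum_exists (R : realFieldType) (B I : finType) (X : B -> I -> R) :
  (0 < #|B|)%N -> (forall w i, `|X w i| <= 1) -> (forall i, \sum_w X w i = 0) ->
  forall n, exists2 ws : seq B, size ws = n &
    \sum_i (\sum_(w <- ws) X w i) ^+ 2 <= (n * #|I|)%:R.
Proof.
move=> B0 X1 X0; elim=> [|n [ws sws hws]].
  by exists [::] => //; rewrite big1 // => i _; rewrite big_nil expr0n.
pose D i := \sum_(w <- ws) X w i.
have [w hw] : exists w, \sum_i D i * X w i <= 0.
  apply/existsP; apply: contraT; rewrite negb_exists => /forallP h.
  have [b0 _] := card_gt0P B0.
  have : 0 < \sum_w \sum_i D i * X w i.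
    rewrite (bigD1 b0) //= ltr_pwDl ?sumr_ge0 // => [|w _]; last rewrite ltW //.
      by rewrite ltNge.
    by rewrite ltNge.
  rewrite exchange_big /= big1 ?ltxx // => i _.
  by rewrite -mulr_sumr X0 mulr0.
exists (w :: ws); first by rewrite /= sws.
have -> : \sum_i (\sum_(v <- w :: ws) X v i) ^+ 2 =
    \sum_i D i ^+ 2 + 2 * \sum_i D i * X w i + \sum_i X w i ^+ 2.
  rewrite mulr_sumr -!big_split /=; apply: eq_bigr => i _.
  by rewrite big_cons -/(D i); ring.
have h1 : \sum_i X w i ^+ 2 <= #|I|%:R.
  have -> : #|I|%:R = \sum_(i : I) 1 :> R by rewrite sumr_const.
  by apply: ler_sum => i _; rewrite -real_normK ?num_real // expr_le1.
by rewrite mulSn natrD; move: hws; rewrite -/D; lra.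
Qed.

(** * Codegrees, their sampling, and the Gram matrix estimate *)

Section codegrees.
Variables (R : realFieldType) (A B : finType) (f : A -> B -> R).
Hypotheses (A0 : (0 < #|A|)%N) (B0 : (0 < #|B|)%N).
Hypothesis f01 : forall a b, 0 <= f a b <= 1.

Definition codegree (b c : B) : R := (\sum_a f a b * f a c) / #|A|%:R.

Let nA : 0 < #|A|%:R :> R. Proof. by rewrite ltr0n. Qed.
Let nB : 0 < #|B|%:R :> R. Proof. by rewrite ltr0n. Qed.

Let ff01 a b a' b' : 0 <= f a b * f a' b' <= 1.
Proof.
have /andP[h0 h1] := f01 a b; have /andP[h2 h3] := f01 a' b'.
by rewrite mulr_ge0 //= mulr_ile1.
Qed.

Lemma codegree01 b c : 0 <= codegree b c <= 1.
Proof.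
rewrite divr_ge0 ?sumr_ge0 //=; last by move=> a _; case/andP: (ff01 a b a c).
rewrite ler_pdivrMr // mul1r.
have -> : #|A|%:R = \sum_(a : A) 1 :> R by rewrite sumr_const.
by apply: ler_sum => a _; case/andP: (ff01 a b a c).
Qed.

Lemma codegreeB b b' c :
  codegree b c - codegree b' c = (\sum_a (f a b - f a b') * f a c) / #|A|%:R.
Proof. by rewrite -mulrBl -sumrB; under eq_bigr do rewrite -mulrBl. Qed.

(** Quantitative compactness of the codegree operator. Written as a sum over pairs [(a, a')], the
    squared difference at [w] depends on [w] only through the products [f a w * f a' w]; one sample
    that balances these products therefore serves all [b] and [b']. *)
Lemma codegree_sample k : (0 < k)%N ->
  exists2 ws : seq B, size ws = (k ^ 2)%N & forall b b',
    (\sum_w (codegree b w - codegree b' w) ^+ 2) / #|B|%:R <=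
    (\sum_(w <- ws) (codegree b w - codegree b' w) ^+ 2) / (k ^ 2)%:R + k%:R^-1.
Proof.
move=> k0.
pose K (i : A * A) : R := (\sum_w f i.1 w * f i.2 w) / #|B|%:R.
pose X w (i : A * A) := f i.1 w * f i.2 w - K i.
have K01 i : 0 <= K i <= 1.
  rewrite divr_ge0 ?sumr_ge0 //=; last by move=> w _; case/andP: (ff01 i.1 w i.2 w).
  rewrite ler_pdivrMr // mul1r.
  have -> : #|B|%:R = \sum_(w : B) 1 :> R by rewrite sumr_const.
  by apply: ler_sum => w _; case/andP: (ff01 i.1 w i.2 w).
have X1 w i : `|X w i| <= 1.
  have /andP[h0 h1] := ff01 i.1 w i.2 w; have /andP[h2 h3] := K01 i.
  rewrite ler_norml /X; apply/andP; split; lra.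
have X0 i : \sum_w X w i = 0.
  rewrite sumrB sumr_const -mulr_natr divfK ?gt_eqF //.
  by rewrite subrr.
have [ws sws hws] := small_sum_exists B0 X1 X0 (k ^ 2).
exists ws => // b b'.
pose g a := f a b - f a b'.
have g1 a : `|g a| <= 1.
  have /andP[h0 h1] := f01 a b; have /andP[h2 h3] := f01 a b'.
  rewrite ler_norml /g; apply/andP; split; lra.
pose G (i : A * A) := g i.1 * g i.2.
pose S := \sum_i G i * \sum_(w <- ws) X w i.
(* Cauchy-Schwarz over the [|A| ^ 2] pairs; division by [k ^ 2 * |A| ^ 2] turns this deviation into
   the error [1 / k]. *)
have S2 : S ^+ 2 <= (k%:R * #|A|%:R ^+ 2) ^+ 2.
  apply: le_trans (sqr_sum_le _ _) _.
    by move=> i; rewrite normrM mulr_ile1.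
  apply: le_trans (ler_wpM2l _ hws) _ => //.
  by rewrite card_prod !natrM le_eqVlt; apply/orP; left; apply/eqP; ring.
have Sk : - (k%:R * #|A|%:R ^+ 2) <= S.
  have kk : 0 <= k%:R * #|A|%:R ^+ 2 :> R by rewrite mulr_ge0 ?exprn_ge0.
  have : `|S| <= k%:R * #|A|%:R ^+ 2.
    by rewrite -(ler_pXn2r (n := 2)) ?nnegrE // real_normK ?num_real.
  by rewrite ler_norml => /andP[].
have sqE w : (codegree b w - codegree b' w) ^+ 2 =
    (\sum_i G i * (f i.1 w * f i.2 w)) / #|A|%:R ^+ 2.
  rewrite codegreeB expr_div_n; congr (_ / _); rewrite expr2 mulr_suml.
  rewrite -(pair_bigA _ (fun a a' => G (a, a') * (f a w * f a' w))) /=.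
  apply: eq_bigr => a _; rewrite mulr_sumr; apply: eq_bigr => a' _.
  by rewrite /G /g /=; ring.
have kR : 0 < k%:R :> R by rewrite ltr0n.
have e1 : \sum_w (codegree b w - codegree b' w) ^+ 2 =
    (\sum_i G i * K i) * #|B|%:R / #|A|%:R ^+ 2.
  under eq_bigr do rewrite sqE.
  rewrite -mulr_suml; congr (_ / _); rewrite exchange_big mulr_suml /=.
  by apply: eq_bigr => i _; rewrite -mulr_sumr -mulrA divfK ?gt_eqF.
have e2 : \sum_(w <- ws) (codegree b w - codegree b' w) ^+ 2 =
    (S + (k ^ 2)%:R * \sum_i G i * K i) / #|A|%:R ^+ 2.
  under eq_bigr do rewrite sqE.
  rewrite -mulr_suml; congr (_ / _); rewrite exchange_big /= /S mulr_sumr.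
  rewrite -big_split /=; apply: eq_bigr => i _.
  rewrite -mulr_sumr mulrCA -mulrDr; congr (_ * _).
  rewrite /X sumrB big_const_seq count_predT sws iter_addr_0 -[_ *+ (k ^ 2)]mulr_natl.
  by rewrite subrK.
rewrite e1 e2.
have -> : (\sum_i G i * K i) * #|B|%:R / #|A|%:R ^+ 2 / #|B|%:R =
    (\sum_i G i * K i) / #|A|%:R ^+ 2 by field; rewrite !gt_eqF.
rewrite natrX; set Z := \sum_i _.
have -> : (S + k%:R ^+ 2 * Z) / #|A|%:R ^+ 2 / k%:R ^+ 2 + k%:R^-1 =
  Z / #|A|%:R ^+ 2 + (S + k%:R * #|A|%:R ^+ 2) / (#|A|%:R ^+ 2 * k%:R ^+ 2).
  by field; rewrite !gt_eqF.
rewrite lerDl divr_ge0 ?mulr_ge0 ?exprn_ge0 //; lra.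
Qed.

(* The weights minus their class averages have zero sum on every class, on
   which codegrees are nearly constant. *)
Lemma cut_class_avg (J : finType) (cl : B -> J) (eta : R) :
  (forall b c, cl b = cl c ->
     \sum_w `|codegree b w - codegree c w| <= eta * #|B|%:R) ->
  forall (x : A -> R) (y : B -> R),
  (forall a, `|x a| <= 1) -> (forall b, `|y b| <= 1) ->
  (\sum_a \sum_b x a * y b * (f a b - class_avg cl (f a) b)) ^+ 2 <=
  4 * eta * (#|A|%:R * #|B|%:R) ^+ 2.
Proof.
move=> heta x y x1 y1.
pose g b := y b - class_avg cl y b.
have g2 b : `|g b| <= 2.
  apply: le_trans (ler_normB _ _) _; have := y1 b.
  have := class_avg_norm_le (fun c (_ : cl c = cl b) => y1 c); lra.
pose H a := \sum_b g b * f a b.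
have -> : \sum_a \sum_b x a * y b * (f a b - class_avg cl (f a) b) =
    \sum_a x a * H a.
  apply: eq_bigr => a _; rewrite /H -sum_sub_class_avg mulr_sumr.
  by apply: eq_bigr => b _; rewrite mulrA.
apply: le_trans (sqr_sum_le _ x1) _.
have -> : 4 * eta * (#|A|%:R * #|B|%:R) ^+ 2 =
    #|A|%:R * (#|A|%:R * (4 * eta * #|B|%:R ^+ 2)) by ring.
rewrite ler_pM2l //.
pose N b := \sum_c g c * codegree b c.
(* The squared norm of the combination of columns with coefficients [g] is the quadratic form of the
   Gram matrix. *)
have H2 : \sum_a H a ^+ 2 = #|A|%:R * \sum_b g b * N b.
  rewrite mulr_sumr.
  under eq_bigr do rewrite expr2 {1}/H mulr_suml.
  rewrite exchange_big /=; apply: eq_bigr => b _.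
  have -> : \sum_a g b * f a b * H a = g b * \sum_a f a b * H a.
    by rewrite mulr_sumr; apply: eq_bigr => a _; rewrite mulrA.
  rewrite [RHS]mulrCA; congr (_ * _); rewrite /N mulr_sumr.
  under eq_bigr do rewrite /H mulr_sumr.
  rewrite exchange_big /=; apply: eq_bigr => c _.
  rewrite /codegree mulrCA [_ * (_ / _)]mulrC divfK ?gt_eqF // mulr_sumr.
  by apply: eq_bigr => a _; rewrite mulrCA.
have Nb b c : cl c = cl b -> `|N b - N c| <= 2 * (eta * #|B|%:R).
  move=> cb; rewrite /N -sumrB; under eq_bigr do rewrite -mulrBr.
  apply: le_trans (ler_norm_sum _ _ _) _.
  apply: le_trans (ler_wpM2l _ (heta b c (esym cb))) => //.
  rewrite mulr_sumr; apply: ler_sum => w _.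
  by rewrite normrM ler_wpM2r.
have gN : \sum_b g b * N b <= 4 * eta * #|B|%:R ^+ 2.
  rewrite /g.
  have -> : \sum_b (y b - class_avg cl y b) * N b =
            \sum_b (y b - class_avg cl y b) * (N b - class_avg cl N b).
    rewrite [RHS]sum_sub_class_avg; apply: eq_bigr => b _; congr (_ * _).
    rewrite -[LHS]subr0; congr (_ - _); apply/esym/eqP.
    rewrite class_avgB subr_eq0; apply/eqP/esym.
    rewrite {1}/class_avg (eq_bigr (fun=> class_avg cl y b)).
      by rewrite -/(class_avg cl (fun=> class_avg cl y b) b) class_avg_cst.
    by move=> c /eqP; exact: class_avg_eq.
  (* The factors are the bound 2 on [g] and the bound [2 * (eta * |B|)] on the deviation of [N] from
     its class averages. *)
  have -> : 4 * eta * #|B|%:R ^+ 2 = \sum_(b : B) 2 * (2 * (eta * #|B|%:R)) :> R.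
    by rewrite sumr_const -mulr_natr; ring.
  apply: ler_sum => b _; apply: le_trans (ler_norm _) _; rewrite normrM.
  by apply: ler_pM => //; [exact: g2|apply: class_avg_near => c; exact: Nb].
by rewrite H2 ler_pM2l.
Qed.

End codegrees.

(** Values from a finite list that are closer than the gap coincide; this turns approximate
    equalities into exact ones. *)
Lemma seq_gap (R : realFieldType) (s : seq R) :
  exists2 g : R, 0 < g & forall x y, x \in s -> y \in s -> x != y -> g <= `|x - y|.
Proof.
have gap1 (x : R) (t : seq R) :
    exists2 g : R, 0 < g & forall y, y \in t -> x != y -> g <= `|x - y|.
  elim: t => [|y t [g g0 hg]]; first by exists 1.
  have [<-|xy] := eqVneq x y.
    by exists g => // z; rewrite inE => /orP[/eqP->|/hg//]; rewrite eqxx.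
  exists (Num.min g `|x - y|); first by rewrite lt_min g0 normr_gt0 subr_eq0.
  move=> z; rewrite inE => /orP[/eqP-> _|/hg h /h h']; rewrite ge_min ?lexx ?orbT //.
  by rewrite h'.
elim: s => [|x s [g g0 hg]]; first by exists 1.
have [h h0 hh] := gap1 x s.
exists (Num.min g h) => [|y z]; first by rewrite lt_min g0.
rewrite !inE => /orP[/eqP->|ys] /orP[/eqP->|zs] yz.
- by rewrite eqxx in yz.
- by rewrite ge_min hh ?orbT.
- by rewrite distrC ge_min hh ?orbT // eq_sym.
- by rewrite ge_min hg.
Qed.

(** The label of [b] is the signature of a chosen representative of its [r]-class, which makes
    labels constant on classes even where [sig] is not. *)
Lemma labels_of_signature (B S : finType) (r : rel B) (sig : B -> S) (K : nat) :
  reflexive r -> symmetric r -> transitive r -> #|S| = K ->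
  (forall b c, sig b = sig c -> r b c) ->
  exists cl : B -> 'I_K, forall b c, cl b = cl c <-> r b c.
Proof.
move=> rr rs rt <- sr.
pose rep b := odflt b [pick c | r b c].
have rrep b : r b (rep b).
  by rewrite /rep; case: pickP => //= _; exact: rr.
exists (fun b => enum_rank (sig (rep b))) => b c; split.
  move=> /enum_rank_inj /sr h; apply: (rt _ _ _ (rrep b)).
  by apply: (rt _ _ _ h); rewrite rs.
move=> bc; congr (enum_rank (sig _)); rewrite /rep.
have -> : [pick d | r b d] = [pick d | r c d].
  apply: eq_pick => d; apply/idP/idP; apply: rt => //.
  by rewrite rs.
by case: pickP => // /(_ c); rewrite rr.
Qed.

(** * Equivalence of vertices with nearly equal codegree vectors *)

Section classes.
Variables (R : realFieldType) (A B : finType) (f : A -> B -> R).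
Hypotheses (A0 : (0 < #|A|)%N) (B0 : (0 < #|B|)%N).
Hypothesis f01 : forall a b, 0 <= f a b <= 1.
Variables (s : seq R) (val : B -> B -> R) (q : B -> B -> R) (g dl eps : R) (k : nat).
Hypothesis vals : forall b c, val b c \in s.
Hypothesis gap : forall x y, x \in s -> y \in s -> x != y -> g <= `|x - y|.
Hypothesis qgap : forall b c, q b c != 0 -> dl <= `|q b c|.

(** Here [val] stands for the asymptotic codegree and [q] for the asymptotic proportion of places
    where two rows of [val] differ; [q b c = 0] will be the equivalence of [b] and [c]. *)
Definition hamming (b c : B) : nat := #|[pred w | val b w != val c w]|.

Hypothesis near_val : forall b c, `|codegree f b c - val b c| <= eps.
Hypothesis near_q : forall b c, `|(hamming b c)%:R / #|B|%:R - q b c| <= eps.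
Hypotheses (g0 : 0 < g) (k0 : (0 < k)%N) (eps_dl : 4 * eps <= dl) (dl0 : 0 < dl).
Hypotheses (eps_g : 4 * eps <= g)
  (eps_k : 4 * (4 * eps ^+ 2 + k%:R^-1) <= g ^+ 2 * (dl / 2)).

Let nB : 0 < #|B|%:R :> R. Proof. by rewrite ltr0n. Qed.
Let eps0 : 0 <= eps.
Proof. by have [b _] := card_gt0P B0; apply: le_trans (near_val b b). Qed.

Lemma hamming_le b c : q b c = 0 -> (hamming b c)%:R <= eps * #|B|%:R.
Proof.
move=> q0; have := near_q b c; rewrite q0 subr0 ger0_norm ?divr_ge0 //.
by rewrite ler_pdivrMr.
Qed.

(** The value of [q] is 0 or at least [dl] in absolute value, and it lies within [dl / 4] of the
    true proportion, whence the threshold of three quarters. *)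
Lemma q_eq0 b c : (hamming b c)%:R < 3 * (dl / 4) * #|B|%:R -> q b c = 0.
Proof.
rewrite -ltr_pdivrMr // => h; apply/eqP; apply: contraT => /qgap.
rewrite leNgt => /negP[]; have := near_q b c.
have : 0 <= (hamming b c)%:R / #|B|%:R :> R by rewrite divr_ge0.
rewrite ler_norml ltr_norml => h0 /andP[h1 h2].
by apply/andP; have := dl0; have := eps_dl; split; lra.
Qed.

Lemma hamming_sym b c : hamming b c = hamming c b.
Proof. by apply: eq_card => w; rewrite !inE eq_sym. Qed.

Lemma hamming_triangle b c d : (hamming b d <= hamming b c + hamming c d)%N.
Proof.
rewrite -cardUI; apply: leq_trans (leq_addr _ _); apply: subset_leq_card.
apply/fintype.subsetP => w; rewrite !inE; apply: contraR; rewrite negb_or !negbK.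
by move=> /andP[/eqP-> /eqP->].
Qed.

Let q_refl b : q b b = 0.
Proof.
apply: q_eq0; rewrite /hamming eq_card0 ?mulr_gt0 ?invr_gt0 // => w.
by rewrite !inE eqxx.
Qed.

Let q_sym b c : q b c = 0 -> q c b = 0.
Proof.
move=> /hamming_le h; apply: q_eq0; rewrite hamming_sym; apply: le_lt_trans h _.
by rewrite ltr_pM2r //; have := dl0; have := eps_dl; lra.
Qed.

(** Two proportions of at most [eps] add up to at most [dl / 2], still below the threshold: here the
    gap makes an approximate relation exactly transitive. *)
Let q_trans b c d : q b c = 0 -> q c d = 0 -> q b d = 0.
Proof.
move=> /hamming_le h1 /hamming_le h2; apply: q_eq0.
have := hamming_triangle b c d; rewrite -(ler_nat R) natrD => h3.
apply: le_lt_trans h3 _; apply: le_lt_trans (lerD h1 h2) _.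
by rewrite -mulrDl ltr_pM2r //; have := dl0; have := eps_dl; lra.
Qed.

(** Equal values on the sample make the codegree vectors close in mean square, hence [val] differs
    in few places, hence [q] vanishes. The number of labels counts the possible value patterns on
    the sample. *)
Lemma hamming_class_labels :
  exists cl : B -> 'I_((size s).+1 ^ (k ^ 2)), forall b c, cl b = cl c <-> q b c = 0.
Proof.
have [ws sws hws] := codegree_sample A0 B0 f01 k0.
have [b0 _] := card_gt0P B0.
pose sig b : {ffun 'I_(k ^ 2) -> 'I_(size s).+1} :=
  [ffun i : 'I_(k ^ 2) => inord (index (val b (nth b0 ws i)) s)].
have [||||b c|cl hcl] := @labels_of_signature _ _ (fun b c => q b c == 0) sig
  ((size s).+1 ^ (k ^ 2)).
- by move=> b; rewrite q_refl eqxx.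
- by move=> b c; apply/eqP/eqP; exact: q_sym.
- by move=> c b d /eqP h1 /eqP h2; rewrite (q_trans h1 h2).
- by rewrite card_ffun !card_ord.
- move=> sbc; apply/eqP/q_eq0.
  have vw w : w \in ws -> val b w = val c w.
    move=> wws; have iw : (index w ws < k ^ 2)%N by rewrite -sws index_mem.
    have /(congr1 (fun h : {ffun _ -> _} => nat_of_ord (h (Ordinal iw)))) := sbc.
    have is_ d v : (index (val d v) s < (size s).+1)%N by rewrite ltnS index_size.
    rewrite !ffunE /= !inordK // nth_index //.
    by move=> /(congr1 (nth 0 s)); rewrite !nth_index.
  have sum_ws : \sum_(w <- ws) (codegree f b w - codegree f c w) ^+ 2 <=
      (k ^ 2)%:R * (4 * eps ^+ 2).
    rewrite -sws mulr_natl -[_ *+ size ws]iter_addr_0 -(count_predT ws) -big_const_seq.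
    rewrite big_seq [leRHS]big_seq; apply: ler_sum => w wws.
    have := near_val b w; have := near_val c w; rewrite (vw w wws) !ler_norml.
    move=> /andP[h1 h2] /andP[h3 h4].
    rewrite -[leLHS]real_normK ?num_real //.
    rewrite (_ : 4 * eps ^+ 2 = (2 * eps) ^+ 2); last by ring.
    by rewrite ler_pXn2r ?nnegrE ?mulr_ge0 // ler_norml; apply/andP; split; lra.
  have := hws b c.
  have k20 : 0 < (k ^ 2)%:R :> R by rewrite ltr0n expn_gt0 k0.
  have := ler_wpM2r (ltW (_ : 0 < (k ^ 2)%:R^-1)) sum_ws.
  rewrite invr_gt0 => /(_ k20); rewrite mulrAC divff ?gt_eqF // mul1r => h1 h2.
  have {h2}h1 := le_trans h2 (lerD h1 (lexx _)).
  (* Where [val] differs it does so by at least [g], and the codegrees by at least [g - 2 * eps],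
     which is no less than [g / 2]. *)
  have hs : (g / 2) ^+ 2 * (hamming b c)%:R <=
      \sum_w (codegree f b w - codegree f c w) ^+ 2.
    rewrite (bigID [pred w | val b w != val c w]) /= -[leLHS]addr0.
    apply: lerD; last by rewrite sumr_ge0 // => w _; exact: sqr_ge0.
    rewrite mulr_natr -sumr_const; apply: ler_sum => w.
    rewrite inE => /(gap (vals b w) (vals c w)) gw.
    rewrite -[leRHS]real_normK ?num_real // ler_pXn2r ?nnegrE ?divr_ge0 ?(ltW g0) //.
    have := near_val b w; have := near_val c w; move: gw.
    have := ler_distD (codegree f b w) (val b w) (val c w).
    have := ler_distD (codegree f c w) (codegree f b w) (val c w).
    by have := eps_g; rewrite [`|val b w - codegree _ _ _|]distrC; lra.
  have h2 : (g / 2) ^+ 2 * (hamming b c)%:R <= (4 * eps ^+ 2 + k%:R^-1) * #|B|%:R.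
    by apply: le_trans hs _; rewrite -ler_pdivrMr.
  have g20 : 0 < (g / 2) ^+ 2 by rewrite exprn_gt0 ?divr_gt0.
  rewrite -(ltr_pM2l g20); apply: le_lt_trans h2 _.
  rewrite [ltRHS]mulrA ltr_pM2r //; apply: (@le_lt_trans _ _ ((g / 2) ^+ 2 * (dl / 2))).
    by rewrite expr_div_n; move: eps_k; lra.
  by rewrite ltr_pM2l //; have := dl0; lra.
- exists cl => b c; split=> [/hcl/eqP//|/eqP]; exact: (hcl b c).2.
Qed.

(** Within a class, codegrees differ by at most [2 * eps] where [val] agrees, and by at most 1 on
    the remaining proportion of at most [eps]. So [eta] is [3 * eps], and the factor 4 of the Gram
    estimate gives 12. *)
Lemma hamming_class_cut (J : finType) (cl : B -> J) :
  (forall b c, cl b = cl c <-> q b c = 0) ->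
  forall (x : A -> R) (y : B -> R),
  (forall a, `|x a| <= 1) -> (forall b, `|y b| <= 1) ->
  (\sum_a \sum_b x a * y b * (f a b - class_avg cl (f a) b)) ^+ 2 <=
  12 * eps * (#|A|%:R * #|B|%:R) ^+ 2.
Proof.
move=> hcl x y x1 y1.
have -> : 12 * eps = 4 * (3 * eps) by ring.
apply: cut_class_avg => // b c /hcl /hamming_le h.
apply: (@le_trans _ _ (\sum_w (2 * eps + (val b w != val c w)%:R))).
  apply: ler_sum => w _; have := near_val b w; have := near_val c w.
  have /andP[h1 h2] := codegree01 A0 f01 b w.
  have /andP[h3 h4] := codegree01 A0 f01 c w.
  rewrite !ler_norml => /andP[? ?] /andP[? ?]; have := eps0.
  by case: eqP => /= [e|_] ?; apply/andP; split; lra.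
rewrite big_split /= sumr_const -natr_sum -[_ *+ #|_|]mulr_natr.
have -> : (\sum_w (val b w != val c w))%N = hamming b c.
  by rewrite /hamming -sum1_card [RHS]big_mkcond; apply: eq_bigr => w _; rewrite inE; case: eqP.
lra.
Qed.

End classes.

(* Class averaging is self-adjoint, hence can be moved to the weights. *)
Lemma cut_double_avg (R : realFieldType) (A B I J : finType) (f : A -> B -> R)
    (clA : A -> I) (clB : B -> J) (z : R) :
  (forall (x : A -> R) (y : B -> R),
    (forall a, `|x a| <= 1) -> (forall b, `|y b| <= 1) ->
    `|\sum_a \sum_b x a * y b * (f a b - class_avg clB (f a) b)| <= z) ->
  (forall (x : A -> R) (y : B -> R),
    (forall a, `|x a| <= 1) -> (forall b, `|y b| <= 1) ->
    `|\sum_a \sum_b x a * y b * (f a b - class_avg clA (f^~ b) a)| <= z) ->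
  forall (x : A -> R) (y : B -> R),
    (forall a, `|x a| <= 1) -> (forall b, `|y b| <= 1) ->
    `|\sum_a \sum_b x a * y b *
       (f a b - class_avg clA (fun a' => class_avg clB (f a') b) a)| <= 2 * z.
Proof.
move=> hB hA x y x1 y1.
(* The error of the double average is the error of averaging over [clA] alone plus the [clA]-average
   of the error of averaging over [clB]. *)
have -> : \sum_a \sum_b x a * y b *
      (f a b - class_avg clA (fun a' => class_avg clB (f a') b) a) =
    \sum_a \sum_b x a * y b * (f a b - class_avg clA (f^~ b) a) +
    \sum_a \sum_b class_avg clA x a * y b * (f a b - class_avg clB (f a) b).
  have -> : \sum_a \sum_b class_avg clA x a * y b * (f a b - class_avg clB (f a) b) =
      \sum_a \sum_b x a * y b * (class_avg clA (f^~ b) a -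
        class_avg clA (fun a' => class_avg clB (f a') b) a).
    rewrite exchange_big [RHS]exchange_big; apply: eq_bigr => b _ /=.
    under eq_bigr do rewrite -mulrA mulrCA; rewrite -mulr_sumr -class_avg_adjoint.
    by rewrite mulr_sumr; apply: eq_bigr => a _; rewrite class_avgB; ring.
  rewrite -big_split; apply: eq_bigr => a _; rewrite -big_split.
  by apply: eq_bigr => b _ /=; ring.
apply: le_trans (ler_normD _ _) _.
have := hA x y x1 y1.
have := hB (class_avg clA x) y (fun a => class_avg_norm_le (fun c _ => x1 c)) y1.
lra.
Qed.

(** * Cut norm and cut distance of kernels *)

Section cut_norm.
Variable R : realType.
Implicit Types (W : R * R -> R) (A B : set R).

Local Notation I01 := (@unit_itv R).
Local Notation leb := (@lebesgue_measure R).
Local Notation leb2 := (leb \x leb)%E.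
Local Notation I2 := (I01 `*` I01).

Lemma measurable_I01 : measurable I01.
Proof. exact: measurable_itv. Qed.

Lemma leb_I01 : leb I01 = 1%E.
Proof. by rewrite /unit_itv lebesgue_measure_itv /= lte_fin ltr01 sube0. Qed.

Definition bounded_kernel W : Prop :=
  measurable_fun I2 W /\ forall z, I2 z -> `|W z| <= 1.

Lemma measurable_I2 : measurable I2.
Proof. by apply: measurableX; exact: measurable_I01. Qed.

Lemma kernel_integrable W A B : bounded_kernel W ->
  measurable A -> A `<=` I01 -> measurable B -> B `<=` I01 ->
  leb2.-integrable (A `*` B) (EFin \o W).
Proof.
move=> [mW bW] mA AI mB BI.
have sub : A `*` B `<=` I2 by move=> z [/AI ? /BI].
have mAB : measurable (A `*` B) by exact: measurableX.
have fin : (leb2 (A `*` B) < +oo)%E.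
  rewrite product_measure1E //; apply: (@le_lt_trans _ _ (leb I01 * leb I01)%E).
    by apply: lee_pmul => //; apply: le_measure; rewrite ?inE //; exact: measurable_I01.
  by rewrite leb_I01 mule1 ltry.
apply: measurable_bounded_integrable => //.
- exact: measurable_funS measurable_I2 sub mW.
- exists 1; split; first exact: num_real.
  by move=> x x1 z /sub /bW h; rewrite /= (le_trans h) // ltW.
Qed.

Lemma cut_norm_le W (c : \bar R) :
  (forall A B, measurable A -> A `<=` I01 -> measurable B -> B `<=` I01 ->
     (`|\int[leb2]_(z in A `*` B) (W z)%:E| <= c)%E) -> (cut_norm W <= c)%E.
Proof. by move=> h; apply: ge_ereal_sup => _ [A [mA AI] [B [mB BI] <-]]; exact: h. Qed.

Lemma cut_norm_ub W A B :
  measurable A -> A `<=` I01 -> measurable B -> B `<=` I01 ->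
  (`|\int[leb2]_(z in A `*` B) (W z)%:E| <= cut_norm W)%E.
Proof. by move=> *; apply: ereal_sup_ubound; exists A => //; exists B. Qed.

Lemma cut_norm_ge0 W : (0 <= cut_norm W)%E.
Proof.
by apply: le_trans (abse_ge0 _) (@cut_norm_ub W set0 set0 _ _ _ _).
Qed.

Lemma cut_norm_eq W W' : (forall z, I2 z -> W z = W' z) -> cut_norm W = cut_norm W'.
Proof.
move=> WW; congr ereal_sup; apply/seteqP; split=> _ [A [mA AI] [B [mB BI] <-]];
  exists A => //; exists B => //; congr (`| _ |)%E; apply: eq_integral => z;
  rewrite inE => -[/AI ? /BI ?]; congr _%:E.
- by apply/esym/WW.
- exact: WW.
Qed.

Lemma cut_norm_opp W : bounded_kernel W -> cut_norm (fun z => - W z) = cut_norm W.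
Proof.
have le W' : bounded_kernel W' -> (cut_norm (fun z => - W' z)%R <= cut_norm W')%E.
  move=> kW; apply: cut_norm_le => A B mA AI mB BI.
  have -> : (\int[leb2]_(z in A `*` B) (- W' z)%R%:E)%E = (- \int[leb2]_(z in A `*` B) (W' z)%:E)%E.
    under eq_integral do rewrite EFinN.
    rewrite integralN //; apply: integrable_add_def; first exact: measurableX.
    exact: (kernel_integrable kW).
  by rewrite abseN; exact: cut_norm_ub.
move=> kW; apply/eqP; rewrite eq_le le //=.
have kN : bounded_kernel (fun z => - W z).
  have [mW bW] := kW; split; first exact: measurableT_comp.
  by move=> z /bW; rewrite normrN.
by have := le _ kN; under [X in (cut_norm X <= _)%E]eq_fun do rewrite opprK.
Qed.

Lemma cut_normD W W' : bounded_kernel W -> bounded_kernel W' ->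
  (cut_norm (fun z => W z + W' z)%R <= cut_norm W + cut_norm W')%E.
Proof.
move=> kW kW'; apply: cut_norm_le => A B mA AI mB BI.
have -> : (\int[leb2]_(z in A `*` B) (W z + W' z)%R%:E)%E =
    (\int[leb2]_(z in A `*` B) (W z)%:E + \int[leb2]_(z in A `*` B) (W' z)%:E)%E.
  rewrite -integralD //; [exact: measurableX|exact: (kernel_integrable kW)|].
  exact: (kernel_integrable kW').
apply: le_trans (lee_abs_add _ _) _.
by apply: leeD; exact: cut_norm_ub.
Qed.

Local Notation imp := (@invertible_measure_preserving R).

(** Measure-preserving maps are specified on the unit interval only. Extended by the identity they
    are measurable and preserve Lebesgue measure on the whole line, so that uniqueness of product
    measures applies. *)
Definition extend_id (f : R -> R) (x : R) : R := if x \in I01 then f x else x.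

Lemma imp_in f x : imp f -> I01 x -> I01 (f x).
Proof. by move=> [[h _ _] _ _ _]; exact: h. Qed.

Lemma imp_preimage f A : imp f -> measurable A -> measurable (I01 `&` f @^-1` A).
Proof. by move=> [_ mf _ _] mA; exact: mf measurable_I01 _ mA. Qed.

Lemma extend_id_preimage f A : imp f ->
  extend_id f @^-1` A = (I01 `&` f @^-1` (A `&` I01)) `|` (A `\` I01).
Proof.
move=> fi; apply/seteqP; split=> x; rewrite /extend_id /=.
  have [xI|xI] := boolP (x \in I01) => h.
    by left; move: xI; rewrite inE => xI; split=> //; split=> //; exact: imp_in.
  by right; split=> //; move: xI; rewrite notin_setE.
case=> [[xI [Af _]]|[Ax xI]]; first by rewrite mem_set.
by rewrite memNset.
Qed.

Lemma measurable_extend_id f : imp f -> measurable_fun setT (extend_id f).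
Proof.
move=> fi _ A mA; rewrite setTI extend_id_preimage //; apply: measurableU.
  by apply: imp_preimage => //; apply: measurableI => //; exact: measurable_I01.
by apply: measurableD => //; exact: measurable_I01.
Qed.

Lemma extend_id_preserving f A : imp f -> measurable A ->
  leb (extend_id f @^-1` A) = leb A.
Proof.
move=> fi mA; have mI := measurable_I01; rewrite extend_id_preimage // measureU.
- rewrite [RHS](measureDI leb mA mI) [RHS]addeC; congr (_ + _)%E.
  by have [_ _ _ h] := fi; apply: h => //; exact: measurableI.
- by apply: imp_preimage => //; exact: measurableI.
- exact: measurableD.
- by apply/seteqP; split=> // x [[xI _] [_]].
Qed.

Definition pair_map (f g : R -> R) (z : R * R) : R * R :=
  (extend_id f z.1, extend_id g z.2).

Lemma measurable_pair_map f g : imp f -> imp g -> measurable_fun setT (pair_map f g).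
Proof.
move=> fi gi; apply: measurable_fun_pair.
- by apply: measurableT_comp (measurable_extend_id fi) _; exact: measurable_fst.
- by apply: measurableT_comp (measurable_extend_id gi) _; exact: measurable_snd.
Qed.

Local Notation RR := (measurableTypeR R * measurableTypeR R)%type.

(** By uniqueness of the product measure it is enough to compare both measures on rectangles. *)
Lemma pair_map_preserving f g (D : set RR) : imp f -> imp g -> measurable D ->
  leb2 D = pushforward leb2 (pair_map f g : RR -> RR) D.
Proof.
move=> fi gi mD; have mp := measurable_pair_map fi gi.
apply: product_measure_unique => // A B mA mB.
have EA := extend_id_preserving fi mA; have EB := extend_id_preserving gi mB.
rewrite -[X in _ = (X * _)%E]EA -[X in _ = (_ * X)%E]EB /pushforward.
have mA' : measurable (extend_id f @^-1` A).
  by rewrite -[X in measurable X]setTI; exact: (measurable_extend_id fi).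
have mB' : measurable (extend_id g @^-1` B).
  by rewrite -[X in measurable X]setTI; exact: (measurable_extend_id gi).
exact: (product_measure1E leb leb mA' mB').
Qed.

Lemma imp_image f A : imp f -> A `<=` I01 -> extend_id f @^-1` (f @` A) = A.
Proof.
move=> fi AI; have [[fI finj _] _ _ _] := fi.
apply/seteqP; split=> x; rewrite /extend_id /=; last first.
  by move=> Ax; rewrite mem_set; [exists x|exact: AI].
have [xI|xI] := boolP (x \in I01) => -[y Ay].
  move=> /finj E; rewrite -E // inE; exact: AI.
by move=> E; move: xI; rewrite -E notin_setE => -[]; apply: fI; exact: AI.
Qed.

(** Change of variables: by injectivity, the rectangle on [A] and [B] is the full preimage of its
    image. *)
Lemma integral_pair_map W f g A B : bounded_kernel W -> imp f -> imp g ->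
  measurable A -> A `<=` I01 -> measurable B -> B `<=` I01 ->
  (\int[leb2]_(z in A `*` B) (W (f z.1, g z.2))%:E)%E =
  (\int[leb2]_(z in (f @` A) `*` (g @` B)) (W z)%:E)%E.
Proof.
move=> kW fi gi mA AI mB BI; have [mW bW] := kW.
have mp := measurable_pair_map fi gi.
have mfA : measurable (f @` A) by have [_ _ h _] := fi; exact: h.
have mgB : measurable (g @` B) by have [_ _ h _] := gi; exact: h.
have fAI : f @` A `<=` I01 by move=> _ [x /AI xI <-]; exact: imp_in.
have gBI : g @` B `<=` I01 by move=> _ [x /BI xI <-]; exact: imp_in.
(* [W] is measurable on the unit square only; extended by 0 it is measurable on the plane, as the
   pushforward formula requires. *)
pose W0 : R * R -> \bar R := (EFin \o W) \_ I2.
have W0E z : I2 z -> W0 z = (W z)%:E.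
  by move=> Iz; rewrite /W0 patchE mem_set.
have mW0 : measurable_fun setT W0.
  apply/(measurable_restrictT (EFin \o W) measurable_I2).
  by apply/measurable_EFinP.
pose D : set RR := (f @` A) `*` (g @` B).
have mD : measurable D by exact: measurableX.
have pre : (pair_map f g : RR -> RR) @^-1` D = A `*` B.
  by rewrite -{1}(imp_image fi AI) -{1}(imp_image gi BI).
transitivity (\int[leb2]_(z in (pair_map f g : RR -> RR) @^-1` D) (W0 \o pair_map f g) z)%E.
  rewrite pre; apply: eq_integral => z; rewrite inE => -[/AI z1 /BI z2].
  rewrite /= W0E /pair_map /extend_id ?mem_set //.
  by split; exact: imp_in.
transitivity (\int[pushforward leb2 (pair_map f g : RR -> RR)]_(z in D) W0 z)%E.
  rewrite integral_pushforward //= pre.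
  have kc : bounded_kernel (fun z => fine (W0 (pair_map f g z))).
    split; first by apply: measurableT_comp => //; apply: measurable_funTS; exact: measurableT_comp.
    move=> z [z1 z2]; rewrite W0E /= /pair_map /extend_id ?mem_set //; last first.
      by split; exact: imp_in.
    by apply: bW; split; exact: imp_in.
  have := kernel_integrable kc mA AI mB BI; congr (integrable _ _ _).
  apply/funext => z; rewrite /= fineK // /W0 patchE; case: ifP => //.
transitivity (\int[leb2]_(z in D) W0 z)%E.
  apply: eq_measure_integral => E mE _; exact/esym/pair_map_preserving.
apply: eq_integral => z; rewrite inE => -[/fAI ? /gBI ?]; exact: W0E.
Qed.

Lemma cut_norm_comp W f g : bounded_kernel W -> imp f -> imp g ->
  (cut_norm (fun z => W (f z.1, g z.2)) <= cut_norm W)%E.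
Proof.
move=> kW fi gi; apply: cut_norm_le => A B mA AI mB BI.
rewrite (integral_pair_map kW fi gi mA AI mB BI); apply: cut_norm_ub.
- by have [_ _ h _] := fi; exact: h.
- by move=> _ [x /AI xI <-]; exact: imp_in.
- by have [_ _ h _] := gi; exact: h.
- by move=> _ [x /BI xI <-]; exact: imp_in.
Qed.

End cut_norm.

Section cut_distance.
Variable R : realType.
Implicit Types (W : R * R -> R) (A B : set R).

Local Notation I01 := (@unit_itv R).
Local Notation leb := (@lebesgue_measure R).
Local Notation I2 := (I01 `*` I01).
Local Notation imp := (@invertible_measure_preserving R).

Lemma imp_comp f g : imp f -> imp g -> imp (f \o g).
Proof.
move=> fi gi; have [fb _ fm fp] := fi; have [gb _ gm gp] := gi.
split.
- exact: set_bij_comp gb fb.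
- move=> _ A mA; have -> : I01 `&` (f \o g) @^-1` A = I01 `&` g @^-1` (I01 `&` f @^-1` A).
    apply/seteqP; split=> x [xI]; last by case.
    by move=> h; split=> //; split=> //; exact: imp_in.
  by apply: imp_preimage => //; exact: imp_preimage.
- move=> A mA AI; rewrite -image_comp; apply: fm; first exact: gm.
  by move=> _ [x /AI xI <-]; exact: imp_in.
- move=> A mA AI.
  have -> : I01 `&` (f \o g) @^-1` A = I01 `&` g @^-1` (I01 `&` f @^-1` A).
    apply/seteqP; split=> x [xI]; last by case.
    by move=> h; split=> //; split=> //; exact: imp_in.
  by rewrite gp ?fp //; exact: imp_preimage.
Qed.

(** Preimages under the inverse are images under [f], so its measurability comes from the clause on
    images in the definition. *)
Lemma imp_inv f : imp f -> exists2 g, imp g &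
  forall x, I01 x -> g (f x) = x /\ f (g x) = x.
Proof.
move=> fi; have [[fI finj fsurj] _ fm fp] := fi.
pose g x := xget 0 [set y | I01 y /\ f y = x].
have gP x : I01 x -> I01 (g x) /\ f (g x) = x.
  move=> xI; have [y yI fy] := fsurj x xI.
  by apply: (@xgetPex _ 0 [set y | I01 y /\ f y = x]); exists y.
have gf x : I01 x -> g (f x) = x.
  move=> xI; have [gI fg] := gP _ (fI _ xI).
  by apply: finj; rewrite ?inE.
have pre A : I01 `&` g @^-1` A = f @` (A `&` I01).
  apply/seteqP; split=> [x [xI Agx]|_ [x [Ax xI] <-]].
    by have [gI fg] := gP x xI; exists (g x).
  by split; [exact: fI|rewrite /= gf].
have img A : A `<=` I01 -> g @` A = I01 `&` f @^-1` A.
  move=> AI; apply/seteqP; split=> [_ [x Ax <-]|x [xI Afx]].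
    by have [gI fg] := gP x (AI _ Ax); split=> //=; rewrite fg.
  by exists (f x) => //; exact: gf.
exists g; last by move=> x xI; split; [exact: gf|case: (gP x xI)].
split.
- split.
  + by move=> x /gP[].
  + move=> x y; rewrite !inE => xI yI gxy.
    by have [_ <-] := gP x xI; have [_ <-] := gP y yI; rewrite gxy.
  + by move=> x xI; exists (f x); [exact: fI|exact: gf].
- move=> _ A mA; rewrite pre; apply: fm => [|x []//].
  by apply: measurableI => //; exact: measurable_I01.
- by move=> A mA AI; rewrite img //; exact: imp_preimage.
- move=> A mA AI; rewrite pre (setIidl AI).
  have ffA : I01 `&` f @^-1` (f @` A) = A.
    apply/seteqP; split=> [x [xI [y Ay]]|x Ax]; last by split; [exact: AI|exists x].
    by move=> /finj E; rewrite -E // inE //; exact: AI.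
  rewrite -{2}ffA fp //; first exact: fm.
  by move=> _ [x /AI xI <-]; exact: fI.
Qed.

Lemma graphon_comp W f g : is_graphon W -> imp f -> imp g ->
  is_graphon (fun z => W (f z.1, g z.2)).
Proof.
move=> [mW bW] fi gi; split; last first.
  by move=> z [z1 z2]; apply: bW; split; exact: imp_in.
have mp := measurable_pair_map fi gi.
have := (measurable_restrictT W (@measurable_I2 R)).1 mW.
set W0 := (_ \_ _) => mW0.
apply: (@eq_measurable_fun _ _ _ _ _ (W0 \o pair_map f g)).
  move=> z; rewrite inE => -[z1 z2].
  rewrite /= /pair_map /extend_id !(mem_set z1, mem_set z2) /W0 patchE mem_set //.
  by split; exact: imp_in.
by apply: measurable_funTS; exact: measurableT_comp.
Qed.

Lemma graphonB_kernel W W' : is_graphon W -> is_graphon W' ->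
  bounded_kernel (fun z => W z - W' z).
Proof.
move=> [mW bW] [mW' bW']; split; first exact: measurable_funB.
move=> z Iz; have /andP[h1 h2] := bW z Iz; have /andP[h3 h4] := bW' z Iz.
by rewrite ler_norml; apply/andP; split; lra.
Qed.

Lemma cut_distance_le W1 W2 f g : imp f -> imp g ->
  (cut_distance W1 W2 <= cut_norm (fun z => W1 z - W2 (f z.1, g z.2))%R)%E.
Proof. by move=> fi gi; apply: ereal_inf_lbound; exists f => //; exists g. Qed.

Lemma cut_distance_ge0 W1 W2 : (0 <= cut_distance W1 W2)%E.
Proof.
by apply: le_ereal_inf_tmp => _ [f _ [g _ <-]]; exact: cut_norm_ge0.
Qed.

(** Composing with the inverse maps moves the rearrangement to the other graphon without increasing
    the cut norm. *)
Lemma cut_distance_sym_le W1 W2 : is_graphon W1 -> is_graphon W2 ->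
  (cut_distance W1 W2 <= cut_distance W2 W1)%E.
Proof.
move=> g1 g2; apply: le_ereal_inf_tmp => _ [f fi [g gi <-]].
have [f' fi' ff'] := imp_inv fi; have [g' gi' gg'] := imp_inv gi.
apply: le_trans (cut_distance_le _ _ fi' gi') _.
have kK := graphonB_kernel g2 (graphon_comp g1 fi gi).
apply: le_trans (cut_norm_comp kK fi' gi') => /=.
rewrite -cut_norm_opp; last first.
  exact: graphonB_kernel g1 (graphon_comp g2 fi' gi').
rewrite le_eqVlt; apply/orP; left; apply/eqP/cut_norm_eq => -[x y] [/= xI yI].
have [_ ->] := ff' x xI; have [_ ->] := gg' y yI.
by rewrite opprB.
Qed.

(** The triangle inequality in strict form: strictness yields actual rearrangements from the infima,
    and these are composed. *)
Lemma cut_distance_lt_add W1 W2 W3 (a b : R) :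
  is_graphon W1 -> is_graphon W2 -> is_graphon W3 ->
  (cut_distance W1 W2 < a%:E)%E -> (cut_distance W2 W3 < b%:E)%E ->
  (cut_distance W1 W3 < (a + b)%:E)%E.
Proof.
move=> g1 g2 g3 /ereal_inf_lt[_ [f fi [g gi <-]] ha].
move=> /ereal_inf_lt[_ [f' fi' [g' gi' <-]] hb].
apply: le_lt_trans (cut_distance_le _ _ (imp_comp fi' fi) (imp_comp gi' gi)) _.
have k12 := graphonB_kernel g1 (graphon_comp g2 fi gi).
have k23 := graphonB_kernel g2 (graphon_comp g3 fi' gi').
have h23 := cut_norm_comp k23 fi gi.
have k23' := graphonB_kernel (graphon_comp g2 fi gi)
  (graphon_comp g3 (imp_comp fi' fi) (imp_comp gi' gi)).
rewrite EFinD; apply: le_lt_trans (lteD ha (le_lt_trans h23 hb)).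
apply: le_trans (cut_normD k12 k23').
rewrite le_eqVlt; apply/orP; left; apply/eqP/cut_norm_eq => z _ /=.
by rewrite addrA subrK.
Qed.

Lemma cut_distance_eq0 W1 W2 :
  (forall e : R, 0 < e -> (cut_distance W1 W2 < e%:E)%E) -> cut_distance W1 W2 = 0%E.
Proof.
move=> h; apply/eqP; rewrite eq_le cut_distance_ge0 andbT.
by apply/lee_addgt0Pr => e e0; rewrite add0e ltW // h.
Qed.

Lemma graphon_class_eq W1 W2 : is_graphon W1 -> is_graphon W2 ->
  cut_distance W1 W2 = 0%E -> graphon_class W1 = graphon_class W2.
Proof.
have sub (V1 V2 : R * R -> R) : is_graphon V1 -> is_graphon V2 -> cut_distance V1 V2 = 0%E ->
    graphon_class V2 `<=` graphon_class V1.
  move=> g1 g2 d12 W [gW d2]; split; [exact: gW|apply: cut_distance_eq0 => e e0].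
  rewrite [e]splitr; apply: (cut_distance_lt_add g1 g2 gW).
  - by rewrite d12 lte_fin divr_gt0.
  - by rewrite d2 lte_fin divr_gt0.
move=> g1 g2 d12; apply/seteqP; split; [apply: (sub _ _ g2 g1)|exact: (sub _ _ g1 g2 d12)].
apply/eqP; rewrite eq_le cut_distance_ge0 andbT -d12.
exact: cut_distance_sym_le.
Qed.

End cut_distance.

Lemma measurable_fun_pieces d d' (T : measurableType d) (U : measurableType d')
    (I : finType) (F : I -> set T) (c : I -> U) (f : T -> U) (D : set T) :
  (forall i, measurable (F i)) -> D = \bigcup_i F i ->
  (forall i x, F i x -> f x = c i) -> measurable_fun D f.
Proof.
move=> mF DE fc _ Y mY.
have -> : D `&` f @^-1` Y = \bigcup_(i in [set i | Y (c i)]) F i.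
  rewrite DE; apply/seteqP; split=> x.
    by move=> [[i _ Fx] Yf]; exists i => //=; rewrite -(fc i x).
  by move=> [i Yc Fx]; split; [exists i|rewrite /= (fc i x)].
apply: fin_bigcup_measurable => //; exact: finite_finset.
Qed.

Section kernel_integrals.
Variable R : realType.
Implicit Types (W : R * R -> R) (A B : set R).

Local Notation I01 := (@unit_itv R).
Local Notation leb := (@lebesgue_measure R).
Local Notation leb2 := (leb \x leb)%E.
Local Notation I2 := (I01 `*` I01).
Local Notation imp := (@invertible_measure_preserving R).

Lemma leb_fin A : measurable A -> A `<=` I01 -> leb A \is a fin_num.
Proof.
move=> mA AI; rewrite ge0_fin_numE //; apply: (@le_lt_trans _ _ (leb I01)).
  by apply: le_measure; rewrite ?inE //; exact: measurable_I01.
by rewrite leb_I01 ltry.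
Qed.

(** The integral over a rectangle becomes a bilinear form in the measures of the traces of [A] and
    [B], which links the cut norm to the matrix estimates. *)
Lemma integral_pieces (I J : finType) (P : I -> set R) (Q : J -> set R)
    (k : I -> J -> R) W A B :
  (forall i, measurable (P i)) -> (forall j, measurable (Q j)) ->
  trivIset setT P -> trivIset setT Q ->
  \bigcup_i P i = I01 -> \bigcup_j Q j = I01 ->
  (forall i j z, P i z.1 -> Q j z.2 -> W z = k i j) ->
  measurable A -> A `<=` I01 -> measurable B -> B `<=` I01 ->
  (\int[leb2]_(z in A `*` B) (W z)%:E)%E =
  (\sum_i \sum_j k i j * (fine (leb (A `&` P i)) * fine (leb (B `&` Q j))))%:E.
Proof.
move=> mP mQ tP tQ UP UQ Wk mA AI mB BI.
pose F (p : I * J) := (A `&` P p.1) `*` (B `&` Q p.2).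
have mAP i : measurable (A `&` P i) by exact: measurableI.
have mBQ j : measurable (B `&` Q j) by exact: measurableI.
have mF p : measurable (F p) by exact: measurableX.
have DE : A `*` B = \bigcup_p F p.
  apply/seteqP; split=> [[x y] [/= Ax By]|[x y] [p _ [[Ax _] [By _]]]//].
  have : I01 x by exact: AI.
  have : I01 y by exact: BI.
  by rewrite -{1}UQ -UP => -[j _ Qy] [i _ Px]; exists (i, j).
have FW p z : F p z -> W z = k p.1 p.2.
  by move=> [[_ Pz] [_ Qz]]; exact: Wk.
have DE' : A `*` B = \big[setU/set0]_(p <- index_enum (I * J)%type) F p.
  rewrite DE -bigcup_seq; congr (bigcup _ _).
  by apply/seteqP; split=> p //= _; rewrite mem_index_enum.
have tF : trivIset [set` index_enum (I * J)%type] F.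
  move=> [i j] [i' j'] _ _ [[x y] [[[_ Pi] [_ Qj]] [[_ Pi'] [_ Qj']]]].
  congr (_, _); first by apply: tP => //; exists x.
  by apply: tQ => //; exists y.
rewrite DE' integral_bigsetU_EFin ?index_enum_uniq //; last first.
  rewrite -DE'; apply/measurable_EFinP.
  exact: (measurable_fun_pieces mF DE FW).
rewrite pair_big /= -sumEFin; apply: eq_bigr => -[i j] _ /=.
transitivity (\int[leb2]_(z in F (i, j)) (cst (k i j)%:E) z)%E.
  by apply: eq_integral => z; rewrite inE => /FW ->.
have API : A `&` P i `<=` I01 by move=> x [/AI].
have BQI : B `&` Q j `<=` I01 by move=> x [/BI].
rewrite integral_cst; last exact: mF.
rewrite [X in (_ * X)%E](product_measure1E leb leb (mAP i) (mBQ j)).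
by rewrite EFinM; congr (_ * _)%E; rewrite EFinM !fineK ?leb_fin.
Qed.

Lemma cut_norm_le_cst W (c : R) :
  (forall A B, measurable A -> A `<=` I01 -> measurable B -> B `<=` I01 ->
    exists2 r : R, (\int[leb2]_(z in A `*` B) (W z)%:E)%E = r%:E & `|r| <= c) ->
  (cut_norm W <= c%:E)%E.
Proof.
move=> h; apply: cut_norm_le => A B mA AI mB BI.
by have [r -> rc] := h A B mA AI mB BI; rewrite abse_EFin lee_fin.
Qed.

(** The cut norm is at most the L1 norm, to which each exceptional strip contributes at most its
    width. *)
Lemma cut_norm_le_L1 W (e x y : R) (X Y : set R) :
  bounded_kernel W -> 0 <= e -> measurable X -> measurable Y ->
  (leb X <= x%:E)%E -> (leb Y <= y%:E)%E ->
  (forall z, I2 z -> `|W z| <= e + \1_X z.1 + \1_Y z.2) ->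
  (cut_norm W <= (e + x + y)%:E)%E.
Proof.
move=> kW e0 mX mY Xx Yy WXY; apply: cut_norm_le => A B mA AI mB BI.
have mAB : measurable (A `*` B) by exact: measurableX.
have iW := kernel_integrable kW mA AI mB BI.
have [miW _] := integrableP _ _ _ iW.
apply: (le_trans (le_abse_integral leb2 mAB miW)).
have leA : (leb A <= 1)%E.
  by rewrite -leb_I01; apply: le_measure; rewrite ?inE //; exact: measurable_I01.
have leB : (leb B <= 1)%E.
  by rewrite -leb_I01; apply: le_measure; rewrite ?inE //; exact: measurable_I01.
have mXT : measurable (X `*` (setT : set R)) by exact: measurableX.
have mTY : measurable ((setT : set R) `*` Y) by exact: measurableX.
apply: (@le_trans _ _ (\int[leb2]_(z in A `*` B)
    (e%:E + ((\1_(X `*` setT) z)%:E + (\1_(setT `*` Y) z)%:E)))%E).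
  apply: ge0_le_integral => //.
  - apply: measurableT_comp => //; exact: miW.
  - apply: emeasurable_funD; first exact: measurable_cst.
    by apply: emeasurable_funD; apply/measurable_EFinP; exact: measurable_indic.
  - move=> z [Az Bz]; rewrite abse_EFin -!EFinD lee_fin.
    have Iz : I2 z by split; [exact: AI|exact: BI].
    apply: le_trans (WXY z Iz) _; rewrite -addrA lerD2l.
    by rewrite !indicE !in_setX !in_setT andbT.
have mul1 (a b : \bar R) (r : R) : (0 <= a)%E -> (0 <= b)%E ->
    (a <= r%:E)%E -> (b <= 1)%E -> (a * b <= r%:E)%E.
  by move=> a0 b0 ar b1; rewrite -[leRHS]mule1; exact: lee_pmul.
rewrite ge0_integralD //; last 2 first.
  - by move=> z _; rewrite adde_ge0 // lee_fin.
  - by apply: emeasurable_funD; apply/measurable_EFinP; exact: measurable_indic.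
rewrite ge0_integralD //; last 2 first.
  - by apply/measurable_EFinP; exact: measurable_indic.
  - by apply/measurable_EFinP; exact: measurable_indic.
rewrite !integral_indic // [X in (X + _)%E](integral_cst leb2 mAB e%:E).
rewrite [leRHS]EFinD [X in (_ <= X + _)%E]EFinD -[leRHS]addeA.
apply: leeD; last apply: leeD.
- rewrite [X in (_ * X)%E](product_measure1E leb leb mA mB).
  by apply: mul1 => //; rewrite ?lee_fin ?mule_ge0 // -[leRHS]mule1 lee_pmul.
- apply: (@le_trans _ _ (leb2 (X `*` B))).
    apply: le_measure; rewrite ?inE //; [exact: measurableI|exact: measurableX|].
    by move=> z [[Xz _] [_ Bz]].
  by rewrite [X in (X <= _)%E](product_measure1E leb leb mX mB); exact: mul1.
- apply: (@le_trans _ _ (leb2 (A `*` Y))).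
    apply: le_measure; rewrite ?inE //; [exact: measurableI|exact: measurableX|].
    by move=> z [[_ Yz] [Az _]].
  by rewrite [X in (X <= _)%E](product_measure1E leb leb mA mY) muleC; exact: mul1.
Qed.

End kernel_integrals.

(** * Interval exchanges and step graphons *)

Section interval_exchange.
Variable R : realType.

Local Notation I01 := (@unit_itv R).
Local Notation leb := (@lebesgue_measure R).
Local Notation imp := (@invertible_measure_preserving R).

Lemma I01E (x : R) : I01 x = (0 <= x <= 1).
Proof. by rewrite /unit_itv /= in_itv. Qed.

(** Half-open cells are translates of each other, unlike the fibres of [interval_index], the last of
    which also contains 1. *)
Definition half_open_cell n (k : 'I_n.+1) : set R :=
  `[k%:R / n.+1%:R, k.+1%:R / n.+1%:R[.

Lemma half_open_cellE n (k : 'I_n.+1) (x : R) :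
  half_open_cell k x = (k%:R <= n.+1%:R * x < k.+1%:R).
Proof.
by rewrite /half_open_cell /= in_itv /= ler_pdivrMr // ltr_pdivlMr // [x * _]mulrC.
Qed.

Lemma half_open_cell_lt1 n (k : 'I_n.+1) (x : R) : half_open_cell k x -> 0 <= x < 1.
Proof.
rewrite half_open_cellE => /andP[h1 h2]; apply/andP; split.
  by rewrite -(pmulr_rge0 x (ltr0Sn R n)); apply: le_trans h1.
rewrite -(ltr_pM2l (ltr0Sn R n)) mulr1; apply: lt_le_trans h2 _.
by rewrite ler_nat.
Qed.

Lemma interval_index_spec n (x : R) (k : 'I_n.+1) : 0 <= x < 1 ->
  half_open_cell k x <-> interval_index n x = k.
Proof.
move=> /andP[x0 x1]; rewrite half_open_cellE.
have nx0 : 0 <= n.+1%:R * x by rewrite mulr_ge0.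
have tn : (Num.truncn (n.+1%:R * x) <= n)%N.
  by rewrite truncn_le_nat -[ltRHS]mulr1 ltr_pM2l.
rewrite /interval_index (minn_idPr tn) -(truncn_eq _ nx0); split.
  by move=> /eqP ->; exact: inord_val.
by move=> <-; rewrite inordK.
Qed.

Lemma interval_index1 n : interval_index n (1 : R) = ord_max.
Proof.
apply/val_inj; rewrite /interval_index mulr1 natrK.
by rewrite (minn_idPl (leqnSn n)) /= inordK.
Qed.

Definition index_cell n (k : 'I_n.+1) : set R :=
  I01 `&` [set x | interval_index n x = k].

Lemma index_cellE n (k : 'I_n.+1) :
  index_cell k = half_open_cell k `|` ([set 1] `&` [set _ | k = ord_max]).
Proof.
apply/seteqP; split=> [x [xI xk]|x [xk|[->/= ->]]].
- have [x1|x1] := eqVneq x 1; first by right; split=> //=; rewrite -xk x1 interval_index1.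
  left; apply/interval_index_spec => //.
  by move: xI; rewrite I01E lt_neqAle x1.
- have x01 := half_open_cell_lt1 xk.
  split; last exact/interval_index_spec.
  by rewrite I01E; case/andP: x01 => -> /ltW.
- by split; [rewrite I01E ler01 lexx|exact: interval_index1].
Qed.

Lemma measurable_half_open_cell n (k : 'I_n.+1) : measurable (half_open_cell k).
Proof. exact: measurable_itv. Qed.

Lemma measurable_index_cell n (k : 'I_n.+1) : measurable (index_cell k).
Proof.
rewrite index_cellE; apply: measurableU; first exact: measurable_half_open_cell.
have [e|e] := pselect (k = ord_max).
  by rewrite (_ : [set _ | _] = setT) ?setIT //; apply/seteqP; split.
by rewrite (_ : [set _ | _] = set0) ?setI0 //; apply/seteqP; split.
Qed.

Lemma leb_index_cell n (k : 'I_n.+1) : leb (index_cell k) = (n.+1%:R^-1)%:E.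
Proof.
apply/eqP; rewrite eq_le; apply/andP; split.
  apply: (@le_trans _ _ (leb `[(k%:R / n.+1%:R : R), k.+1%:R / n.+1%:R])).
    apply: le_measure; rewrite ?inE //; [exact: measurable_index_cell|].
    rewrite index_cellE => x [|[-> /= ->]].
      by rewrite /half_open_cell /= !in_itv /= => /andP[-> /ltW].
    by rewrite in_itv /= divff // lexx andbT ler_pdivrMr // mul1r ler_nat.
  rewrite lebesgue_measure_itv /= lte_fin ltr_pM2r ?invr_gt0 // ltr_nat ltnSn.
  by rewrite -EFinD -mulrBl -natrB // subSnn mul1r.
apply: (@le_trans _ _ (leb (half_open_cell k))).
  rewrite lebesgue_measure_itv /= lte_fin ltr_pM2r ?invr_gt0 // ltr_nat ltnSn.
  by rewrite -EFinD -mulrBl -natrB // subSnn mul1r.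
apply: le_measure; rewrite ?inE //; [exact: measurable_half_open_cell|exact: measurable_index_cell|].
by rewrite index_cellE; exact: subsetUl.
Qed.

Lemma trivIset_index_cell n : trivIset setT (@index_cell n).
Proof. by move=> i j _ _ [x [[_ <-] [_ <-]]]. Qed.

Lemma bigcup_index_cell n : \bigcup_k (@index_cell n k) = I01.
Proof.
by apply/seteqP; split=> [x [k _ []//]|x xI]; exists (interval_index n x).
Qed.

Lemma leb_translate (t : R) (A : set R) : measurable A ->
  measurable [set x | A (x + t)] /\ leb [set x | A (x + t)] = leb A.
Proof.
move=> mA; have mt : measurable_fun setT (fun x : R => x + t).
  by apply: measurable_funD => //; exact: measurable_cst.
split; first by rewrite -[X in measurable X]setTI; exact: mt.
rewrite -[LHS]/(pushforward leb ((fun x => x + t) : R -> measurableTypeR R) A).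
apply/esym/lebesgue_measure_unique => //= _ [[a b]] _ <-.
rewrite /pushforward.
have -> : (fun x => x + t) @^-1` `]a, b] = `]a - t, b - t]%classic.
  by apply/seteqP; split=> x /=; rewrite !in_itv /= ltrBlDr lerBrDr.
rewrite !lebesgue_measure_itv /= !lte_fin ltrD2r.
by case: ifP => //; rewrite -!EFinD opprB addrA subrK.
Qed.

(* The endpoint 1 has the index of the last interval; it is left fixed so that
   the map is bijective. *)
Definition exchange n (s : 'S_n.+1) (x : R) : R :=
  if x == 1 then 1 else
  x + ((s (interval_index n x))%:R - (interval_index n x)%:R) / n.+1%:R.

Lemma exchange1 n (s : 'S_n.+1) : exchange s 1 = 1.
Proof. by rewrite /exchange eqxx. Qed.

Lemma exchange_shift n (s : 'S_n.+1) (k : 'I_n.+1) (x : R) : half_open_cell k x ->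
  exchange s x = x + ((s k)%:R - k%:R) / n.+1%:R.
Proof.
move=> xk; have x01 := half_open_cell_lt1 xk.
have /(interval_index_spec _ x01) xk' := xk.
by rewrite /exchange xk'; case/andP: x01 => _ /lt_eqF ->.
Qed.

Lemma shift_cell n (j k : 'I_n.+1) (x : R) :
  half_open_cell k (x + (k%:R - j%:R) / n.+1%:R) = half_open_cell j x.
Proof.
rewrite !half_open_cellE mulrDr [_ * (_ / _)]mulrC divfK //.
congr is_true; apply/andP/andP => -[h1 h2].
- by rewrite -!natr1 in h2 *; split; lra.
- by rewrite -!natr1 in h2 *; split; lra.
Qed.

Lemma exchange_cell n (s : 'S_n.+1) (k : 'I_n.+1) (x : R) : half_open_cell k x ->
  half_open_cell (s k) (exchange s x).
Proof. by move=> xk; rewrite (exchange_shift s xk) shift_cell. Qed.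

Lemma I01_cases n (x : R) : I01 x -> x = 1 \/ exists k : 'I_n.+1, half_open_cell k x.
Proof.
rewrite I01E => /andP[x0 x1]; have [->|x1'] := eqVneq x 1; first by left.
right; exists (interval_index n x); apply/interval_index_spec => //.
by rewrite x0 lt_neqAle x1'.
Qed.

Lemma half_open_cell_I01 n (k : 'I_n.+1) : half_open_cell k `<=` I01.
Proof.
by move=> x /half_open_cell_lt1 /andP[x0 x1]; rewrite I01E x0 ltW.
Qed.

Lemma exchange_I01 n (s : 'S_n.+1) (x : R) : I01 x -> I01 (exchange s x).
Proof.
move=> /(I01_cases n)[->|[k xk]]; first by rewrite exchange1 I01E ler01 lexx.
exact: half_open_cell_I01 (exchange_cell s xk).
Qed.

Lemma exchangeK n (s : 'S_n.+1) (x : R) : I01 x -> exchange (s^-1)%g (exchange s x) = x.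
Proof.
move=> /(I01_cases n)[->|[k xk]]; first by rewrite !exchange1.
rewrite (exchange_shift _ (exchange_cell s xk)) (exchange_shift s xk) permK.
by rewrite -addrA -mulrDl addrA subrK subrr mul0r addr0.
Qed.

Lemma exchange_preimage n (s : 'S_n.+1) (A : set R) :
  I01 `&` exchange s @^-1` A = (A `&` [set 1]) `|`
    \big[setU/set0]_(k < n.+1)
      [set x | (half_open_cell (s k) `&` A) (x + ((s k)%:R - k%:R) / n.+1%:R)].
Proof.
rewrite -(bigcup_mkord_ord (fun k : 'I_n.+1 =>
  [set x | (half_open_cell (s k) `&` A) (x + ((s k)%:R - k%:R) / n.+1%:R)])).
apply/seteqP; split=> [x [xI]|x].
  move: (xI) => /(I01_cases n)[->|[k xk]] /=; first by rewrite exchange1; left.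
  rewrite (exchange_shift s xk) => Ax; right; exists k => //=.
  by rewrite inord_val; split=> //; rewrite shift_cell.
case=> [[Ax /= x1]|[k /= kn]].
  by rewrite x1 in Ax *; split; [rewrite I01E ler01 lexx|rewrite /= exchange1].
move=> [h Ax]; have xk : half_open_cell (inord k : 'I_n.+1) x by rewrite -(shift_cell _ (s (inord k))).
split; first exact: half_open_cell_I01 xk.
by rewrite /= (exchange_shift s xk).
Qed.

Lemma measurable_exchange_preimage n (s : 'S_n.+1) (A : set R) : measurable A ->
  measurable (I01 `&` exchange s @^-1` A).
Proof.
move=> mA; rewrite exchange_preimage; apply: measurableU.
  exact: measurableI.
apply: bigsetU_measurable => k _.
have := leb_translate (((s k)%:R - k%:R) / n.+1%:R)
  (measurableI _ _ (measurable_half_open_cell (s k)) mA).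
by case.
Qed.

(** The right-hand side does not involve [s]; comparison with the identity permutation will show
    that exchanges preserve measure. *)
Lemma leb_exchange_preimage n (s : 'S_n.+1) (A : set R) : measurable A ->
  leb (I01 `&` exchange s @^-1` A) = (\sum_(k < n.+1) leb (half_open_cell k `&` A))%E.
Proof.
move=> mA.
have trs k := leb_translate (((s k)%:R - k%:R) / n.+1%:R)
  (measurableI _ _ (measurable_half_open_cell (s k)) mA).
have mk k := (trs k).1.
rewrite exchange_preimage measureU; last first.
- rewrite -(bigcup_mkord_ord (fun k : 'I_n.+1 =>
    [set x | (half_open_cell (s k) `&` A) (x + ((s k)%:R - k%:R) / n.+1%:R)])).
  apply/seteqP; split=> // x [[_ ->] [k _ [h _]]].
  have := half_open_cell_lt1 (k := inord k : 'I_n.+1) (x := 1).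
  by rewrite -(shift_cell _ (s (inord k))) ltxx andbF => /(_ h).
- by apply: bigsetU_measurable => k _; exact: mk.
- exact: measurableI.
rewrite [X in (X + _)%E](_ : _ = 0%E) ?add0e; last first.
  apply/eqP; rewrite eq_le measure_ge0 andbT -(lebesgue_measure_set1 (1 : R)).
  by apply: le_measure; rewrite ?inE //; exact: measurableI.
rewrite measure_bigsetU_ord //; last first.
  move=> j k _ _ [x [[h _] [h' _]]]; move: h h'; rewrite !shift_cell => xj xk.
  have /(interval_index_spec _ (half_open_cell_lt1 xj)) <- := xj.
  by have /(interval_index_spec _ (half_open_cell_lt1 xj)) <- := xk.
rewrite [RHS](reindex_inj (@perm_inj _ s)); apply: eq_bigr => k _.
exact: (trs k).2.
Qed.

Lemma exchange_imp n (s : 'S_n.+1) : imp (exchange s).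
Proof.
have ex1 x : I01 x -> exchange (1 : 'S_n.+1)%g x = x.
  move=> /(I01_cases n)[->|[k xk]]; first by rewrite exchange1.
  by rewrite (exchange_shift _ xk) perm1 subrr mul0r addr0.
have exV x : I01 x -> exchange s (exchange (s^-1)%g x) = x.
  by move=> xI; rewrite -{1}[s]invgK exchangeK.
split.
- split.
  + by move=> x; exact: exchange_I01.
  + move=> x y; rewrite !inE => xI yI e.
    by rewrite -(exchangeK s xI) e exchangeK.
  + move=> x xI; exists (exchange (s^-1)%g x); first exact: exchange_I01.
    exact: exV.
- by move=> _ A mA; exact: measurable_exchange_preimage.
- move=> A mA AI; have -> : exchange s @` A = I01 `&` exchange (s^-1)%g @^-1` A.
    apply/seteqP; split=> [_ [x Ax <-]|x [xI Ax]].
      by split; [exact/exchange_I01/AI|rewrite /= exchangeK //; exact: AI].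
    by exists (exchange (s^-1)%g x) => //; exact: exV.
  exact: measurable_exchange_preimage.
- move=> A mA AI; rewrite leb_exchange_preimage // -(leb_exchange_preimage 1%g) //.
  congr (leb _); apply/seteqP; split=> [x [xI]|x Ax]; first by rewrite /= ex1.
  by split; [exact: AI|rewrite /= ex1 //; exact: AI].
Qed.

End interval_exchange.

(** Used to bring each class of vertices into consecutive intervals, where it becomes one step. *)
Lemma sorting_perm n K (cl : 'I_n.+1 -> 'I_K) : exists s : 'S_n.+1, forall b i,
  (#|[pred c | cl c <= i]| <= s b)%N = (i < cl b)%N.
Proof.
(* Predecessors in the lexicographic order of label and index; this order is total, so ranks are
   distinct. *)
pose below b := [pred c | (cl c < cl b)%N || (cl c == cl b) && (c < b)%N].
have lt_below b : (#|below b| < n.+1)%N.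
  apply: (@leq_trans #|'I_n.+1|); last by rewrite card_ord.
  apply: proper_card; apply/properP; split.
    exact: subset_predT.
  by exists b => //; rewrite !inE ltnn eqxx ltnn.
pose rk b : 'I_n.+1 := Ordinal (lt_below b).
have below_total b c : b != c -> (b \in below c) (+) (c \in below b).
  rewrite !inE -!val_eqE /=.
  by case: (ltngtP (cl b) (cl c)) => h; case: (ltngtP b c) => h' //=.
have lt_rk b c : b \in below c -> (#|below b| < #|below c|)%N.
  move=> bc; apply: proper_card; apply/properP; split; last first.
    by exists b => //; rewrite !inE ltnn eqxx ltnn.
  apply/fintype.subsetP => d; move: bc; rewrite !inE -!val_eqE /= => h1 h2; lia.
have rk_inj : injective rk.
  move=> b c /(congr1 val) /= e; apply/eqP; apply: contraT => /below_total.
  by case bc: (b \in below c); case cb: (c \in below b) => //= _;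
    [have := lt_rk _ _ bc|have := lt_rk _ _ cb]; rewrite e ltnn.
exists (perm rk_inj) => b i; rewrite permE /=.
apply/idP/idP => [|ib].
  apply: contraTT; rewrite -leqNgt -ltnNge => bi; apply: proper_card.
  apply/properP; split; last by exists b; rewrite !inE ?ltnn ?eqxx ?ltnn.
  by apply/fintype.subsetP => c; rewrite !inE -val_eqE /=; lia.
apply: subset_leq_card; apply/fintype.subsetP => c; rewrite !inE; lia.
Qed.

Section step_graphons.
Variable R : realType.

Local Notation I01 := (@unit_itv R).
Local Notation leb := (@lebesgue_measure R).
Local Notation imp := (@invertible_measure_preserving R).

Definition cut_point K (p : 'I_K.+1 -> R) (i : 'I_K.+1) : R :=
  \sum_(j < K.+1 | (j <= i)%N) p j.

(** Counting cut points gives a partition of [0, 1] for arbitrary real [p]: candidate lengths are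
    drawn from a finite list and may be negative or fail to sum to 1. *)
Definition step_index K (p : 'I_K.+1 -> R) (x : R) : 'I_K.+1 :=
  inord (minn K #|[pred i | cut_point p i <= x]|).

Definition step_cell K (p : 'I_K.+1 -> R) (i : 'I_K.+1) : set R :=
  I01 `&` [set x | step_index p x = i].

Lemma measurable_finite_type (J : finType) (T : Type) (E : J -> set R)
    (h : {ffun J -> bool} -> T) (t : T) : (forall j, measurable (E j)) ->
  measurable [set x | h [ffun j => x \in E j] = t].
Proof.
move=> mE.
have -> : [set x | h [ffun j => x \in E j] = t] =
    \bigcup_(v in [set v : {ffun J -> bool} | h v = t])
      \bigcap_j (if v j then E j else ~` E j).
  apply/seteqP; split=> [x /= hx|x [v /= <- xv] /=].
    exists [ffun j => x \in E j] => //= j _; rewrite ffunE.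
    by case: ifPn; rewrite ?notin_setE // inE.
  congr h; apply/ffunP => j; rewrite ffunE; have := xv j I.
  by case: (v j) => h'; [rewrite mem_set|rewrite memNset].
apply: fin_bigcup_measurable => [|v _]; first exact: finite_finset.
apply: fin_bigcap_measurable => [|j _]; first exact: finite_finset.
by case: (v j) => //; exact: measurableC.
Qed.

Lemma measurable_step_cell K (p : 'I_K.+1 -> R) i : measurable (step_cell p i).
Proof.
apply: measurableI; first exact: measurable_I01.
pose E (j : 'I_K.+1) : set R := `[cut_point p j, +oo[%classic.
have := @measurable_finite_type _ _ E
  (fun v : {ffun 'I_K.+1 -> bool} => inord (minn K #|[pred j | v j]|) : 'I_K.+1) i
  (fun j => measurable_itv _).
congr measurable; apply/seteqP; split=> x /= <-; congr (inord (minn K _));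
  by apply: eq_card => j; rewrite !inE ffunE /E; apply/idP/idP;
    rewrite inE /= in_itv /= andbT.
Qed.

Lemma step_cell_partition K (p : 'I_K.+1 -> R) : finite_partition (step_cell p).
Proof.
split; first exact: measurable_step_cell.
- by move=> i j _ _ [x [[_ <-] [_ <-]]].
- by apply/seteqP; split=> [x [k _ []//]|x xI]; exists (step_index p x).
Qed.

(** After sorting, the class boundaries [c' i] differ from the cut points by at most [K.+1 * eps],
    being sums of at most [K.+1] terms. Labels disagree only between a boundary and its cut point,
    that is, on [K.+1] intervals of at most that length and a null set. *)
Lemma exchange_step n K (cl : 'I_n.+1 -> 'I_K.+1) (p : 'I_K.+1 -> R) (eps : R) :
  (forall i, `|#|[pred b | cl b == i]|%:R / n.+1%:R - p i| <= eps) ->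
  exists2 f, imp f & exists X, [/\ measurable X,
    (leb X <= (K.+1%:R ^+ 2 * eps)%:E)%E &
    forall x, I01 x -> ~ X x -> step_index p (f x) = cl (interval_index n x)].
Proof.
move=> hp; have [s hs] := sorting_perm cl.
have fi := exchange_imp R s; exists (exchange s) => //.
have eps0 : 0 <= eps by apply: le_trans (hp ord0).
pose c' i : R := #|[pred b | (cl b <= i)%N]|%:R / n.+1%:R.
have cc' (i : 'I_K.+1) : `|c' i - cut_point p i| <= K.+1%:R * eps.
  have -> : c' i = \sum_(j < K.+1 | (j <= i)%N) #|[pred b | cl b == j]|%:R / n.+1%:R.
    rewrite /c' -mulr_suml -natr_sum; congr (_%:R / _).
    rewrite -sum1_card (partition_big cl (fun j => (j <= i)%N)) //=.
    apply: eq_bigr => j ji; rewrite -sum1_card; apply: eq_bigl => b.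
    by rewrite !inE; case: eqP => [->|]; rewrite ?ji ?andbF.
  rewrite /cut_point -sumrB; apply: le_trans (ler_norm_sum _ _ _) _.
  apply: (@le_trans _ _ (\sum_(j < K.+1 | (j <= i)%N) eps)).
    by apply: ler_sum => j _.
  apply: (@le_trans _ _ (\sum_(j < K.+1) eps)).
    by rewrite big_mkcond /=; apply: ler_sum => j _; case: ifP.
  by rewrite sumr_const card_ord mulr_natl.
pose Z (i : 'I_K.+1) : set R :=
  `[Num.min (c' i) (cut_point p i), Num.max (c' i) (cut_point p i)]%classic.
(* The point 1 is included because exchanges fix it instead of moving it with its interval. *)
pose Y : set R := [set 1] `|` \big[setU/set0]_(i < K.+1) Z i.
have mZ i : measurable (Z i) by exact: measurable_itv.
have mbZ : measurable (\big[setU/set0]_(i < K.+1) Z i).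
  by apply: bigsetU_measurable => i _.
have mY : measurable Y by exact: measurableU.
have lZ i : (leb (Z i) <= (K.+1%:R * eps)%:E)%E.
  rewrite lebesgue_measure_itv /=; case: ifP => _; last by rewrite lee_fin mulr_ge0.
  rewrite -EFinD lee_fin; apply: le_trans (cc' i).
  by have [h|h] := leP (c' i) (cut_point p i); [rewrite distrC|]; exact: ler_norm.
exists (I01 `&` exchange s @^-1` Y); split.
- exact: imp_preimage.
- have mYI : measurable (Y `&` I01) by apply: measurableI => //; exact: measurable_I01.
  have -> : I01 `&` exchange s @^-1` Y = I01 `&` exchange s @^-1` (Y `&` I01).
    apply/seteqP; split=> x [xI]; last by case.
    by move=> Yx; split=> //; split=> //; exact: exchange_I01.
  have [_ _ _ ->//] := fi.
  apply: (@le_trans _ _ (leb Y)); first by apply: le_measure; rewrite ?inE.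
  apply: (@le_trans _ _ (leb [set (1%R : R)] + leb (\big[setU/set0]_(i < K.+1) Z i))%E).
    exact: measureU2.
  rewrite lebesgue_measure_set1 add0e.
  have [_ h] : measurable (\big[setU/set0]_(i < K.+1) Z i) /\
      (leb (\big[setU/set0]_(i < K.+1) Z i) <= \sum_(i < K.+1) (K.+1%:R * eps)%:E)%E.
    apply: (big_ind2 (fun (A : set R) (r : \bar R) => measurable A /\ (leb A <= r)%E)).
    - by split=> //; rewrite measure0.
    - move=> A r B t [mA lA] [mB lB]; split; first exact: measurableU.
      by apply: (@le_trans _ _ (leb A + leb B)%E); [exact: measureU2|exact: leeD].
    - by move=> i _.
  apply: le_trans h _; rewrite sumEFin lee_fin sumr_const card_ord -[leLHS]mulr_natl.
  by rewrite mulrA -expr2.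
- move=> x xI nX.
  have nY : ~ Y (exchange s x) by move=> h; apply: nX.
  have x1 : x <> 1 by move=> x1; apply: nY; left; rewrite /= x1 exchange1.
  have [//|[k xk]] := I01_cases n xI.
  have x01 := half_open_cell_lt1 xk; have /(interval_index_spec _ x01) -> := xk.
  have yk := exchange_cell s xk; set y := exchange s x in nY yk *.
  (* Outside [Y] the point [y] never lies between a cut point and the true class boundary, and for
     the latter sorting gives the comparison with the label. *)
  have cE (i : 'I_K.+1) : (cut_point p i <= y) = (i < cl k)%N.
    rewrite -hs.
    have -> : (#|[pred c | (cl c <= i)%N]| <= s k)%N = (c' i <= y).
      move: yk; rewrite half_open_cellE => /andP[y1 y2].
      rewrite /c' ler_pdivrMr // [y * _]mulrC; apply/idP/idP => h.
        by apply: le_trans y1; rewrite ler_nat.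
      by rewrite -ltnS -(ltr_nat R); exact: le_lt_trans y2.
    have nZ : ~ Z i y.
      move=> h; apply: nY; right; rewrite -(bigcup_mkord_ord Z).
      by exists i => //=; rewrite inord_val.
    apply/idP/idP => h; rewrite leNgt; apply/negP => h'; apply: nZ;
      by rewrite /Z /= in_itv /= ge_min le_max (ltW h') h ?orbT.
  apply/val_inj; rewrite /step_index /=.
  have -> : #|[pred i | cut_point p i <= y]| = cl k :> nat.
    rewrite -sum1_card (eq_bigl (fun i : 'I_K.+1 => (i < cl k)%N)); last first.
      by move=> i; rewrite inE cE.
    rewrite -(big_ord_widen K.+1 (fun=> 1%N) (ltnW (ltn_ord (cl k)))).
    by rewrite sum1_card card_ord.
  by rewrite (minn_idPr (leq_ord (cl k))) inordK.
Qed.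

End step_graphons.

Section step_graphon_distance.
Variable R : realType.

Local Notation I01 := (@unit_itv R).
Local Notation leb := (@lebesgue_measure R).
Local Notation I2 := (I01 `*` I01).
Local Notation imp := (@invertible_measure_preserving R).

(** Candidate densities are arbitrary reals from a finite list; clamping turns every candidate into
    a graphon and does not increase distances to numbers in [0, 1]. *)
Definition clamp (x : R) : R := Num.max 0 (Num.min 1 x).

Lemma clamp01 x : 0 <= clamp x <= 1.
Proof. by rewrite /clamp le_max lexx /= ge_max ler01 ge_min lexx. Qed.

Lemma clamp_near x y : 0 <= x <= 1 -> `|x - clamp y| <= `|x - y|.
Proof.
move=> /andP[x0 x1]; rewrite /clamp; have [y1|y1] := leP 1 y.
  rewrite (max_idPr ler01) distrC [leRHS]distrC !ger0_norm ?subr_ge0 ?lerB //.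
  exact: le_trans y1.
have [//|y0] := leP 0 y.
rewrite subr0 ger0_norm //; apply: le_trans (ler_norm _).
by rewrite lerBrDl gerDr ltW.
Qed.

Lemma graphon_pieces (I J : finType) (P : I -> set R) (Q : J -> set R)
    (k : I -> J -> R) (W : R * R -> R) :
  (forall i, measurable (P i)) -> (forall j, measurable (Q j)) ->
  \bigcup_i P i = I01 -> \bigcup_j Q j = I01 ->
  (forall i j, 0 <= k i j <= 1) ->
  (forall i j z, P i z.1 -> Q j z.2 -> W z = k i j) -> is_graphon W.
Proof.
move=> mP mQ UP UQ k01 Wk.
pose F (p : I * J) := P p.1 `*` Q p.2.
have mF p : measurable (F p) by exact: measurableX.
have FW p z : F p z -> W z = k p.1 p.2 by move=> [Pz Qz]; exact: Wk.
have DE : I2 = \bigcup_p F p.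
  rewrite -{1}UP -UQ; apply/seteqP; split=> [[x y]|[x y]].
    by move=> [[i _ /= Px] [j _ /= Qy]]; exists (i, j).
  by move=> [[i j] _ [/= Px Qy]]; split; [exists i|exists j].
split; first exact: (measurable_fun_pieces mF DE FW).
by move=> z; rewrite DE => -[p _ /FW ->]; exact: k01.
Qed.

Definition step_graphon K K' (q : 'I_K.+1 -> R) (p : 'I_K'.+1 -> R)
    (D : 'I_K.+1 -> 'I_K'.+1 -> R) (z : R * R) : R :=
  clamp (D (step_index q z.1) (step_index p z.2)).

Lemma step_graphon_graphon K K' (q : 'I_K.+1 -> R) (p : 'I_K'.+1 -> R) D :
  is_graphon (step_graphon q p D).
Proof.
have [mq _ uq] := step_cell_partition q; have [mp _ up] := step_cell_partition p.
apply: (graphon_pieces mq mp uq up (k := fun i j => clamp (D i j))).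
  by move=> i j; exact: clamp01.
by move=> i j z [_ /= qi] [_ /= pj]; rewrite /step_graphon qi pj.
Qed.

Lemma step_graphon_stepfunction K K' (q : 'I_K.+1 -> R) (p : 'I_K'.+1 -> R) D :
  is_stepfunction (step_graphon q p D).
Proof.
exists K.+1, K'.+1, (step_cell q), (step_cell p); split.
- exact: step_cell_partition.
- exact: step_cell_partition.
- move=> i j; exists (clamp (D i j)) => z [[_ /= qi] [_ /= pj]].
  by rewrite /step_graphon qi pj.
Qed.

Definition block_kernel n m (e : 'I_n.+1 -> 'I_m.+1 -> R) (z : R * R) : R :=
  e (interval_index n z.1) (interval_index m z.2).

Lemma block_kernel_graphon n m (e : 'I_n.+1 -> 'I_m.+1 -> R) :
  (forall i j, 0 <= e i j <= 1) -> is_graphon (block_kernel e).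
Proof.
move=> e01.
apply: (graphon_pieces (@measurable_index_cell R n) (@measurable_index_cell R m)
  (bigcup_index_cell R n) (bigcup_index_cell R m) e01).
by move=> i j z [_ /= <-] [_ /= <-].
Qed.

(** The measures of the traces of a test set on the cells, multiplied by the number of cells, are
    weights in [0, 1]. *)
Lemma cut_norm_block n m (e : 'I_n.+1 -> 'I_m.+1 -> R) (c : R) :
  (forall x y, (forall i, `|x i| <= 1) -> (forall j, `|y j| <= 1) ->
    `|\sum_i \sum_j x i * y j * e i j| <= c * (n.+1%:R * m.+1%:R)) ->
  (cut_norm (block_kernel e) <= c%:E)%E.
Proof.
move=> he; apply: cut_norm_le_cst => A B mA AI mB BI.
have Wk i j z : index_cell i z.1 -> index_cell j z.2 -> block_kernel e z = e i j.
  by move=> [_ /= <-] [_ /= <-].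
rewrite (integral_pieces (@measurable_index_cell R n) (@measurable_index_cell R m)
  (@trivIset_index_cell R n) (@trivIset_index_cell R m)
  (bigcup_index_cell R n) (bigcup_index_cell R m) Wk mA AI mB BI).
eexists; first by [].
have weight (l : nat) (E : set R) (i : 'I_l.+1) : measurable E -> E `<=` I01 ->
    `|l.+1%:R * fine (leb (E `&` index_cell i))| <= 1.
  move=> mE EI; have mEc := measurableI _ _ mE (measurable_index_cell i).
  have le : (leb (E `&` index_cell i) <= (l.+1%:R^-1)%:E)%E.
    rewrite -(leb_index_cell R i).
    by apply: le_measure; rewrite ?inE //; exact: measurable_index_cell.
  have fin : leb (E `&` index_cell i) \is a fin_num.
    by apply: leb_fin => // x [/EI].
  rewrite ger0_norm ?mulr_ge0 ?fine_ge0 // mulrC -ler_pdivlMr // mul1r.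
  by rewrite -lee_fin fineK.
have nm0 : 0 < n.+1%:R * m.+1%:R :> R by rewrite mulr_gt0.
rewrite -(ler_pM2r nm0) -[X in _ * X <= _]gtr0_norm // -normrM.
have := he _ _ (fun i => weight n A i mA AI) (fun j => weight m B j mB BI).
congr (`| _ | <= _); rewrite mulr_suml; apply: eq_bigr => i _.
by rewrite mulr_suml; apply: eq_bigr => j _; ring.
Qed.

(** The matrix bound leads from the block kernel to its average, and the L1 bound from the average
    to the rearranged step graphon; the strips come from the two exchanges. *)
Lemma block_step_distance n m K K' (e : 'I_n.+1 -> 'I_m.+1 -> R)
    (clA : 'I_n.+1 -> 'I_K.+1) (clB : 'I_m.+1 -> 'I_K'.+1)
    (q : 'I_K.+1 -> R) (p : 'I_K'.+1 -> R) D (z eps : R) :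
  (forall i j, 0 <= e i j <= 1) ->
  let avg a b := class_avg clA (fun a' => class_avg clB (e a') b) a in
  (forall x y, (forall i, `|x i| <= 1) -> (forall j, `|y j| <= 1) ->
    `|\sum_i \sum_j x i * y j * (e i j - avg i j)| <= z * (n.+1%:R * m.+1%:R)) ->
  (forall i, `|#|[pred a | clA a == i]|%:R / n.+1%:R - q i| <= eps) ->
  (forall j, `|#|[pred b | clB b == j]|%:R / m.+1%:R - p j| <= eps) ->
  (forall a b, `|avg a b - D (clA a) (clB b)| <= eps) ->
  (cut_distance (block_kernel e) (step_graphon q p D) <=
     (z + (eps + K.+1%:R ^+ 2 * eps + K'.+1%:R ^+ 2 * eps))%:E)%E.
Proof.
move=> e01 avg hcut hq hp hD.
have avg01 a b : 0 <= avg a b <= 1.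
  have avg_ge0 (B J : finType) (cl : B -> J) (x : B -> R) c :
      (forall d, 0 <= x d) -> 0 <= class_avg cl x c.
    by move=> x0; rewrite divr_ge0 ?sumr_ge0.
  rewrite avg_ge0 => [|a']; last first.
    by rewrite avg_ge0 // => b'; case/andP: (e01 a' b').
  apply: le_trans (ler_norm _) _; apply: class_avg_norm_le => a' _.
  apply: class_avg_norm_le => b' _.
  by have /andP[h0 h1] := e01 a' b'; rewrite ger0_norm.
have [f fi [X [mX lX hX]]] := exchange_step hq.
have [g gi [Y [mY lY hY]]] := exchange_step hp.
have gS := graphon_comp (step_graphon_graphon q p D) fi gi.
have gE := block_kernel_graphon e01; have gV := block_kernel_graphon avg01.
apply: le_trans (cut_distance_le _ _ fi gi) _.
rewrite (cut_norm_eq (W' := fun w => (block_kernel e w - block_kernel avg w) +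
  (block_kernel avg w - step_graphon q p D (f w.1, g w.2)))); last first.
  by move=> w _; rewrite addrA subrK.
apply: le_trans (cut_normD (graphonB_kernel gE gV) (graphonB_kernel gV gS)) _.
rewrite [leRHS]EFinD; apply: leeD.
  by apply: (@cut_norm_block _ _ (fun i j => e i j - avg i j)).
have eps0 : 0 <= eps by apply: le_trans (hq ord0).
apply: (cut_norm_le_L1 (graphonB_kernel gV gS) eps0 mX mY lX lY).
move=> w Iw; have [_ bd] := graphonB_kernel gV gS.
have [w1 w2] := Iw; rewrite !indicE.
have [Xw|Xw] := boolP (w.1 \in X).
  by apply: le_trans (bd w Iw) _; rewrite -addrA addrCA lerDl addr_ge0.
have [Yw|Yw] := boolP (w.2 \in Y).
  by apply: le_trans (bd w Iw) _; rewrite addr0 lerDr.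
rewrite !addr0 /step_graphon /= (hX _ w1) ?(hY _ w2); last 2 first.
  by move=> h; rewrite mem_set in Yw.
  by move=> h; rewrite mem_set in Xw.
by apply: le_trans (clamp_near _ (avg01 _ _)) _; exact: hD.
Qed.

End step_graphon_distance.

(** * Definable equivalence of vertices *)

Lemma ncard_sub (T : Type) (A B : set T) : finite_set B -> A `<=` B ->
  finite_set A /\ (ncard A <= ncard B)%N.
Proof.
move=> fB AB; have fA := sub_finite_set AB fB; split=> //.
have := subset_card_le AB.
by rewrite (card_le_eql (ncard_finite fA)) (card_le_eqr (ncard_finite fB)) card_le_II.
Qed.

Lemma card_eq_pred (I : finType) (P : {pred I}) : [set` P] #= `I_#|P|.
Proof.
case: (pickP P) => [x0 _|P0]; last first.
  have -> : [set` P] = set0.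
    by apply/seteqP; split=> // i; have := P0 i; rewrite /= -[P i]/(i \in P) => ->.
  by rewrite (eq_card0 P0) II0 card_eq00.
rewrite card_eq_sym; suff fb : set_bij `I_#|P| [set` P] (nth x0 (enum P)).
  exact: pcard_eq (bij_of_set_bijection fb).
split.
- by move=> i /= iP; rewrite -mem_enum mem_nth // -cardE.
- move=> i j; rewrite !inE /= cardE => iP jP /eqP.
  by rewrite nth_uniq ?enum_uniq // => /eqP.
- move=> i /= iP; exists (index i (enum P)); last by rewrite nth_index ?mem_enum.
  by rewrite /= cardE index_mem mem_enum.
Qed.

Lemma ncard_image (T : Type) (I : finType) (P : {pred I}) (h : I -> T) (A : set T) :
  {in P &, injective h} -> A = h @` [set` P] -> ncard A = #|P|.
Proof.
move=> hinj ->; apply: ncardE; apply: card_eq_trans (card_eq_pred P).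
by apply: inj_card_eq => i j; rewrite !inE; exact: hinj.
Qed.

Lemma ncard_param (T : Type) (I : finType) (B : set T) (h : I -> T) (Q : T -> Prop) :
  set_bij setT B h ->
  ncard [set x | B x /\ Q x] = #|[pred i | `[< Q (h i) >]]|.
Proof.
move=> [hB hinj hsurj]; apply: (ncard_image (h := h)).
  by move=> i j _ _; apply: hinj; rewrite inE.
apply/seteqP; split=> [x [Bx Qx]|_ [i /= Qi <-]].
  have [i _ hi] := hsurj x Bx; exists i => //; rewrite /= -topredE /= hi; exact/asboolP.
by split; [apply: hB|move: Qi; rewrite -topredE => /asboolP].
Qed.

Lemma ncard_bijT (T : Type) (I : finType) (B : set T) (h : I -> T) :
  set_bij setT B h -> ncard B = #|I|.
Proof.
move=> [hB hinj hsurj]; apply: (ncard_image (h := h) (P := I)).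
  by move=> i j _ _; apply: hinj; rewrite inE.
apply/seteqP; split=> [x Bx|_ [i _ <-]]; last by apply: hB.
by have [i _ hi] := hsurj x Bx; exists i.
Qed.

Lemma sum_asbool (R : realType) (I : finType) (Q : I -> Prop) :
  \sum_i (`[< Q i >])%:R = #|[pred i | `[< Q i >]]|%:R :> R.
Proof.
rewrite -sum1_card natr_sum [RHS]big_mkcond; apply: eq_bigr => i _ /=.
by rewrite inE; case: asbool.
Qed.

Section definable_equivalence.
Variables (L : language) (C : set (structure L)) (chi : structure L -> nat).
Variable R : realType.
Local Notation definable := (definable C).
Local Notation definable2 := (definable2 C).
Local Notation definable3 := (definable3 C).
Local Notation finitely_valued := (finitely_valued C).
Local Notation for_large := (for_large C chi).
Local Notation tame := (tame C chi R).

Lemma for_large_andr k (T P Q : predicate L k) :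
  for_large T (fun F a => P F a /\ Q F a) -> for_large T Q.
Proof. by apply: for_large_mono => F _ _ a _ []. Qed.

Lemma definable3_cat k l m (P : predicate L (k + l + m)) : definable P ->
  definable3 (fun F x y z => P F (cat_val (cat_val x y) z)).
Proof. by apply: definable_ext => F _ a; rewrite !cat_sub. Qed.

Variables (nU nV k : nat) (T : predicate L k).
Variables (U : predicate2 L nU k) (V : predicate2 L nV k) (E : predicate3 L nU nV k).
Hypotheses (asymp : asymptotic_class C chi).
Hypotheses (dT : definable T) (dU : definable2 U) (dV : definable2 V) (dE : definable3 E).

Local Notation Us F s := [set u : 'I_nU -> F | U u s].
Local Notation Vs F s := [set v : 'I_nV -> F | V v s].

Hypotheses (tU : tame T (fun F (s : 'I_k -> F) => ncard (Us F s)))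
  (tV : tame T (fun F (s : 'I_k -> F) => ncard (Vs F s))).
Hypotheses (fU : for_large T (fun F (s : 'I_k -> F) => finite_set (Us F s)))
  (fV : for_large T (fun F (s : 'I_k -> F) => finite_set (Vs F s))).

Definition edge_indicator (F : structure L) n m (u : 'I_n -> ('I_nU -> F))
    (v : 'I_m -> ('I_nV -> F)) (s : 'I_k -> F) (i : 'I_n) (j : 'I_m) : R :=
  (`[< E (u i) (v j) s >])%:R.

Definition pair_context (F : structure L) (t : 'I_(nV + nV + k) -> F) : Prop :=
  [/\ T (rsub t), V (lsub (lsub t)) (rsub t) & V (rsub (lsub t)) (rsub t)].

(** [K] is fixed before [eps]: the relation and the number of labels depend on the asymptotic values
    only, and the threshold on [chi] absorbs [eps]. Equivalence means that [r2], the asymptotic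
    proportion of vertices telling the two apart, is 0. *)
Lemma definable_equivalence : exists (eqv : predicate3 L nV nV k) (K : nat),
  definable3 eqv /\
  forall eps : R, 0 < eps -> for_large T (fun F (s : 'I_k -> F) => forall n m
    (u : 'I_n.+1 -> ('I_nU -> F)) (v : 'I_m.+1 -> ('I_nV -> F)),
    set_bij setT (Us F s) u -> set_bij setT (Vs F s) v ->
    exists cl : 'I_m.+1 -> 'I_K.+1,
      (forall b c, cl b = cl c <-> eqv F (v b) (v c) s) /\
      forall (x : 'I_n.+1 -> R) (y : 'I_m.+1 -> R),
      (forall a, `|x a| <= 1) -> (forall b, `|y b| <= 1) ->
      `|\sum_a \sum_b x a * y b *
        (edge_indicator u v s a b - class_avg cl (edge_indicator u v s a) b)| <=
      eps * (n.+1%:R * m.+1%:R)).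
Proof.
have dT2 : definable pair_context.
  apply: definable_ext (definable_and
    (definable_ren (fun i => rshift (nV + nV) i) dT) (definable_and
    (definable_ren2 (fun i => lshift k (lshift nV i)) (fun i => rshift (nV + nV) i) dV)
    (definable_ren2 (fun i => lshift k (rshift nV i)) (fun i => rshift (nV + nV) i) dV))).
  by move=> F _ t; split=> [[? [? ?]]|[? ? ?]].
pose ctx (F : structure L) (v v' : 'I_nV -> F) (s : 'I_k -> F) := cat_val (cat_val v v') s.
have ctxP F v v' s : T s -> V v s -> V v' s -> pair_context (ctx F v v' s).
  by move=> Ts Vv Vv'; split; rewrite /ctx ?lsub_cat ?rsub_cat.
have up2 (P : predicate L (nV + nV + k)) : for_large pair_context P ->
    for_large T (fun F s => forall v v', V v s -> V v' s -> P F (ctx F v v' s)).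
  by move=> [N hN]; exists N => F CF NF s Ts v v' Vv Vv'; apply: hN => //; exact: ctxP.
have down (P : predicate L k) : for_large T P ->
    for_large pair_context (fun F t => P F (rsub t)).
  by move=> [N hN]; exists N => F CF NF t [Tt _ _]; exact: hN.
have tU2 : tame pair_context (fun F t => ncard (Us F (rsub t))).
  by apply: (tame_ren dT2 _ tU) => F _ t [].
have tV2 : tame pair_context (fun F t => ncard (Vs F (rsub t))).
  by apply: (tame_ren dT2 _ tV) => F _ t [].
(* Common neighbours: their number relative to the size of [U] is the codegree. *)
pose X1 (F : structure L) (x : 'I_nU -> F) (t : 'I_(nV + nV + k) -> F) :=
  U x (rsub t) /\ (E x (lsub (lsub t)) (rsub t) /\ E x (rsub (lsub t)) (rsub t)).
have dX1 : definable2 X1.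
  apply: definable_and.
    exact: (definable_ren2 (fun i => lshift _ i)
      (fun i => rshift nU (rshift (nV + nV) i)) dU).
  apply: definable_and.
    exact: (definable_ren3 (fun i => lshift _ i)
      (fun i => rshift nU (lshift k (lshift nV i)))
      (fun i => rshift nU (rshift (nV + nV) i)) dE).
  exact: (definable_ren3 (fun i => lshift _ i)
    (fun i => rshift nU (lshift k (rshift nV i)))
    (fun i => rshift nU (rshift (nV + nV) i)) dE).
have b1 : for_large pair_context (fun F t => finite_set [set x | X1 F x t] /\
    (ncard [set x | X1 F x t] <= ncard (Us F (rsub t)))%N).
  apply: for_large_mono (down _ fU) => F _ _ t _ fUt.
  by apply: ncard_sub fUt _ => x [].
have t1 := tame_family asymp dT2 dX1 tU2 b1.
have [r1 fr1 hr1] := tame_ratio t1 tU2 (for_large_andr b1).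
have [[s1 hs1] lev1] := fr1.
pose val (F : structure L) (v v' : 'I_nV -> F) (s : 'I_k -> F) := r1 F (ctx F v v' s).
(* The vertices [w] that tell the two given vertices apart. Equality of asymptotic codegrees is a
   finite disjunction over [s1], as each value has a definable level set. *)
pose X2 (F : structure L) (w : 'I_nV -> F) (t : 'I_(nV + nV + k) -> F) := V w (rsub t) /\
  ~ exists2 c, c \in s1 &
    (pair_context (ctx F (lsub (lsub t)) w (rsub t)) /\
       val F (lsub (lsub t)) w (rsub t) = c) /\
    (pair_context (ctx F (rsub (lsub t)) w (rsub t)) /\
       val F (rsub (lsub t)) w (rsub t) = c).
have dX2 : definable2 X2.
  apply: definable_and.
    exact: (definable_ren2 (fun i => lshift _ i)
      (fun i => rshift nV (rshift (nV + nV) i)) dV).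
  apply: definable_not.
  apply: (@definable_exists_in _ _ _ _ s1 (fun c F a =>
    (pair_context (ctx F (lsub (lsub (rsub a))) (lsub a) (rsub (rsub a))) /\
       val F (lsub (lsub (rsub a))) (lsub a) (rsub (rsub a)) = c) /\
    (pair_context (ctx F (rsub (lsub (rsub a))) (lsub a) (rsub (rsub a))) /\
       val F (rsub (lsub (rsub a))) (lsub a) (rsub (rsub a)) = c))) => c.
  apply: definable_and.
    exact: (definable_ren3 (fun i => rshift nV (lshift k (lshift nV i)))
      (fun i => lshift _ i) (fun i => rshift nV (rshift (nV + nV) i))
      (definable3_cat (lev1 c))).
  exact: (definable_ren3 (fun i => rshift nV (lshift k (rshift nV i)))
    (fun i => lshift _ i) (fun i => rshift nV (rshift (nV + nV) i))
    (definable3_cat (lev1 c))).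
have b2 : for_large pair_context (fun F t => finite_set [set x | X2 F x t] /\
    (ncard [set x | X2 F x t] <= ncard (Vs F (rsub t)))%N).
  apply: for_large_mono (down _ fV) => F _ _ t _ fVt.
  by apply: ncard_sub fVt _ => x [].
have t2 := tame_family asymp dT2 dX2 tV2 b2.
have [r2 fr2 hr2] := tame_ratio t2 tV2 (for_large_andr b2).
have [[s2 hs2] lev2] := fr2.
have [g g0 hg] := seq_gap s1.
(* 0 joins the list so that nonzero values of [r2] are at least [dl] away from it. *)
have [dl dl0 hdl] := seq_gap (0 :: s2).
(* Makes [4 / kk] at most half of the budget [g ^ 2 * (dl / 2)] for the labels; the other half is
   left for [16 * ee ^ 2]. *)
pose kk := (Num.truncn (16 / (g ^+ 2 * dl))).+1.
pose K := ((size s1).+1 ^ (kk ^ 2)).-1.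
exists (fun F v v' s => pair_context (ctx F v v' s) /\ r2 F (ctx F v v' s) = 0), K.
split; first exact: (definable3_cat (lev2 0)).
move=> eps eps0.
have gdl0 : 0 < g ^+ 2 * dl by rewrite mulr_gt0 ?exprn_gt0.
(* The first two bounds respect the gaps, the next two the sampling budget, and the last gives
   [12 * ee <= eps ^ 2] for the cut estimate. *)
pose ee := Num.min (Num.min (dl / 4) (g / 4))
  (Num.min (Num.min 1 (g ^+ 2 * dl / 64)) (eps ^+ 2 / 12)).
have ee0 : 0 < ee by rewrite !lt_min ltr01 !divr_gt0 ?exprn_gt0.
have ee1 : ee <= dl / 4 by rewrite /ee !ge_min lexx.
have ee2 : ee <= g / 4 by rewrite /ee !ge_min lexx orbT.
have ee3 : ee <= 1 by rewrite /ee !ge_min lexx !orbT.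
have ee4 : ee <= g ^+ 2 * dl / 64 by rewrite /ee !ge_min lexx !orbT.
have ee5 : ee <= eps ^+ 2 / 12 by rewrite /ee !ge_min lexx !orbT.
apply: for_large_mono (for_large_and (up2 _ (hr1 ee ee0)) (up2 _ (hr2 ee ee0))).
move=> F CF chi0 s Ts [near1 near2] n m u v ub vb.
set f := edge_indicator u v s.
have Vv b : V (v b) s by have [h _ _] := vb; exact: h.
have Uu a : U (u a) s by have [h _ _] := ub; exact: h.
have cU : ncard (Us F s) = n.+1 by rewrite (ncard_bijT ub) card_ord.
have cV : ncard (Vs F s) = m.+1 by rewrite (ncard_bijT vb) card_ord.
pose vl b c := val F (v b) (v c) s.
pose qq b c := r2 F (ctx F (v b) (v c) s).
have vls b c : vl b c \in s1 by apply: hs1 => //; exact: ctxP.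
have f01 a b : 0 <= f a b <= 1.
  by rewrite /f /edge_indicator; case: asbool; rewrite ?ler01 ?lexx.
have near_val b c : `|codegree f b c - vl b c| <= ee.
  have := near1 (v b) (v c) (Vv b) (Vv c).
  rewrite /ctx !rsub_cat cU => /(_ isT).
  suff -> : (ncard [set x | X1 F x (cat_val (cat_val (v b) (v c)) s)])%:R =
      \sum_a f a b * f a c :> R by rewrite /codegree card_ord.
  rewrite /X1 !(rsub_cat, lsub_cat).
  rewrite (ncard_param (fun x => E x (v b) s /\ E x (v c) s) ub) -sum_asbool.
  apply: eq_bigr => a _; rewrite /f /edge_indicator -natrM mulnb.
  by congr (nat_of_bool _)%:R; apply/idP/andP => [/asboolP[? ?]|[/asboolP ? /asboolP ?]];
    [split|]; apply/asboolP.
have near_q b c : `|(hamming vl b c)%:R / #|'I_m.+1|%:R - qq b c| <= ee.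
  have := near2 (v b) (v c) (Vv b) (Vv c).
  rewrite {1 2 3}/ctx !rsub_cat cV => /(_ isT).
  suff -> : ncard [set w | X2 F w (cat_val (cat_val (v b) (v c)) s)] = hamming vl b c.
    by rewrite card_ord.
  rewrite /X2 !(rsub_cat, lsub_cat) (ncard_param _ vb); apply: eq_card => w.
  rewrite !inE; apply/asboolP/idP => [nex|/eqP ne [r _ [[_ e1] [_ e2]]]].
    apply/eqP => e; apply: nex; exists (vl b w); first exact: vls.
    by split; split; rewrite ?e //; exact: ctxP.
  by apply: ne; rewrite /vl e1 e2.
have qgap b c : qq b c != 0 -> dl <= `|qq b c|.
  move=> q0; rewrite -[qq b c]subr0; apply: hdl; rewrite ?inE ?eqxx ?q0 //.
  by rewrite (hs2 F CF _ (ctxP _ _ _ _ Ts (Vv b) (Vv c))) orbT.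
have dlk : 4 * (4 * ee ^+ 2 + kk%:R^-1) <= g ^+ 2 * (dl / 2).
  have h1 : ee ^+ 2 <= ee by rewrite expr2 ler_piMr // ltW.
  have kk0 : 0 < kk%:R :> R by rewrite ltr0n.
  have h2 : kk%:R^-1 <= g ^+ 2 * dl / 16.
    rewrite -[leRHS]invrK lef_pV2 ?posrE ?invr_gt0 ?divr_gt0 //.
    by rewrite invf_div ltW // truncnS_gt.
  by have := ee4; lra.
have A0 : (0 < #|'I_n.+1|)%N by rewrite card_ord.
have B0 : (0 < #|'I_m.+1|)%N by rewrite card_ord.
have e4dl : 4 * ee <= dl by have := ee1; lra.
have e4g : 4 * ee <= g by have := ee2; lra.
have [cl hcl] := hamming_class_labels A0 B0 f01 vls hg qgap near_val near_q g0
  (ltn0Sn _) e4dl dl0 e4g dlk.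
have KE : ((size s1).+1 ^ (kk ^ 2) = K.+1)%N by rewrite /K prednK // expn_gt0.
pose cl' b : 'I_K.+1 := cast_ord KE (cl b).
have hcl' b c : cl' b = cl' c <-> qq b c = 0.
  by rewrite -(hcl b c); split=> [/cast_ord_inj|e]; rewrite // /cl' e.
exists cl'; split=> [b c|x y x1 y1].
  by rewrite hcl'; split=> [|[]//]; split=> //; exact: ctxP.
have := hamming_class_cut A0 B0 f01 near_val near_q hcl' x1 y1.
rewrite !card_ord => h; rewrite -(ler_pXn2r (n := 2)) ?nnegrE ?mulr_ge0 ?(ltW eps0) //.
rewrite real_normK ?num_real // exprMn; apply: le_trans h _.
by rewrite ler_wpM2r ?exprn_ge0 ?mulr_ge0 //; have := ee5; lra.
Qed.

End definable_equivalence.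

Lemma finite_param (T : Type) (A : set T) : finite_set A ->
  exists u : 'I_(ncard A) -> T, set_bij setT A u.
Proof.
move=> fA; have := ncard_finite fA; rewrite card_eq_sym => /card_bijP[f fb].
have [finj fsurj] : injective f /\ forall y, exists x, f x = y.
  have [g gf fg] := fb; split; first exact: can_inj gf.
  by move=> y; exists (g y); rewrite fg.
pose u (i : 'I_(ncard A)) : T := set_val (f (SigSub (mem_set (ltn_ord i : `I_(ncard A) i)))).
exists u; split.
- by move=> i _; exact: set_valP.
- by move=> i j _ _ /val_inj /finj /(congr1 val) /= /val_inj.
- move=> x Ax; have [[i iA] fi] := fsurj (SigSub (mem_set Ax)).
  have il : (i < ncard A)%N by have := iA; rewrite inE.
  exists (Ordinal il) => //; rewrite /u.
  rewrite (_ : SigSub _ = SigSub iA) ?fi //.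
  by apply: val_inj.
Qed.

Lemma ncard_cat (L : language) (F : structure L) k l (A : set ('I_k -> F))
    (B : set ('I_l -> F)) : finite_set A -> finite_set B ->
  finite_set [set c | A (lsub c) /\ B (rsub c)] /\
  ncard [set c | A (lsub c) /\ B (rsub c)] = (ncard A * ncard B)%N.
Proof.
move=> /finite_param[u ub] /finite_param[v vb].
set X := [set c | _].
pose h (p : 'I_(ncard A) * 'I_(ncard B)) := cat_val (u p.1) (v p.2).
have [uA uinj usurj] := ub; have [vB vinj vsurj] := vb.
have hb : set_bij setT X h.
  split.
  - by move=> p _; rewrite /X /h /= lsub_cat rsub_cat; split; [exact: uA|exact: vB].
  - move=> [i j] [i' j'] _ _ e.
    have /= ei := congr1 (@lsub _ _ _) e; have /= ej := congr1 (@rsub _ _ _) e.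
    rewrite /h !lsub_cat /= in ei; rewrite /h !rsub_cat /= in ej.
    by congr (_, _); [apply: uinj|apply: vinj]; rewrite ?inE.
  - move=> c [/usurj[i _ ui] /vsurj[j _ vj]]; exists (i, j) => //.
    by rewrite /h /= ui vj cat_sub.
split; last by rewrite (ncard_bijT hb) card_prod !card_ord.
have -> : X = h @` setT.
  apply/seteqP; split=> [x Xx|_ [p _ <-]]; last by have [hX _ _] := hb; exact: hX.
  by have [_ _ hs] := hb; have [p _ hp] := hs x Xx; exists p.
by apply: finite_image; exact: finite_finset.
Qed.

(** * Asymptotic class sizes and densities between classes *)

Section class_sizes.
Variables (L : language) (C : set (structure L)) (chi : structure L -> nat).
Variable R : realType.
Local Notation for_large := (for_large C chi).
Local Notation tame := (tame C chi R).
Variables (nV k : nat) (T : predicate L k) (V : predicate2 L nV k).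
Variable eqv : predicate3 L nV nV k.
Hypotheses (asymp : asymptotic_class C chi) (dT : definable C T).
Hypotheses (dV : definable2 C V) (deqv : definable3 C eqv).
Hypotheses
  (tV : tame T (fun F (s : 'I_k -> F) => ncard [set v : 'I_nV -> F | V v s]))
  (fV : for_large T (fun F (s : 'I_k -> F) => finite_set [set v : 'I_nV -> F | V v s])).

Definition vertex_context (F : structure L) (t : 'I_(nV + k) -> F) : Prop :=
  T (rsub t) /\ V (lsub t) (rsub t).

Definition vertex_class (F : structure L) (w : 'I_nV -> F) (t : 'I_(nV + k) -> F) : Prop :=
  V w (rsub t) /\ eqv (lsub t) w (rsub t).

Lemma definable_vertex_context : definable C vertex_context.
Proof.
apply: definable_and; first exact: (definable_ren (fun i => rshift nV i) dT).
exact: (definable_ren2 (fun i => lshift k i) (fun i => rshift nV i) dV).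
Qed.

(** The class size is taken as a function of a vertex, not of a label: labels vary freely with the
    structure, whereas the class of a vertex is definable from it. *)
Lemma vertex_class_asymptotics :
  [/\ tame vertex_context (fun F t => ncard [set w | @vertex_class F w t]),
      for_large vertex_context (fun F t => finite_set [set w | @vertex_class F w t])
    & exists2 r : valuation L (nV + k) R, finitely_valued C vertex_context r &
      forall eps : R, 0 < eps -> for_large vertex_context (fun F t =>
        (0 < ncard [set v : 'I_nV -> F | V v (rsub t)])%N ->
        `|(ncard [set w | @vertex_class F w t])%:R /
          (ncard [set v : 'I_nV -> F | V v (rsub t)])%:R - r F t| <= eps)].
Proof.
have dC := definable_vertex_context.
have dX : definable2 C vertex_class.
  apply: definable_and.
    exact: (definable_ren2 (fun i => lshift _ i) (fun i => rshift nV (rshift nV i)) dV).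
  exact: (definable_ren3 (fun i => rshift nV (lshift k i)) (fun i => lshift _ i)
    (fun i => rshift nV (rshift nV i)) deqv).
have tV' : tame vertex_context
    (fun F t => ncard [set v : 'I_nV -> F | V v (rsub t)]).
  by apply: (tame_ren dC _ tV) => F _ t [].
have b : for_large vertex_context (fun F t =>
    finite_set [set w | @vertex_class F w t] /\
    (ncard [set w | @vertex_class F w t] <=
     ncard [set v : 'I_nV -> F | V v (rsub t)])%N).
  have [N hN] := fV; exists N => F CF NF t [Tt _].
  by apply: ncard_sub (hN F CF NF _ Tt) _ => w [].
have tX := tame_family asymp dC dX tV' b.
split=> //; last exact: (tame_ratio tX tV' (for_large_andr b)).
by apply: for_large_mono b => F _ _ t _ [].
Qed.

End class_sizes.

Section regular_limits.
Variables (L : language) (C : set (structure L)) (chi : structure L -> nat).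
Variable R : realType.
Local Notation for_large := (for_large C chi).
Local Notation tame := (tame C chi R).
Variables (nU nV k : nat) (T : predicate L k).
Variables (U : predicate2 L nU k) (V : predicate2 L nV k) (E : predicate3 L nU nV k).
Hypotheses (asymp : asymptotic_class C chi).
Hypotheses (dT : definable C T) (dU : definable2 C U) (dV : definable2 C V).
Hypothesis dE : definable3 C E.
Local Notation Us F s := [set u : 'I_nU -> F | U u s].
Local Notation Vs F s := [set v : 'I_nV -> F | V v s].
Hypotheses (tU : tame T (fun F (s : 'I_k -> F) => ncard (Us F s)))
  (tV : tame T (fun F (s : 'I_k -> F) => ncard (Vs F s))).
Hypotheses (fU : for_large T (fun F (s : 'I_k -> F) => finite_set (Us F s)))
  (fV : for_large T (fun F (s : 'I_k -> F) => finite_set (Vs F s))).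
Variables (eqU : predicate3 L nU nU k) (eqV : predicate3 L nV nV k).
Hypotheses (deqU : definable3 C eqU) (deqV : definable3 C eqV).

Definition edge_context (F : structure L) (t : 'I_(nU + nV + k) -> F) : Prop :=
  [/\ T (rsub t), U (lsub (lsub t)) (rsub t) & V (rsub (lsub t)) (rsub t)].

Definition class_edge (F : structure L) (c : 'I_(nU + nV) -> F)
    (t : 'I_(nU + nV + k) -> F) : Prop :=
  ((U (lsub c) (rsub t) /\ eqU (lsub (lsub t)) (lsub c) (rsub t)) /\
   (V (rsub c) (rsub t) /\ eqV (rsub (lsub t)) (rsub c) (rsub t))) /\
  E (lsub c) (rsub c) (rsub t).

Local Notation class_U := (@vertex_class L nU k U eqU).
Local Notation class_V := (@vertex_class L nV k V eqV).

(** The edges between two classes are bounded by the product of the class sizes. This product is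
    tame, hence so is the number of edges, and the ratio has finitely many asymptotic values. *)
Lemma class_density_asymptotics :
  exists2 r : valuation L (nU + nV + k) R, finitely_valued C edge_context r &
    forall eps : R, 0 < eps -> for_large edge_context (fun F t =>
      let cU := [set w | class_U w (cat_val (lsub (lsub t)) (rsub t))] in
      let cV := [set w | class_V w (cat_val (rsub (lsub t)) (rsub t))] in
      (0 < ncard cU * ncard cV)%N ->
      `|(ncard [set c | @class_edge F c t])%:R / (ncard cU * ncard cV)%:R - r F t| <= eps).
Proof.
have dC : definable C edge_context.
  apply: definable_ext (definable_and
    (definable_ren (fun i => rshift (nU + nV) i) dT) (definable_and
    (definable_ren2 (fun i => lshift k (lshift nV i)) (fun i => rshift (nU + nV) i) dU)
    (definable_ren2 (fun i => lshift k (rshift nU i)) (fun i => rshift (nU + nV) i) dV))).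
  by move=> F _ t; split=> [[? [? ?]]|[? ? ?]].
have dX : definable2 C class_edge.
  apply: definable_and; first apply: definable_and; first apply: definable_and.
  - exact: (definable_ren2 (fun i => lshift _ (lshift nV i))
      (fun i => rshift (nU + nV) (rshift (nU + nV) i)) dU).
  - exact: (definable_ren3 (fun i => rshift (nU + nV) (lshift k (lshift nV i)))
      (fun i => lshift _ (lshift nV i))
      (fun i => rshift (nU + nV) (rshift (nU + nV) i)) deqU).
  - apply: definable_and.
      exact: (definable_ren2 (fun i => lshift _ (rshift nU i))
        (fun i => rshift (nU + nV) (rshift (nU + nV) i)) dV).
    exact: (definable_ren3 (fun i => rshift (nU + nV) (lshift k (rshift nU i)))
      (fun i => lshift _ (rshift nU i))
      (fun i => rshift (nU + nV) (rshift (nU + nV) i)) deqV).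
  - exact: (definable_ren3 (fun i => lshift _ (lshift nV i))
      (fun i => lshift _ (rshift nU i))
      (fun i => rshift (nU + nV) (rshift (nU + nV) i)) dE).
have [tcU fcU _] := vertex_class_asymptotics asymp dT dU deqU tU fU.
have [tcV fcV _] := vertex_class_asymptotics asymp dT dV deqV tV fV.
(* Coordinates of [(u, s)] and, below, [(v, s)] inside [(u, v, s)], used to pull class sizes back to
   pairs of vertices. *)
pose pU : 'I_(nU + k) -> 'I_(nU + nV + k) :=
  copair (fun i => lshift k (lshift nV i)) (fun i => rshift (nU + nV) i).
pose pV : 'I_(nV + k) -> 'I_(nU + nV + k) :=
  copair (fun i => lshift k (rshift nU i)) (fun i => rshift (nU + nV) i).
have pUE (F : structure L) (t : 'I_(nU + nV + k) -> F) :
    (fun i => t (pU i)) = cat_val (lsub (lsub t)) (rsub t).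
  rewrite -[LHS]cat_sub; congr cat_val; apply/funext => i.
    by rewrite {1}/lsub /pU copair_lshift.
  by rewrite {1}/rsub /pU copair_rshift.
have pVE (F : structure L) (t : 'I_(nU + nV + k) -> F) :
    (fun i => t (pV i)) = cat_val (rsub (lsub t)) (rsub t).
  rewrite -[LHS]cat_sub; congr cat_val; apply/funext => i.
    by rewrite {1}/lsub /pV copair_lshift.
  by rewrite {1}/rsub /pV copair_rshift.
have cU (F : structure L) (t : _ -> F) : C F -> edge_context t ->
    vertex_context T U (fun i => t (pU i)).
  by move=> _ [? ? ?]; rewrite pUE; split; rewrite ?lsub_cat rsub_cat.
have cV (F : structure L) (t : _ -> F) : C F -> edge_context t ->
    vertex_context T V (fun i => t (pV i)).
  by move=> _ [? ? ?]; rewrite pVE; split; rewrite ?lsub_cat rsub_cat.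
have tame_y := tame_mul (tame_ren dC (fun F CF t => @cU F t CF) tcU)
  (tame_ren dC (fun F CF t => @cV F t CF) tcV).
have b : for_large edge_context (fun F t => finite_set [set c | @class_edge F c t] /\
    (ncard [set c | @class_edge F c t] <=
     ncard [set w | class_U w (fun i => t (pU i))] *
     ncard [set w | class_V w (fun i => t (pV i))])%N).
  have [N hN] := fcU; have [M hM] := fcV; exists (maxn N M) => F CF.
  rewrite gtn_max => /andP[NF MF] t ct.
  have [fc <-] := ncard_cat (hN F CF NF _ (cU F t CF ct)) (hM F CF MF _ (cV F t CF ct)).
  apply: ncard_sub fc _ => c [[[? ?] [? ?]] _].
  by rewrite /= /vertex_class pUE pVE !lsub_cat !rsub_cat.
have tX := tame_family asymp dC dX tame_y b.
have [r fr hr] := tame_ratio tX tame_y (for_large_andr b).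
exists r => // eps eps0; apply: for_large_mono (hr eps eps0) => F _ _ t _.
by rewrite pUE pVE.
Qed.

End regular_limits.

(** The code [size s] of an element missing from [s] decodes to 0, the value given to labels that do
    not occur. *)
Lemma nth_index_default (R : realType) (s : seq R) (x : R) :
  x \in 0 :: s -> nth 0 s (index x s) = x.
Proof.
have [xs _|xs] := boolP (x \in s); first exact: nth_index.
rewrite inE (negbTE xs) orbF => /eqP x0; rewrite x0 in xs *.
by rewrite memNindex // nth_default.
Qed.

(** * The finite list of candidate step functions *)

Section regular_limits.
Variables (L : language) (C : set (structure L)) (chi : structure L -> nat).
Variable R : realType.
Local Notation for_large := (for_large C chi).
Local Notation tame := (tame C chi R).
Variables (nU nV k : nat) (T : predicate L k).
Variables (U : predicate2 L nU k) (V : predicate2 L nV k) (E : predicate3 L nU nV k).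
Hypotheses (asymp : asymptotic_class C chi).
Hypotheses (dT : definable C T) (dU : definable2 C U) (dV : definable2 C V).
Hypothesis dE : definable3 C E.
Local Notation Us F s := [set u : 'I_nU -> F | U u s].
Local Notation Vs F s := [set v : 'I_nV -> F | V v s].
Hypotheses (tU : tame T (fun F (s : 'I_k -> F) => ncard (Us F s)))
  (tV : tame T (fun F (s : 'I_k -> F) => ncard (Vs F s))).
Hypotheses (fU : for_large T (fun F (s : 'I_k -> F) => finite_set (Us F s)))
  (fV : for_large T (fun F (s : 'I_k -> F) => finite_set (Vs F s))).

Lemma label_ratio (I : finType) K (cl : I -> 'I_K.+1) (n : nat) (r : I -> R) (eps : R) :
  0 <= eps ->
  (forall a, `|(class_size cl a)%:R / n.+1%:R - r a| <= eps) ->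
  forall i, `|#|[pred a | cl a == i]|%:R / n.+1%:R -
    (if [pick a | cl a == i] is Some a then r a else 0)| <= eps.
Proof.
move=> eps0 hr i; case: pickP => [a /eqP <-|P0]; first exact: hr.
by rewrite (eq_card0 P0) mul0r subr0 normr0.
Qed.

(** The candidates are all step functions with step lengths and densities taken from the finite
    value lists, fixed before [eps] and the structure. *)
Lemma regular_limits : exists Tc : set (R * R -> R),
  [/\ finite_set Tc, forall W, Tc W -> is_graphon W /\ is_stepfunction W &
    forall eps : R, 0 < eps -> for_large T (fun F (s : 'I_k -> F) => forall n m
      (u : 'I_n.+1 -> ('I_nU -> F)) (v : 'I_m.+1 -> ('I_nV -> F)),
      set_bij setT (Us F s) u -> set_bij setT (Vs F s) v ->
      exists2 W, Tc W &
        (cut_distance (block_kernel (edge_indicator R E u v s)) W <= eps%:E)%E)].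
Proof.
(* The transposed edge relation, so that the equivalence on [U] results from exchanging the two
   sides. *)
pose Et (F : structure L) (v : 'I_nV -> F) (u : 'I_nU -> F) (s : 'I_k -> F) := E u v s.
have dEt : definable3 C Et.
  exact: (definable_ren3 (fun i => lshift k (rshift nV i))
    (fun i => lshift k (lshift nU i)) (fun i => rshift (nV + nU) i) dE).
have [eqV [KV [deqV cutV]]] := definable_equivalence asymp dT dU dV dE tU tV fU fV.
have [eqU [KU [deqU cutU]]] := definable_equivalence asymp dT dV dU dEt tV tU fV fU.
have [_ _ [rU fvU hrU]] := vertex_class_asymptotics asymp dT dU deqU tU fU.
have [_ _ [rV fvV hrV]] := vertex_class_asymptotics asymp dT dV deqV tV fV.
have [rE fvE hrE] := class_density_asymptotics asymp dT dU dV dE tU tV fU fV deqU deqV.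
have [[sU hsU] _] := fvU; have [[sV hsV] _] := fvV; have [[sE hsE] _] := fvE.
pose dec (s : seq R) (i : 'I_(size s).+1) : R := nth 0 s i.
pose enc (s : seq R) (x : R) : 'I_(size s).+1 := inord (index x s).
have encK s x : x \in 0 :: s -> dec s (enc s x) = x.
  by move=> xs; rewrite /dec /enc inordK ?ltnS ?index_size // nth_index_default.
pose data := ({ffun 'I_KU.+1 -> 'I_(size sU).+1} * {ffun 'I_KV.+1 -> 'I_(size sV).+1} *
  {ffun 'I_KU.+1 * 'I_KV.+1 -> 'I_(size sE).+1})%type.
pose cand (d : data) : R * R -> R := step_graphon (fun i => dec _ (d.1.1 i))
  (fun j => dec _ (d.1.2 j)) (fun i j => dec _ (d.2 (i, j))).
exists (range cand); split.
- by apply: finite_image; exact: finite_finset.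
- move=> _ [d _ <-]; split; first exact: step_graphon_graphon.
  exact: step_graphon_stepfunction.
move=> eps eps0.
(* The factor of the size and density error in the distance bound. That error is allotted [eps / 2],
   and the two cut estimates [eps / 4] each. *)
pose M : R := 1 + KU.+1%:R ^+ 2 + KV.+1%:R ^+ 2.
have M0 : 0 < M by rewrite /M !addr_gt0 ?exprn_gt0.
pose ee := eps / 2 / M.
have ee0 : 0 < ee by rewrite !divr_gt0.
have ez0 : 0 < eps / 4 by rewrite divr_gt0.
have upU (P : predicate L (nU + k)) : for_large (vertex_context T U) P ->
    for_large T (fun F s => forall u, U u s -> P F (cat_val u s)).
  move=> [N hN]; exists N => F CF NF s Ts u Uu; apply: hN => //.
  by split; rewrite !(lsub_cat, rsub_cat).
have upV (P : predicate L (nV + k)) : for_large (vertex_context T V) P ->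
    for_large T (fun F s => forall v, V v s -> P F (cat_val v s)).
  move=> [N hN]; exists N => F CF NF s Ts u Uu; apply: hN => //.
  by split; rewrite !(lsub_cat, rsub_cat).
have upE (P : predicate L (nU + nV + k)) : for_large (edge_context T U V) P ->
    for_large T (fun F s => forall u v, U u s -> V v s -> P F (cat_val (cat_val u v) s)).
  move=> [N hN]; exists N => F CF NF s Ts u v Uu Vv; apply: hN => //.
  by split; rewrite !(lsub_cat, rsub_cat).
apply: for_large_mono (for_large_and (for_large_and (cutV _ ez0) (cutU _ ez0))
  (for_large_and (upU _ (hrU ee ee0)) (for_large_and (upV _ (hrV ee ee0))
    (upE _ (hrE ee ee0))))).
move=> F CF _ s Ts [[hV hU] [nearU [nearV nearE]]] n m u v ub vb.
have [clB [clBP cutB]] := hV n m u v ub vb.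
have [clA [clAP cutA]] := hU m n v u vb ub.
have Uu a : U (u a) s by have [h _ _] := ub; exact: h.
have Vv b : V (v b) s by have [h _ _] := vb; exact: h.
have cU : ncard (Us F s) = n.+1 by rewrite (ncard_bijT ub) card_ord.
have cV : ncard (Vs F s) = m.+1 by rewrite (ncard_bijT vb) card_ord.
set e := edge_indicator R E u v s.
have csU a : ncard [set w | vertex_class U eqU w (cat_val (u a) s)] = class_size clA a.
  rewrite /vertex_class lsub_cat rsub_cat (ncard_param _ ub); apply: eq_card => a'.
  by rewrite !inE; apply/asboolP/eqP => [/clAP|e']; [|apply/clAP].
have csV b : ncard [set w | vertex_class V eqV w (cat_val (v b) s)] = class_size clB b.
  rewrite /vertex_class lsub_cat rsub_cat (ncard_param _ vb); apply: eq_card => b'.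
  by rewrite !inE; apply/asboolP/eqP => [/clBP|e']; [|apply/clBP].
have csE a b : (ncard [set c | class_edge U V E eqU eqV c (cat_val (cat_val (u a) (v b)) s)])%:R =
    \sum_(a' | clA a' == clA a) \sum_(b' | clB b' == clB b) e a' b' :> R.
  rewrite pair_big /= (ncard_image (I := ('I_n.+1 * 'I_m.+1)%type) (h := fun p => cat_val (u p.1) (v p.2))
    (P := [pred p | [&& clA p.1 == clA a, clB p.2 == clB b & `[< E (u p.1) (v p.2) s >]]])).
  - rewrite -sum1_card natr_sum big_mkcond [RHS]big_mkcond; apply: eq_bigr => -[a' b'] _ /=.
    rewrite !inE /e /edge_indicator /=.
    by case: (clA a' == _); case: (clB b' == _); case: asbool.
  - move=> [i j] [i' j'] _ _ eq; have [_ uinj _] := ub; have [_ vinj _] := vb.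
    have /= := congr1 (@lsub _ _ _) eq; have /= := congr1 (@rsub _ _ _) eq.
    rewrite !lsub_cat !rsub_cat => ej ei.
    by congr (_, _); [apply: uinj|apply: vinj]; rewrite ?inE.
  - apply/seteqP; split=> [c|_ [[i j] /= + <-]].
      rewrite /class_edge /= !(lsub_cat, rsub_cat) => -[[[Uc eU] [Vc eV]] Ec].
      have [_ _ /(_ _ Uc)[i _ ui]] := ub; have [_ _ /(_ _ Vc)[j _ vj]] := vb.
      exists (i, j); last by rewrite /= ui vj cat_sub.
      rewrite /= inE /= ui vj; apply/and3P; split; last exact/asboolP.
        by apply/eqP/esym/clAP; rewrite ui.
      by apply/eqP/esym/clBP; rewrite vj.
    rewrite inE /= => /and3P[/eqP ei /eqP ej /asboolP Eij].
    rewrite /class_edge /= !(lsub_cat, rsub_cat); split=> //; split; split=> //.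
      exact/clAP.
    exact/clBP.
(* The asymptotic values at all vertices of a class approximate the same ratio, so one picked vertex
   per label is enough; labels without vertices get 0. *)
pose q i : R := if [pick a | clA a == i] is Some a then rU F (cat_val (u a) s) else 0.
pose p j : R := if [pick b | clB b == j] is Some b then rV F (cat_val (v b) s) else 0.
pose D i j : R := if [pick a | clA a == i] is Some a then
  if [pick b | clB b == j] is Some b then rE F (cat_val (cat_val (u a) (v b)) s) else 0
  else 0.
have ctxU a : vertex_context T U (cat_val (u a) s) by split; rewrite !(lsub_cat, rsub_cat).
have ctxV b : vertex_context T V (cat_val (v b) s) by split; rewrite !(lsub_cat, rsub_cat).
have ctxE a b : edge_context T U V (cat_val (cat_val (u a) (v b)) s).
  by split; rewrite !(lsub_cat, rsub_cat).
have qK i : dec sU (enc sU (q i)) = q i.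
  apply: encK; rewrite /q; case: pickP => [a _|_]; last by rewrite mem_head.
  by rewrite inE hsU ?orbT.
have pK j : dec sV (enc sV (p j)) = p j.
  apply: encK; rewrite /p; case: pickP => [b _|_]; last by rewrite mem_head.
  by rewrite inE hsV ?orbT.
have DK i j : dec sE (enc sE (D i j)) = D i j.
  apply: encK; rewrite /D; case: pickP => [a _|_]; last by rewrite mem_head.
  by case: pickP => [b _|_]; rewrite ?mem_head // inE hsE ?orbT.
pose d : data := ([ffun i => enc sU (q i)], [ffun j => enc sV (p j)],
  [ffun ij => enc sE (D ij.1 ij.2)]).
have candE : cand d = step_graphon q p D.
  have e1 : (fun i => dec sU (d.1.1 i)) = q.
    by apply/funext => i; rewrite ffunE qK.
  have e2 : (fun j => dec sV (d.1.2 j)) = p.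
    by apply/funext => j; rewrite ffunE pK.
  have e3 : (fun i j => dec sE (d.2 (i, j))) = D.
    by apply/funext => i; apply/funext => j; rewrite ffunE DK.
  by rewrite /cand e1 e2 e3.
exists (cand d); first by exists d.
rewrite candE.
have bound : 2 * (eps / 4) + (ee + KU.+1%:R ^+ 2 * ee + KV.+1%:R ^+ 2 * ee) <= eps.
  have -> : ee + KU.+1%:R ^+ 2 * ee + KV.+1%:R ^+ 2 * ee = M * ee by rewrite /M; ring.
  by rewrite /ee [M * _]mulrC divfK ?gt_eqF //; lra.
apply: (@le_trans _ _ (2 * (eps / 4) +
  (ee + KU.+1%:R ^+ 2 * ee + KV.+1%:R ^+ 2 * ee))%:E); last by rewrite lee_fin.
apply: (block_step_distance (clA := clA) (clB := clB)).
- by move=> i j; rewrite /e /edge_indicator; case: asbool; rewrite ?ler01 ?lexx.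
- move=> x y x1 y1.
  rewrite -[2 * _ * _]mulrA; apply: cut_double_avg => // {}x {}y {}x1 {}y1.
  rewrite exchange_big [n.+1%:R * _]mulrC; have := cutA y x y1 x1.
  congr (`| _ | <= _); apply: eq_bigr => b _; apply: eq_bigr => a _.
  by rewrite [y b * _]mulrC.
- apply: label_ratio; first exact: ltW.
  move=> a; have := nearU (u a) (Uu a); rewrite rsub_cat cU => /(_ isT).
  by rewrite csU.
- apply: label_ratio; first exact: ltW.
  move=> b; have := nearV (v b) (Vv b); rewrite rsub_cat cV => /(_ isT).
  by rewrite csV.
- move=> a b.
  (* The double average is constant on pairs of classes, so it can be evaluated at the vertices
     picked in [D]. *)
  have [a' eA DA] : exists2 a', clA a' = clA a &
      forall j, D (clA a) j = if [pick b | clB b == j] is Some b then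
        rE F (cat_val (cat_val (u a') (v b)) s) else 0.
    rewrite /D; case: pickP => [a' /eqP ea|/(_ a)]; last by rewrite eqxx.
    by exists a'.
  have [b' eB DB] : exists2 b', clB b' = clB b &
      D (clA a) (clB b) = rE F (cat_val (cat_val (u a') (v b')) s).
    rewrite DA; case: pickP => [b' /eqP eb|/(_ b)]; last by rewrite eqxx.
    by exists b'.
  have /= := nearE (u a') (v b') (Uu a') (Vv b').
  rewrite !(lsub_cat, rsub_cat) csU csV.
  have sA : (0 < class_size clA a')%N by have := class_size_gt0 R clA a'; rewrite ltr0n.
  have sB : (0 < class_size clB b')%N by have := class_size_gt0 R clB b'; rewrite ltr0n.
  rewrite muln_gt0 sA sB => /(_ isT).
  rewrite DB csE; congr (`| _ - _ | <= _).
  rewrite {1}/class_avg /class_avg -mulr_suml natrM invfM mulrA eA eB.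
  by rewrite /class_size eA eB mulrAC.
Qed.

End regular_limits.

(** * Accumulation points *)

(** One candidate is chosen per point to be represented; distinct points get distinct candidates
    because a candidate determines its class. *)
Lemma finite_accumulation (R : realType) (Tc : set (R * R -> R))
    (P : set (R * R -> R)) :
  finite_set Tc -> (forall W, Tc W -> is_graphon W) ->
  (forall W, P W -> is_graphon W /\ exists2 W', Tc W' & cut_distance W W' = 0%E) ->
  exists T : set (R * R -> R),
    [/\ finite_set T, T `<=` Tc & set_bij T [set graphon_class W | W in P] (@graphon_class R)].
Proof.
move=> fTc gTc hP; set Q := [set graphon_class W | W in P].
have rep (a : set (R * R -> R)) : exists W, Q a -> Tc W /\ graphon_class W = a.
  have [[W PW <-]|nQ] := pselect (Q a); last by exists (fun=> 0).
  have [gW [W' TW' d0]] := hP W PW; exists W' => _; split; first exact: TW'.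
  exact/esym/(graphon_class_eq gW (gTc _ TW') d0).
have [ch hch] := choice rep.
exists (ch @` Q); split.
- apply: sub_finite_set fTc => _ [a Qa <-]; exact: (hch a Qa).1.
- by move=> _ [a Qa <-]; exact: (hch a Qa).1.
- split.
  + by move=> _ [a Qa <-]; rewrite (hch a Qa).2.
  + move=> W W'; rewrite !inE => -[a Qa <-] [b Qb <-].
    by rewrite (hch a Qa).2 (hch b Qb).2 => ->.
  + by move=> a Qa; exists (ch a); [exists a|exact: (hch a Qa).2].
Qed.

Lemma finite_set_eps (R : realType) (X : Type) (Tc : set X) (f : X -> \bar R) :
  finite_set Tc -> (forall x, Tc x -> (0 < f x)%E) ->
  exists2 e : R, 0 < e & forall x, Tc x -> (e%:E < f x)%E.
Proof.
move=> /finite_param[u [uT _ usurj]] f0.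
have lower (y : \bar R) : (0 < y)%E -> exists2 e : R, 0 < e & (e%:E < y)%E.
  case: y => [r| |]//; last by exists 1; rewrite ?ltry.
  by rewrite lte_fin => r0; exists (r / 2); rewrite ?lte_fin; lra.
have low i : exists e : R, 0 < e /\ (e%:E < f (u i))%E.
  by have [e e0 ef] := lower _ (f0 _ (uT i I)); exists e.
have [h hh] := choice low.
exists (\big[Num.min/1]_i h i).
  by apply: lt_bigmin => // i _; case: (hh i).
move=> x /usurj[i _ <-]; apply: le_lt_trans (hh i).2.
by rewrite lee_fin bigmin_le_cond.
Qed.

Section accumulation.
Variables (R : realType) (L : language) (C : set (structure L)).
Variables (chi : structure L -> nat) (m : nat) (S : formula L m).
Variables (G : defgraph_over C S).
Hypotheses (asymp : asymptotic_class C chi)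
  (fin : graph_finite_relative_dimension chi G).

Lemma definable_fibre n (X : defset_over C S n) :
  definable2 C (fun F (x : 'I_n -> F) (s : 'I_m -> F) => fibre X s x).
Proof.
exists (do_map X) => F _ a.
by rewrite /fibre /points /= cat_sub.
Qed.

Lemma fibre_tame n (X : defset_over C S n) : finite_relative_dimension chi X ->
  tame C chi R (fun F => points F S) (fun F s => ncard (fibre X s)) /\
  for_large C chi (fun F => points F S) (fun F s => finite_set (fibre X s)).
Proof.
move=> [mu [d [asy dfin]]]; apply: (has_asymptotics_tame R asy).
by exists 0%N => F CF _ s; exact: dfin.
Qed.

(** A cluster graphon at positive distance from all candidates stays more than some [e] away from
    these finitely many. But a graph near it with large [chi] is also near a candidate, against the
    triangle inequality. *)
Lemma graph_limits : exists Tc : set (R * R -> R),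
  [/\ finite_set Tc, forall W, Tc W -> is_graphon W /\ is_stepfunction W &
    forall W, is_graphon W -> is_cluster_graphon chi G W ->
      exists2 W', Tc W' & cut_distance W W' = 0%E].
Proof.
have [fdU fdV _] := fin.
have [tU fU] := fibre_tame fdU; have [tV fV] := fibre_tame fdV.
have dE : definable3 C (fun F (u : 'I_(dg_nU G) -> F) (v : 'I_(dg_nV G) -> F)
    (s : 'I_m -> F) => fibre (dg_E G) s (cat_val u v)).
  by apply: definable_ext (definable_fibre (dg_E G)) => F _ a; rewrite cat_sub.
have [Tc [fTc gTc hTc]] := regular_limits asymp (definable_points C S)
  (definable_fibre (dg_U G)) (definable_fibre (dg_V G)) dE tU tV fU fV.
exists Tc; split=> // W gW clW.
have [//|ne] := pselect (exists2 W', Tc W' & cut_distance W W' = 0%E); exfalso.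
have [e e0 he] : exists2 e : R, 0 < e & forall W', Tc W' -> (e%:E < cut_distance W W')%E.
  apply: finite_set_eps fTc _ => W' TW'; rewrite lt_neqAle cut_distance_ge0 andbT.
  by apply/eqP => d0; apply: ne; exists W'.
(* Two distances of [e / 4], the second enlarged to [e / 2] for strictness, add up to less than
   [e]. *)
have e40 : 0 < e / 4 by rewrite divr_gt0.
have [N hN] := hTc (e / 4) e40.
have [F [CF NF [s Ss [W0 [n [l [u [v [ub vb WE]]]]] d0]]]] := clW (e / 4) N e40.
have [W' TW' dW'] := hN F CF NF s Ss n l u v ub vb.
have {}WE : W0 = block_kernel (edge_indicator R
    (fun F (u : 'I_(dg_nU G) -> F) (v : 'I_(dg_nV G) -> F)
      (s : 'I_m -> F) => fibre (dg_E G) s (cat_val u v)) u v s).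
  by apply/funext => z; rewrite WE.
rewrite -WE in dW'.
have g0 : is_graphon W0.
  rewrite WE; apply: block_kernel_graphon => i j.
  by rewrite /edge_indicator; case: asbool; rewrite ?ler01 ?lexx.
have gW' := (gTc W' TW').1.
have := he W' TW'; apply/negP; rewrite -leNgt; apply: ltW.
have h1 : (cut_distance W W0 < (e / 4)%:E)%E.
  exact: le_lt_trans (cut_distance_sym_le gW g0) d0.
have h2 : (cut_distance W0 W' < (e / 2)%:E)%E.
  by apply: le_lt_trans dW' _; rewrite lte_fin; lra.
apply: lt_le_trans (cut_distance_lt_add gW g0 gW' h1 h2) _.
by rewrite lee_fin; lra.
Qed.

End accumulation.

Theorem corollary5p6 (R : realType) (L : language) (C : set (structure L))
    (chi : structure L -> nat) (m : nat) (S : formula L m)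
    (G : defgraph_over C S) :
  asymptotic_class C chi ->
  graph_finite_relative_dimension chi G ->
  exists T : set (R * R -> R),
    [/\ finite_set T,
        forall W, T W -> is_graphon W /\ is_stepfunction W
      & set_bij T (accumulation_points chi G) (@graphon_class R)].
Proof.
move=> asymp fin; have [Tc [fTc gTc hTc]] := graph_limits R asymp fin.
have [|W [gW cW]|T [fT sT bT]] :=
    @finite_accumulation R Tc [set W | is_graphon W /\ is_cluster_graphon chi G W] fTc.
- by move=> W /gTc[].
- by split=> //; exact: hTc.
- by exists T; split=> // W /sT /gTc.
Qed.
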